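(* Let $\Gamma(z)=Cz+D$ ($z\in\mathbb{C}^n$) for some invertible matrix $C\in\mathcal{M}(n)$ with $\|C\|\le 1$ and some $D\in\mathbb{C}^n$, $D\neq 0$, and let $U$ be a holomorphic function on $\mathbb{C}^n$ such that $C_{U,\Gamma}$ is bounded on $F_\psi^2$. If the weighted composition operator $C_{U,\Gamma}$ is self-adjoint, then $$U(z)=\alpha K_{\Gamma(0),\psi}(z)\quad\text{for all } z\in\mathbb{C}^n,\quad\text{where }\alpha=c_{n-1}\overline{U(0)}\text{ is a real number},$$ and exactly one of the following holds: (i) $U(0)=0$, in which case $U\equiv 0$ and consequently $C_{U,\Gamma}\equiv 0$; (ii) $U(0)\neq 0$, in which case $C^*=C$ only if $C$ satisfies $$\sum_{r=n-1}^{\infty}\frac{r(r-1)\cdots(r-n+2)}{c_r}\langle (C^* )^{-1}D,D\rangle^{r-n+1}=\sum_{r=n-1}^{\infty}\frac{r(r-1)\cdots(r-n+2)}{c_r}\langle C^{-1}D,D\rangle^{r-n+1}.$$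
   Context: Let $n\ge 1$. On $\mathbb{C}^n$ write $\langle w,z\rangle=\sum_{j=1}^n w_j\overline{z_j}$ and $|w|^2=\langle w,w\rangle$. $\mathcal{M}(n)$ is the set of complex $n\times n$ matrices, $\|C\|$ is the operator norm of $C$ induced by $|\cdot|$, and $C^*$ is the conjugate transpose. Weight: $\psi:[0,\infty)\to[0,\infty)$ is a $C^3$ function with $\psi'(y)>0$, $\psi''(y)\ge 0$, $\psi'''(y)\ge 0$ for all $y\ge 0$. Moreover there is a real number $l<\tfrac12$ such that, with $\phi(y)=y\psi'(y)$, $\phi''(y)=O\big(y^{-1/2}[\phi'(y)]^{1+l}\big)$ as $y\to\infty$; when $n>1$ it is also assumed that $\psi''(y)=O\big(y^{-1/2}[\psi'(y)]^{1+l}\big)$ as $y\to\infty$. Put $c_r=\int_0^\infty s^re^{-\psi(s)}\,ds$ for $r\ge 0$. Space: $F_\psi^2$ is the Hilbert space of holomorphic functions $g:\mathbb{C}^n\to\mathbb{C}$ with $\int_{\mathbb{C}^n}|g(z)|^2e^{-\psi(|z|^2)}\,d\mu(z)<\infty$, with inner product $\langle g,h\rangle_\psi=\int_{\mathbb{C}^n} g(z)\overline{h(z)}e^{-\psi(|z|^2)}\,d\mu(z)$, where $\mu$ is $\frac{(n-1)!}{\pi^n}$ times standard Lebesgue measure on $\mathbb{C}^n$. Its reproducing kernel at $p\in\mathbb{C}^n$ (so $f(p)=\langle f,K_{p,\psi}\rangle_\psi$ for all $f\in F_\psi^2$) is $$K_{p,\psi}(z)=\frac{1}{(n-1)!}\sum_{r=n-1}^\infty\frac{r(r-1)\cdots(r-n+2)}{c_r}\langle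 z,p\rangle^{r-n+1}$$ (the product $r(r-1)\cdots(r-n+2)$ is $1$ when $n=1$). For holomorphic $U:\mathbb{C}^n\to\mathbb{C}$ and $\Gamma:\mathbb{C}^n\to\mathbb{C}^n$, the weighted composition operator is $C_{U,\Gamma}f=U\cdot(f\circ\Gamma)$. ''Bounded on $F_\psi^2$'' means that the operator maps $F_\psi^2$ into itself and is a bounded linear operator. *)

(* Defs.v *)
From HB Require Import structures.
From mathcomp Require Import all_boot all_order all_algebra.
From mathcomp Require Import all_classical all_reals all_analysis.
From mathcomp Require Import complex.
Set Implicit Arguments.
Unset Strict Implicit.
Unset Printing Implicit Defensive.
Import Order.TTheory GRing.Theory Num.Theory.
Import numFieldNormedType.Exports.
Local Open Scope classical_set_scope.
Local Open Scope ring_scope.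

(* Alias of m1 \x m2: the sigma-finite instance of the library for this term
   is shadowed by the one for subprobability measures. *)
Section sigma_prod.
Local Open Scope ereal_scope.
Context d1 d2 (T1 : measurableType d1) (T2 : measurableType d2) (R : realType).
Variables (m1 : {sigma_finite_measure set T1 -> \bar R})
          (m2 : {sigma_finite_measure set T2 -> \bar R}).

Definition sigma_prod : set (T1 * T2) -> \bar R := m1 \x m2.

HB.instance Definition _ := Measure.on sigma_prod.

Let sigma_prod_sigma_finite : sigma_finite setT sigma_prod.
Proof.
have /sigma_finiteP[F [TF ndF Foo]] := sigma_finiteT m1.
have /sigma_finiteP[G [TG ndG Goo]] := sigma_finiteT m2.
exists (fun n => F n `*` G n).
  rewrite -setXTT TF TG predeqE => -[x y]; split.
    move=> [/= [n _ Fnx] [k _ Gky]]; exists (maxn n k) => //; split.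
    - by move: x Fnx; exact/subsetPset/ndF/leq_maxl.
    - by move: y Gky; exact/subsetPset/ndG/leq_maxr.
  by move=> [n _ []/= ? ?]; split; exists n.
move=> k; have [? ?] := Foo k; have [? ?] := Goo k.
split; first exact: measurableX.
by rewrite /sigma_prod product_measure1E// lte_mul_pinfty// ge0_fin_numE.
Qed.

HB.instance Definition _ := Measure_isSigmaFinite.Build _ _ _ sigma_prod
  sigma_prod_sigma_finite.

End sigma_prod.

(* The product of m1 on T and m2 on T^n, transported to T^(n+1) along
   (x, t) |-> x :: t. *)
Section cons_measure.
Local Open Scope ereal_scope.
Context d (T : measurableType d) (R : realType) (n : nat).
Variables (m1 : {sigma_finite_measure set T -> \bar R})
          (m2 : {sigma_finite_measure set (n.-tuple T) -> \bar R}).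

Definition cons_pair (p : T * n.-tuple T) : n.+1.-tuple T :=
  [the n.+1.-tuple T of p.1 :: p.2].

Lemma measurable_cons_pair : measurable_fun [set: T * n.-tuple T] cons_pair.
Proof. exact: (measurable_cons measurable_fst measurable_snd). Qed.

Definition cons_measure : set (n.+1.-tuple T) -> \bar R :=
  pushforward (sigma_prod m1 m2) cons_pair.

Let cons_measure0 : cons_measure set0 = 0.
Proof. by rewrite /cons_measure /pushforward preimage_set0 measure0. Qed.

Let cons_measure_ge0 A : 0 <= cons_measure A.
Proof. exact: (measure_ge0 (sigma_prod m1 m2)). Qed.

Let cons_measure_sigma_additive : semi_sigma_additive cons_measure.
Proof.
move=> F mF tF mUF; rewrite /cons_measure /pushforward preimage_bigcup.
apply: measure_semi_sigma_additive.
- by move=> k; rewrite -[X in measurable X]setTI; exact: measurable_cons_pair.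
- apply/trivIsetP => /= i j _ _ ij; rewrite -preimage_setI.
  by move/trivIsetP : tF => /(_ _ _ _ _ ij) ->//; rewrite preimage_set0.
- rewrite -preimage_bigcup -[X in measurable X]setTI.
  exact: measurable_cons_pair.
Qed.

HB.instance Definition _ := isMeasure.Build _ _ _ cons_measure
  cons_measure0 cons_measure_ge0 cons_measure_sigma_additive.

Let cons_measure_sigma_finite : sigma_finite setT cons_measure.
Proof.
have [F TF mF] := sigma_finiteT (sigma_prod m1 m2).
pose g (t : n.+1.-tuple T) : T * n.-tuple T := (thead t, [tuple of behead t]).
have mg : measurable_fun [set: n.+1.-tuple T] g.
  apply/measurable_fun_pairP; split; last exact: measurable_behead.
  exact: measurable_tnth.
have gK p : g (cons_pair p) = p.
  by case: p => x t; rewrite /g /cons_pair/= theadE; congr pair; exact: val_inj.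
exists (fun k => g @^-1` F k).
  by rewrite -preimage_bigcup -TF preimage_setT.
move=> k; have [mFk Fkoo] := mF k; split.
  by rewrite -[X in measurable X]setTI; exact: mg.
rewrite /cons_measure /pushforward -comp_preimage.
by rewrite (_ : g \o cons_pair = id)//; apply/funext => p /=; exact: gK.
Qed.

HB.instance Definition _ := Measure_isSigmaFinite.Build _ _ _ cons_measure
  cons_measure_sigma_finite.

End cons_measure.

Fixpoint tuple_measure d (T : measurableType d) (R : realType)
    (m : {sigma_finite_measure set T -> \bar R}) (n : nat) :
    {sigma_finite_measure set (n.-tuple T) -> \bar R} :=
  match n with
  | 0 => \d_([tuple] : 0.-tuple T)
  | k.+1 => cons_measure m (tuple_measure m k)
  end.

Section Cn.
Variables (R : realType) (n : nat).
Implicit Types w z p : 'cV[R[i]]_n.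

Definition cdot w z : R[i] := \sum_(j < n) w j 0 * (z j 0)^*.

Definition cnorm2 w : R := complex.Re (cdot w w).

Definition cnorm w : R := Num.sqrt (cnorm2 w).

Definition opnorm (C : 'M[R[i]]_n) : R :=
  sup [set cnorm (C *m z) | z in [set z | cnorm z <= 1]].

Definition ctranspose (C : 'M[R[i]]_n) : 'M[R[i]]_n := map_mx Num.conj C^T.

Definition affine (C : 'M[R[i]]_n) (D : 'cV[R[i]]_n) z : 'cV[R[i]]_n :=
  C *m z + D.

(* Complex differentiability: the scalar field of both spaces is R[i]. *)
Definition holomorphic (g : 'cV[R[i]]_n -> R[i]) : Prop :=
  forall x, differentiable (g : 'cV[R[i]]_n -> R[i]^o) x.

(* The integration variable ranges over (R * R)^n; t stands for the vector
   of C^n with coordinates t_j.1 + i t_j.2. *)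
Definition cvec (t : n.-tuple (measurableTypeR R * measurableTypeR R)) :
    'cV[R[i]]_n :=
  \col_j Complex (tnth t j).1 (tnth t j).2.

Definition lebesgue_Cn :=
  tuple_measure (sigma_prod (@lebesgue_measure R) (@lebesgue_measure R)) n.

Let mu_factor_ge0 : 0 <= (n.-1)`!%:R / pi ^+ n :> R.
Proof. by rewrite divr_ge0// exprn_ge0// pi_ge0. Qed.

Definition mu_Cn := mscale (NngNum mu_factor_ge0) lebesgue_Cn.

End Cn.

Section halfline_derivative.
Variable R : realType.
Implicit Types f : R -> R.

(* Derivatives of functions on [0, +oo[, one-sided at 0; the values of f on
   negative reals are not used. *)
Definition hl_quotient f y : R -> R := fun h => h^-1 * (f (h + y) - f y).

Definition hl_filter (y : R) := within [set h : R | 0 <= h + y] 0^'.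

Definition hl_derivable f : Prop :=
  forall y, 0 <= y -> cvg (hl_quotient f y @ hl_filter y).

Definition hl_derive f (y : R) : R := lim (hl_quotient f y @ hl_filter y).

Definition hl_C3 f : Prop :=
  [/\ hl_derivable f, hl_derivable (hl_derive f),
      hl_derivable (hl_derive (hl_derive f)) &
      {within `[0, +oo[, continuous (hl_derive (hl_derive (hl_derive f)))}].

End halfline_derivative.

Definition pinfty_filter (R : realType) : filter_on R :=
  FilterType (pinfty_nbhs R) _.

Section weighted_space.
Variables (R : realType) (n : nat) (psi : R -> R).
Implicit Types (f g h U : 'cV[R[i]]_n -> R[i]) (p z : 'cV[R[i]]_n).
Implicit Types T : ('cV[R[i]]_n -> R[i]) -> ('cV[R[i]]_n -> R[i]).

Definition moment (r : nat) : R :=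
  \int[@lebesgue_measure R]_(s in `[0, +oo[) (s ^+ r * expR (- psi s)).

(* r ^_ n.-1 = r (r - 1) ... (r - n + 2) *)
Definition kernel_series (x : R[i]) : R[i] :=
  lim ((fun N => \sum_(n.-1 <= r < N)
    ((r ^_ n.-1)%:R / moment r)%:C%C * x ^+ (r - n.-1) : R[i]^o) @ \oo).

Definition rkernel p z : R[i] := (n.-1)`!%:R^-1 * kernel_series (cdot z p).

Definition weight z : R := expR (- psi (cnorm2 z)).

Definition in_F g : Prop :=
  holomorphic g /\
  (\int[@mu_Cn R n]_t (Normc.normc (g (cvec t)) ^+ 2 * weight (cvec t))%:E
     < +oo)%E.

Definition inner g h : R[i] :=
  let w t := g (cvec t) * (h (cvec t))^* * (weight (cvec t))%:C%C in
  Complex (\int[@mu_Cn R n]_t complex.Re (w t)) (\int[@mu_Cn R n]_t complex.Im (w t)).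

Definition Fnorm g : R := Num.sqrt (complex.Re (inner g g)).

Definition wcomp U (Gamma : 'cV[R[i]]_n -> 'cV[R[i]]_n) f z : R[i] :=
  U z * f (Gamma z).

Definition bounded_operator T : Prop :=
  [/\ forall f, in_F f -> in_F (T f),
      forall a f g, in_F f -> in_F g ->
        T (fun z => a * f z + g z) = (fun z => a * T f z + T g z) &
      exists M : R, forall f, in_F f -> Fnorm (T f) <= M * Fnorm f].

Definition self_adjoint T : Prop :=
  forall f g, in_F f -> in_F g -> inner (T f) g = inner f (T g).

End weighted_space.

(* Main.v *)
(* The kernels [q_k(z) = <z, p>^k] detect Taylor coefficients: for f in the
   space, [<f, q_k>] is a positive constant [A_k] times the k-th Fourier
   coefficient of [t |-> f (e^(2 i pi t) p)].  For f a polynomial and a weight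
   of bounded support this is the orthogonality of the monomials, computed in
   polar coordinates by Beta integrals; both sides are continuous for uniform
   approximation by polynomials on polydiscs, and the support is removed by
   dominated convergence.
   Write T for the operator, so that T 1 = U.  Self-adjointness gives
   [<U, q_k> = <1, T q_k>], which is the conjugate of [A_0 U(0) <D, p>^k], since
   taking the inner product with 1 evaluates at 0.  Hence the k-th homogeneous
   part of U at p is [(A_0 / A_k) conj(U(0)) <p, D>^k], the k-th term of
   [alpha K_D].  For k = 0 and p = 0 this reads U(0) = conj(U(0)). *)
Require Import Defs.
From mathcomp Require Import all_boot all_order all_algebra.
From mathcomp Require Import all_classical all_reals all_analysis.
From mathcomp Require Import complex zify ring lra measurable_realfun.
Import Order.TTheory GRing.Theory Num.Theory.
Import numFieldNormedType.Exports.
Local Open Scope classical_set_scope.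
Local Open Scope ring_scope.
Set Implicit Arguments.
Unset Strict Implicit.
Unset Printing Implicit Defensive.
Local Notation nc := Normc.normc.
Local Notation Re := (@complex.Re _).
Local Notation Im := (@complex.Im _).

(** * Complex-valued integrals *)

Section complex_modulus.
Variable R : realType.
Implicit Types x y z : R[i].

(** Self-adjointness is tested on powers of [cdot z p] and not on the kernel itself. These are
    polynomials, so finite moments put them in the space, and the convergence of the kernel series
    is later read off the Taylor expansion of U. The main obstacle is the reproduction formula for
    an arbitrary f of the space. [holomorphic] provides complex differentiability at each point and
    no continuity of the derivative, so Goursat's argument is carried out on a parameter square. In
    several variables the Taylor coefficients in one variable are integrals depending on the others;
    interpolation at scaled roots of unity has coefficients that are finite combinations of values
    of f, so the variables can be treated one by one. The same approximation shows that f is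
    measurable for the product structure on tuples. The radial variable is s = |z|^2: planar
    Lebesgue measure becomes pi ds in it, and the weight and its moments are expressed through it
    directly. *)

Lemma nc_normr x : `|x| = (nc x)%:C%C. Proof. by []. Qed.

Lemma nc_ge0 x : 0 <= nc x. Proof. by case: x => a b; exact: sqrtr_ge0. Qed.

Lemma ncD x y : nc (x + y) <= nc x + nc y.
Proof. by have := ler_normD x y; rewrite !nc_normr -rmorphD/= lecR. Qed.

Lemma ncM x y : nc (x * y) = nc x * nc y.
Proof. exact: Normc.normcM. Qed.

Lemma ncN x : nc (- x) = nc x.
Proof. by apply: complexI; rewrite -!nc_normr normrN. Qed.

Lemma ncB x y : nc (x - y) = nc (y - x).
Proof. by rewrite -ncN opprB. Qed.

Lemma ncX x k : nc (x ^+ k) = nc x ^+ k.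
Proof. by apply: complexI; rewrite rmorphXn/= -!nc_normr normrX. Qed.

Lemma nc0 : nc (0 : R[i]) = 0. Proof. exact: Normc.normc0. Qed.

Lemma nc1 : nc (1 : R[i]) = 1. Proof. exact: Normc.normc1. Qed.

Lemma ncV x : nc x^-1 = (nc x)^-1. Proof. exact: Normc.normcV. Qed.

Lemma nc_eq0 x : (nc x == 0) = (x == 0).
Proof. by rewrite -[LHS](inj_eq (@complexI R)) -nc_normr normr_eq0. Qed.

Lemma nc_gt0 x : (0 < nc x) = (x != 0).
Proof. by rewrite lt_neqAle eq_sym nc_eq0 nc_ge0 andbT. Qed.

Lemma ncC (a : R) : nc a%:C%C = `|a|.
Proof. by rewrite /= expr0n addr0 sqrtr_sqr. Qed.

Lemma nc_sum I (r : seq I) (P : pred I) (F : I -> R[i]) :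
  nc (\sum_(i <- r | P i) F i) <= \sum_(i <- r | P i) nc (F i).
Proof.
elim/big_ind2 : _ => //; first by rewrite nc0.
by move=> x a y b xa yb; rewrite (le_trans (ncD _ _))// lerD.
Qed.

Lemma nc_prod I (r : seq I) (P : pred I) (F : I -> R[i]) :
  nc (\prod_(i <- r | P i) F i) = \prod_(i <- r | P i) nc (F i).
Proof. exact: (big_morph _ ncM nc1). Qed.

Lemma cReD x y : Re (x + y) = Re x + Re y. Proof. by case: x y => ? ? []. Qed.
Lemma cImD x y : Im (x + y) = Im x + Im y. Proof. by case: x y => ? ? []. Qed.
Lemma cReN x : Re (- x) = - Re x. Proof. by case: x. Qed.
Lemma cImN x : Im (- x) = - Im x. Proof. by case: x. Qed.
Lemma cReM x y : Re (x * y) = Re x * Re y - Im x * Im y.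
Proof. by case: x y => ? ? []. Qed.
Lemma cImM x y : Im (x * y) = Re x * Im y + Im x * Re y.
Proof. by case: x y => ? ? []. Qed.

Lemma conjE x : (x^*)%R = Complex (Re x) (- Im x).
Proof. by case: x. Qed.

Lemma cRe_conj x : Re (x^*)%R = Re x. Proof. by rewrite conjE. Qed.
Lemma cIm_conj x : Im (x^*)%R = - Im x. Proof. by rewrite conjE. Qed.

Lemma nc_conj x : nc (x^*)%R = nc x.
Proof. by rewrite conjE; case: x => a b; rewrite /nc sqrrN. Qed.

Lemma nc_sqr x : nc x ^+ 2 = Re x ^+ 2 + Im x ^+ 2.
Proof. by case: x => a b; rewrite /nc sqr_sqrtr// addr_ge0// sqr_ge0. Qed.

Lemma mulr_conj x : x * (x^*)%R = (nc x ^+ 2)%:C%C.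
Proof.
rewrite nc_sqr conjE; case: x => a b; apply/eqP; rewrite eq_complex/=.
by apply/andP; split; apply/eqP; ring.
Qed.

Lemma Re_le_nc x : `|Re x| <= nc x.
Proof.
rewrite -(@ler_pXn2r _ 2)// ?nnegrE ?nc_ge0// nc_sqr real_normK ?num_real//.
by rewrite lerDl sqr_ge0.
Qed.

Lemma Im_le_nc x : `|Im x| <= nc x.
Proof.
rewrite -(@ler_pXn2r _ 2)// ?nnegrE ?nc_ge0// nc_sqr real_normK ?num_real//.
by rewrite lerDr sqr_ge0.
Qed.

Lemma nc_le_ReIm x : nc x <= `|Re x| + `|Im x|.
Proof.
rewrite -(@ler_pXn2r _ 2)// ?nnegrE ?nc_ge0 ?addr_ge0// nc_sqr sqrrD.
rewrite !real_normK ?num_real// -addrA lerD2l lerDr mulrn_wge0// mulr_ge0//.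
Qed.

End complex_modulus.

Section complex_integral.
Context d (T : measurableType d) (R : realType).
Variables (mu : {measure set T -> \bar R}) (D : set T) (mD : measurable D).
Implicit Types f g : T -> R[i].

Definition cmeasurable f :=
  measurable_fun D (Re \o f) /\ measurable_fun D (Im \o f).

Definition cintegrable f :=
  mu.-integrable D (EFin \o (Re \o f)) /\ mu.-integrable D (EFin \o (Im \o f)).

(** Taken by components exactly as in [inner], so that an inner product is by conversion a [cint]
    over [mu_Cn]. *)
Definition cint f : R[i] :=
  Complex (\int[mu]_(x in D) Re (f x)) (\int[mu]_(x in D) Im (f x)).

Lemma cmeasurableD f g : cmeasurable f -> cmeasurable g ->
  cmeasurable (fun x => f x + g x).
Proof.
move=> [f1 f2] [g1 g2]; split.
  apply: (eq_measurable_fun ((Re \o f) \+ (Re \o g))); last exact: measurable_funD.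
  by move=> x _ /=; rewrite cReD.
apply: (eq_measurable_fun ((Im \o f) \+ (Im \o g))); last exact: measurable_funD.
by move=> x _ /=; rewrite cImD.
Qed.

Lemma cmeasurableM f g : cmeasurable f -> cmeasurable g ->
  cmeasurable (fun x => f x * g x).
Proof.
move=> [f1 f2] [g1 g2]; split.
  apply: (eq_measurable_fun ((Re \o f) \* (Re \o g) \- (Im \o f) \* (Im \o g))).
    by move=> x _ /=; rewrite cReM.
  by apply: measurable_funB; exact: measurable_funM.
apply: (eq_measurable_fun ((Re \o f) \* (Im \o g) \+ (Im \o f) \* (Re \o g))).
  by move=> x _ /=; rewrite cImM.
by apply: measurable_funD; exact: measurable_funM.
Qed.

Lemma cmeasurable_cst c : cmeasurable (fun=> c).
Proof. by split; exact: measurable_cst. Qed.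

Lemma cmeasurable_conj f : cmeasurable f -> cmeasurable (fun x => ((f x)^*)%R).
Proof.
move=> [f1 f2]; split.
  by apply: eq_measurable_fun f1 => x _ /=; rewrite cRe_conj.
apply: (eq_measurable_fun (fun x => - (Im \o f) x)).
  by move=> x _ /=; rewrite cIm_conj.
exact: measurableT_comp.
Qed.

Lemma cmeasurableX f k : cmeasurable f -> cmeasurable (fun x => f x ^+ k).
Proof.
move=> mf; elim: k => [|k IH]; first exact: cmeasurable_cst.
by under eq_fun do rewrite exprS; exact: cmeasurableM.
Qed.

Lemma cmeasurable_real (h : T -> R) : measurable_fun D h ->
  cmeasurable (fun x => (h x)%:C%C).
Proof. by move=> mh; split => //=; exact: measurable_cst. Qed.

Lemma cmeasurable_sum I (s : seq I) (F : I -> T -> R[i]) :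
  (forall i, cmeasurable (F i)) -> cmeasurable (fun x => \sum_(i <- s) F i x).
Proof.
move=> mF; elim: s => [|i s IH].
  by under eq_fun do rewrite big_nil; exact: cmeasurable_cst.
by under eq_fun do rewrite big_cons; exact: cmeasurableD.
Qed.

Lemma cmeasurable_prod I (s : seq I) (F : I -> T -> R[i]) :
  (forall i, cmeasurable (F i)) -> cmeasurable (fun x => \prod_(i <- s) F i x).
Proof.
move=> mF; elim: s => [|i s IH].
  by under eq_fun do rewrite big_nil; exact: cmeasurable_cst.
by under eq_fun do rewrite big_cons; exact: cmeasurableM.
Qed.

Lemma cmeasurable_nc f : cmeasurable f -> measurable_fun D (fun x => nc (f x)).
Proof.
move=> [f1 f2].
apply: (eq_measurable_fun
    (fun x => Num.sqrt ((Re \o f) x ^+ 2 + (Im \o f) x ^+ 2))).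
  by move=> x _ /=; case: (f x).
apply: (@measurableT_comp _ _ _ _ _ _ (@Num.sqrt R)).
  by apply: continuous_measurable_fun; exact: sqrt_continuous.
by apply: measurable_funD; exact: measurable_funX.
Qed.

Lemma eq_cint f g : (forall x, D x -> f x = g x) -> cint f = cint g.
Proof.
by move=> fg; congr Complex; apply: eq_Rintegral => x; rewrite inE => /fg ->.
Qed.

Lemma cintegrable_dom f (g : T -> R) : cmeasurable f ->
  mu.-integrable D (EFin \o g) -> (forall x, D x -> nc (f x) <= g x) ->
  cintegrable f.
Proof.
move=> [f1 f2] ig fg; split; apply: le_integrable ig => //.
- exact/measurable_EFinP.
- move=> x Dx /=; rewrite lee_fin (le_trans (Re_le_nc _))// (le_trans (fg _ Dx))//.
  exact: ler_norm.
- exact/measurable_EFinP.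
- move=> x Dx /=; rewrite lee_fin (le_trans (Im_le_nc _))// (le_trans (fg _ Dx))//.
  exact: ler_norm.
Qed.

Lemma cintegrable_measurable f : cintegrable f -> cmeasurable f.
Proof. by move=> [/measurable_int/measurable_EFinP ? /measurable_int/measurable_EFinP]. Qed.

Lemma cintegrable_nc f : cintegrable f ->
  mu.-integrable D (EFin \o (fun x => nc (f x))).
Proof.
move=> fi; have [i1 i2] := fi.
have := integrableD mD (integrable_abse i1) (integrable_abse i2).
apply: le_integrable => //.
  exact/measurable_EFinP/cmeasurable_nc/cintegrable_measurable.
move=> x Dx /=; rewrite lee_fin ger0_norm ?nc_ge0// (le_trans (nc_le_ReIm _))//.
exact: ler_norm.
Qed.

Lemma cintegrableD f g : cintegrable f -> cintegrable g ->
  cintegrable (fun x => f x + g x).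
Proof.
move=> fi gi; apply: (cintegrable_dom (g := fun x => nc (f x) + nc (g x))).
- by apply: cmeasurableD; exact: cintegrable_measurable.
- exact: integrableD (cintegrable_nc fi) (cintegrable_nc gi).
- by move=> x _; exact: ncD.
Qed.

Lemma cintegrableZ c f : cintegrable f -> cintegrable (fun x => c * f x).
Proof.
move=> fi; apply: (cintegrable_dom (g := fun x => nc c * nc (f x))).
- apply: cmeasurableM; first exact: cmeasurable_cst.
  exact: cintegrable_measurable.
- exact: integrableZl (cintegrable_nc fi).
- by move=> x _; rewrite ncM.
Qed.

Lemma cintegrable0 : cintegrable (fun=> 0).
Proof. by split; exact: integrable0. Qed.

Lemma cintegrable_sum I (s : seq I) (F : I -> T -> R[i]) :
  (forall i, cintegrable (F i)) -> cintegrable (fun x => \sum_(i <- s) F i x).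
Proof.
move=> mF; elim: s => [|i s IH].
  by under eq_fun do rewrite big_nil; exact: cintegrable0.
by under eq_fun do rewrite big_cons; exact: cintegrableD.
Qed.

Lemma cintD f g : cintegrable f -> cintegrable g ->
  cint (fun x => f x + g x) = cint f + cint g.
Proof.
move=> [f1 f2] [g1 g2]; apply/eqP; rewrite eq_complex /=.
under eq_Rintegral do rewrite cReD.
under [X in _ && (X == _)]eq_Rintegral do rewrite cImD.
by rewrite !RintegralD// !eqxx.
Qed.

Lemma cintZ c f : cintegrable f -> cint (fun x => c * f x) = c * cint f.
Proof.
move=> [f1 f2]; apply/eqP; rewrite eq_complex /=.
under eq_Rintegral do rewrite cReM.
under [X in _ && (X == _)]eq_Rintegral do rewrite cImM.
have iZ k (h : T -> R) : mu.-integrable D (EFin \o h) ->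
    mu.-integrable D (EFin \o (fun x => k * h x)).
  by move=> ih; exact: (integrableZl mD k ih).
have iRf := iZ _ _ f1; have iIf := iZ _ _ f2.
rewrite RintegralB//.
rewrite RintegralD//.
rewrite !(RintegralZl _ mD f1) !(RintegralZl _ mD f2).
by case: c => a b /=; rewrite !eqxx.
Qed.

Lemma cint0 : cint (fun=> 0) = 0.
Proof. by rewrite /cint /= Rintegral_cst// mul0r. Qed.

Lemma cint_sum I (s : seq I) (F : I -> T -> R[i]) :
  (forall i, cintegrable (F i)) ->
  cint (fun x => \sum_(i <- s) F i x) = \sum_(i <- s) cint (F i).
Proof.
move=> mF; elim: s => [|i s IH].
  rewrite big_nil (@eq_cint _ (fun=> 0)) ?cint0// => x _.
  by rewrite big_nil.
rewrite big_cons -IH -cintD//; last exact: cintegrable_sum.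
by apply: eq_cint => x _; rewrite big_cons.
Qed.

Lemma cintB f g : cintegrable f -> cintegrable g ->
  cint (fun x => f x - g x) = cint f - cint g.
Proof.
move=> fi gi; rewrite -mulN1r -cintZ// -cintD//; last exact: cintegrableZ.
by apply: eq_cint => x _; rewrite mulN1r.
Qed.

Lemma cint_conj f : cintegrable f ->
  cint (fun x => ((f x)^*)%R) = ((cint f)^*)%R.
Proof.
move=> [f1 f2]; rewrite conjE /cint /=; congr Complex.
  by apply: eq_Rintegral => x _; rewrite cRe_conj.
under eq_Rintegral do rewrite cIm_conj -mulN1r.
by rewrite RintegralZl// mulN1r.
Qed.

Lemma cint_real (h : T -> R) :
  cint (fun x => (h x)%:C%C) = (\int[mu]_(x in D) h x)%:C%C.
Proof. by rewrite /cint /= Rintegral_cst// mul0r. Qed.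

(** The factor 2 comes from bounding the two components separately; the estimates below only need
    some absolute constant. *)
Lemma nc_cint_le f (g : T -> R) : cmeasurable f ->
  mu.-integrable D (EFin \o g) -> (forall x, D x -> nc (f x) <= g x) ->
  nc (cint f) <= 2 * \int[mu]_(x in D) g x.
Proof.
move=> mf ig fg; have [f1 f2] := cintegrable_dom mf ig fg.
rewrite (le_trans (nc_le_ReIm _))// mulr_natl mulr2n lerD//=.
  rewrite (le_trans (le_normr_Rintegral mD f1))// le_Rintegral//.
    exact: integrable_norm.
  by move=> x Dx /=; rewrite (le_trans (Re_le_nc _))// fg.
rewrite (le_trans (le_normr_Rintegral mD f2))// le_Rintegral//.
  exact: integrable_norm.
by move=> x Dx /=; rewrite (le_trans (Im_le_nc _))// fg.
Qed.

End complex_integral.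

(** * Goursat's bisection argument *)

Section square_bisection.
Variable R : realType.
Implicit Types (Q : R -> R -> R -> R).

(** If each quarter carried less than a fourth of the value, the triangle inequality would
    contradict additivity. *)
Lemma square_split_ge Q x y h :
  Q x y h = Q x y (h / 2) + Q (x + h / 2) y (h / 2) +
            Q x (y + h / 2) (h / 2) + Q (x + h / 2) (y + h / 2) (h / 2) ->
  exists ab : bool * bool,
    `|Q x y h| <= 4 * `|Q (x + ab.1%:R * (h / 2)) (y + ab.2%:R * (h / 2)) (h / 2)|.
Proof.
move=> Qadd; apply: contrapT => /forallNP/= H.
have lt4 (a b : bool) : 4 * `|Q (x + a%:R * (h / 2)) (y + b%:R * (h / 2)) (h / 2)| <
    `|Q x y h| by rewrite ltNge; apply/negP; exact: (H (a, b)).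
have := lt4 false false; have := lt4 true false.
have := lt4 false true; have := lt4 true true.
rewrite !mul0r !mul1r !addr0 => h1 h2 h3 h4.
have := Qadd; move: h1 h2 h3 h4.
move: (Q x y (h / 2)) (Q (x + h / 2) y (h / 2)) => p q.
move: (Q x (y + h / 2) (h / 2)) (Q (x + h / 2) (y + h / 2) (h / 2)) => r s.
move=> h1 h2 h3 h4 E.
have := ler_normD (p + q + r) s; have := ler_normD (p + q) r.
have := ler_normD p q; rewrite -E; lra.
Qed.

(** [Q] is any additive function of squares, given by lower left corner and side. Repeated halving
    produces squares of side 2^-k that shrink to a point and still carry 4^-k of [|Q 0 0 1|], which
    a bound [e * h ^+ 2] near that point contradicts for small [e]. The limit point may lie on the
    boundary of the squares, hence the non-strict inequalities. *)
Lemma square_goursat Q :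
  (forall x y h, Q x y h =
     Q x y (h / 2) + Q (x + h / 2) y (h / 2) +
     Q x (y + h / 2) (h / 2) + Q (x + h / 2) (y + h / 2) (h / 2)) ->
  (forall x0 y0 : R, 0 <= x0 <= 1 -> 0 <= y0 <= 1 -> forall e : R, 0 < e ->
     exists2 dl : R, 0 < dl & forall x y h : R, 0 < h < dl ->
       0 <= x -> x <= x0 <= x + h -> x + h <= 1 ->
       0 <= y -> y <= y0 <= y + h -> y + h <= 1 -> `|Q x y h| <= e * h ^+ 2) ->
  Q 0 0 1 = 0.
Proof.
move=> Qadd Qloc.
have /choice[nx nxP] : forall p : R * R * R, exists ab : bool * bool,
    `|Q p.1.1 p.1.2 p.2| <= 4 * `|Q (p.1.1 + ab.1%:R * (p.2 / 2))
                                   (p.1.2 + ab.2%:R * (p.2 / 2)) (p.2 / 2)|.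
  by move=> p; exact: square_split_ge.
pose step (p : R * R * R) := (p.1.1 + (nx p).1%:R * (p.2 / 2),
                              p.1.2 + (nx p).2%:R * (p.2 / 2), p.2 / 2).
pose u k := iter k step (0, 0, 1).
have hk k : (u k).2 = 2^-1 ^+ k.
  by elim: k => [|k IH]; rewrite ?expr0// /u iterS -/(u k) /= IH exprSr.
have hk0 k : 0 < (u k).2 by rewrite hk exprn_gt0// invr_gt0.
have b01 (b : bool) : 0 <= (b%:R : R) <= 1 by case: b; rewrite ?lexx ?ler01.
(* [f] and [g] select one coordinate, so the nested-interval argument is made once for both axes.
   The limit is the supremum of the left ends. *)
have coord (f : R * R -> R) (g : bool * bool -> bool) :
    f (0, 0) = 0 -> (forall p, f (step p).1 = f p.1 + (g (nx p))%:R * (p.2 / 2)) ->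
    exists x0, 0 <= x0 <= 1 /\
      forall k, 0 <= f (u k).1 /\ f (u k).1 <= x0 <= f (u k).1 + (u k).2 /\
                f (u k).1 + (u k).2 <= 1.
  move=> f0 fS.
  have S k : f (u k).1 <= f (u k.+1).1 /\
             f (u k.+1).1 + (u k.+1).2 <= f (u k).1 + (u k).2.
    rewrite /u iterS -/(u k) fS /=; have /andP[b0 b1] := b01 (g (nx (u k))).
    have := hk0 k; split; first by rewrite lerDl mulr_ge0// divr_ge0// ltW.
    rewrite -addrA lerD2l.
    have : (g (nx (u k)))%:R * ((u k).2 / 2) <= 1 * ((u k).2 / 2).
      by rewrite ler_wpM2r// divr_ge0// ltW.
    lra.
  have M j k : (j <= k)%N -> f (u j).1 <= f (u k).1 /\
             f (u k).1 + (u k).2 <= f (u j).1 + (u j).2.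
    move=> /subnK <-; elim: (k - j)%N => [|i [IH1 IH2]] //.
    rewrite addSn; have [S1 S2] := S (i + j)%N.
    by rewrite (le_trans IH1)// (le_trans S2).
  pose X := [set f (u k).1 | k in [set: nat]].
  have ubX k : ubound X (f (u k).1 + (u k).2).
    move=> _ [j _ <-]; have [jk|kj] := leqP j k.
      have [M1 _] := M _ _ jk; rewrite (le_trans M1)// lerDl ltW//.
    have [_ M2] := M _ _ (ltnW kj); rewrite (le_trans _ M2)// lerDl ltW//.
  have hsX : has_sup X by split; [exists (f (u 0%N).1); exists 0%N|exists (f (u 0%N).1 + (u 0%N).2)].
  have lo k : f (u k).1 <= sup X by apply: sup_ubound; [exact: hsX.2|exists k].
  have hi k : sup X <= f (u k).1 + (u k).2 by apply: ge_sup => //; exact: hsX.1.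
  have u0 : f (u 0%N).1 = 0 by [].
  exists (sup X); split.
    have := lo 0%N; have := hi 0%N; rewrite u0 add0r /= => -> ->//.
  move=> k; have [M1 M2] := M 0%N k (leq0n k).
  rewrite lo hi; split; first by rewrite -u0.
  by split=> //; rewrite (le_trans M2)// u0 add0r.
have [x0 [x01 Hx]] := coord fst fst erefl (fun=> erefl).
have [y0 [y01 Hy]] := coord snd snd erefl (fun=> erefl).
apply/eqP; rewrite -normr_eq0; apply/eqP/le_anti; rewrite normr_ge0 andbT.
rewrite leNgt; apply/negP => c0.
have Qk k : `|Q 0 0 1| <= 4 ^+ k * `|Q (u k).1.1 (u k).1.2 (u k).2|.
  elim: k => [|k IH]; first by rewrite expr0 mul1r.
  rewrite (le_trans IH)// exprSr -mulrA ler_wpM2l ?exprn_ge0//.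
(* With [e] half of [|Q 0 0 1|], the power of 4 cancels against the squared side and [|Q 0 0 1|] is
   at most half of itself. *)
have [dl dl0 H] := Qloc x0 y0 x01 y01 (`|Q 0 0 1| / 2) ltac:(by rewrite divr_gt0).
have [k kdl] : exists k, (u k).2 < dl.
  have /cvgrPdist_lt/(_ _ dl0)[k _ /(_ k (leqnn k))] := @cvg_expr R 2^-1 ltac:(by rewrite ger0_norm ?invr_ge0// invf_lt1// ltr1n).
  rewrite /= sub0r normrN ger0_norm ?exprn_ge0 ?invr_ge0// => kdl.
  by exists k; rewrite hk.
have [x1 [x2 x3]] := Hx k; have [y1 [y2 y3]] := Hy k.
have := H _ _ _ (introT andP (conj (hk0 k) kdl)) x1 x2 x3 y1 y2 y3 => Hk.
have := le_trans (Qk k) (ler_wpM2l (exprn_ge0 k (ler0n R 4)) Hk).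
rewrite hk -!exprM mulnC exprM (_ : 2^-1 ^+ 2 = 4^-1 :> R); last by field.
rewrite mulrCA -exprMn divff ?expr1n ?mulr1 ?pnatr_eq0//.
lra.
Qed.

End square_bisection.

(** * Calculus along paths in the complex plane *)

Section complex_paths.
Variable R : realType.
Implicit Types (phi : R -> R[i]) (f g : R -> R) (q : R[i] -> R[i]).

Definition pcont phi :=
  continuous (fun t => Re (phi t)) /\ continuous (fun t => Im (phi t)).

Definition pderiv phi (t : R) (d : R[i]) :=
  is_derive t 1 (fun s => Re (phi s)) (Re d) /\
  is_derive t 1 (fun s => Im (phi s)) (Im d).

(** Stated with the real modulus [nc], since the norm of [R[i]] and the radii of its balls are
    themselves elements of [R[i]]. *)
Definition ccont q := forall w (e : R), 0 < e -> exists2 dl : R, 0 < dl &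
  forall w', nc (w' - w) < dl -> nc (q w' - q w) < e.

Lemma pcont_cst c : pcont (fun=> c).
Proof. by split=> t; exact: cvg_cst. Qed.

Lemma pcontD phi psi : pcont phi -> pcont psi -> pcont (fun t => phi t + psi t).
Proof.
move=> [a1 a2] [b1 b2]; split => t.
  under eq_fun do rewrite cReD; exact: cvgD (a1 t) (b1 t).
under eq_fun do rewrite cImD; exact: cvgD (a2 t) (b2 t).
Qed.

Lemma pcontM phi psi : pcont phi -> pcont psi -> pcont (fun t => phi t * psi t).
Proof.
move=> [a1 a2] [b1 b2]; split => t.
  under eq_fun do rewrite cReM.
  exact: cvgB (cvgM (a1 t) (b1 t)) (cvgM (a2 t) (b2 t)).
under eq_fun do rewrite cImM.
exact: cvgD (cvgM (a1 t) (b2 t)) (cvgM (a2 t) (b1 t)).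
Qed.

Lemma pcont_conj phi : pcont phi -> pcont (fun t => ((phi t)^*)%R).
Proof.
move=> [a1 a2]; split => t.
  under eq_fun do rewrite cRe_conj; exact: a1.
under eq_fun do rewrite cIm_conj; exact: cvgN (a2 t).
Qed.

Lemma pcontX phi k : pcont phi -> pcont (fun t => phi t ^+ k).
Proof.
move=> mf; elim: k => [|k IH]; first exact: pcont_cst.
by under eq_fun do rewrite exprS; exact: pcontM.
Qed.

Lemma pcont_real f : continuous f -> pcont (fun t => (f t)%:C%C).
Proof. by move=> cf; split => //= t; exact: cvg_cst. Qed.

Lemma ccont_path q phi : ccont q -> pcont phi -> pcont (fun t => q (phi t)).
Proof.
move=> cq [a1 a2].
have H t e : 0 < e -> \forall s \near t, nc (q (phi s) - q (phi t)) < e.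
  move=> e0; have [dl dl0 H] := cq (phi t) e e0.
  have dl2 : 0 < dl / 2 by rewrite divr_gt0.
  near=> s; apply: H; rewrite (le_lt_trans (nc_le_ReIm _))//.
  rewrite (_ : dl = dl / 2 + dl / 2); last by field.
  rewrite cReD cReN cImD cImN ltrD// distrC.
    by near: s; move/cvgrPdist_lt: (a1 t); apply.
  by near: s; move/cvgrPdist_lt: (a2 t); apply.
split=> t; apply/cvgrPdist_lt => e e0; near=> s.
  rewrite distrC (_ : _ - _ = Re (q (phi s) - q (phi t))) ?cReD ?cReN//.
  by rewrite -cReN -cReD (le_lt_trans (Re_le_nc _))//; near: s; exact: H.
rewrite distrC (_ : _ - _ = Im (q (phi s) - q (phi t))) ?cImD ?cImN//.
by rewrite -cImN -cImD (le_lt_trans (Im_le_nc _))//; near: s; exact: H.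
Unshelve. all: by end_near. Qed.

Lemma is_derive1D f g (t df dg : R) : is_derive t 1 f df -> is_derive t 1 g dg ->
  is_derive t 1 (fun s => f s + g s) (df + dg).
Proof. exact: is_deriveD. Qed.

Lemma is_derive1B f g (t df dg : R) : is_derive t 1 f df -> is_derive t 1 g dg ->
  is_derive t 1 (fun s => f s - g s) (df - dg).
Proof. exact: is_deriveB. Qed.

Lemma is_derive1M f g (t df dg : R) : is_derive t 1 f df -> is_derive t 1 g dg ->
  is_derive t 1 (fun s => f s * g s) (df * g t + f t * dg).
Proof.
move=> hf hg; have := is_deriveM hf hg; rewrite /GRing.scale /= addrC.
by rewrite [X in _ -> is_derive _ _ _ (X + _)]mulrC.
Qed.

Lemma pderiv_cst c t : pderiv (fun=> c) t 0.
Proof. by split; exact: is_derive_cst. Qed.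

Lemma pderivD phi psi t a b : pderiv phi t a -> pderiv psi t b ->
  pderiv (fun s => phi s + psi s) t (a + b).
Proof.
move=> [a1 a2] [b1 b2]; split.
  under eq_fun do rewrite cReD; rewrite cReD; exact: is_derive1D.
under eq_fun do rewrite cImD; rewrite cImD; exact: is_derive1D.
Qed.

Lemma pderivM phi psi t a b : pderiv phi t a -> pderiv psi t b ->
  pderiv (fun s => phi s * psi s) t (a * psi t + phi t * b).
Proof.
move=> [a1 a2] [b1 b2]; split.
  under eq_fun do rewrite cReM.
  rewrite (_ : Re _ = (Re a * Re (psi t) + Re (phi t) * Re b) -
                      (Im a * Im (psi t) + Im (phi t) * Im b)).
    by apply: is_derive1B; exact: is_derive1M.
  by rewrite cReD !cReM; ring.
under eq_fun do rewrite cImM.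
rewrite (_ : Im _ = (Re a * Im (psi t) + Re (phi t) * Im b) +
                    (Im a * Re (psi t) + Im (phi t) * Re b)).
  by apply: is_derive1D; exact: is_derive1M.
by rewrite cImD !cImM; ring.
Qed.

Lemma pderiv_real f (t df : R) : is_derive t 1 f df ->
  pderiv (fun s => (f s)%:C%C) t df%:C%C.
Proof. by move=> h; split => //=; exact: is_derive_cst. Qed.

Lemma pderiv_eq phi t a b : pderiv phi t a -> a = b -> pderiv phi t b.
Proof. by move=> h <-. Qed.

Lemma is_derive1_continuous f (t df : R) : is_derive t 1 f df -> {for t, continuous f}.
Proof.
by move=> [h _]; apply/differentiable_continuous/derivable1_diffP.
Qed.

Lemma pderiv_pcont phi (phi' : R -> R[i]) :
  (forall t, pderiv phi t (phi' t)) -> pcont phi.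
Proof.
move=> h; split => t; have [h1 h2] := h t.
  exact: is_derive1_continuous h1.
exact: is_derive1_continuous h2.
Qed.

Lemma ler_incr_derive f f' (a b K : R) : a <= b ->
  (forall x, a <= x <= b -> is_derive x 1 f (f' x)) ->
  (forall x, a <= x <= b -> `|f' x| <= K) -> `|f b - f a| <= K * (b - a).
Proof.
move=> ab df bf.
have [||c cab ->] := @MVT_segment _ f f' a b ab.
- by move=> x /itvP xab; apply: df; rewrite !xab.
- apply: derivable_within_continuous => x /itvP xab.
  by apply: ex_derive; apply: df; rewrite !xab.
rewrite normrM (ger0_norm (_ : 0 <= b - a)) ?subr_ge0// ler_wpM2r ?subr_ge0//.
by apply: bf; rewrite !(itvP cab).
Qed.

Lemma Rintegral_FTC f F (a b : R) : a < b -> continuous f ->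
  (forall x, a <= x <= b -> is_derive x 1 F (f x)) ->
  \int[lebesgue_measure]_(x in `[a, b]) f x = F b - F a.
Proof.
move=> ab cf dF; rewrite /Rintegral (@continuous_FTC2 _ f F)//.
- exact: continuous_subspaceT.
- split.
  + by move=> x /itvP xab; apply: ex_derive; apply: dF; rewrite !ltW// xab.
  + apply: cvg_at_right_filter; apply: is_derive1_continuous (dF a _).
    by rewrite lexx ltW.
  + apply: cvg_at_left_filter; apply: is_derive1_continuous (dF b _).
    by rewrite lexx ltW.
- move=> x /itvP xab; rewrite derive1E; apply: derive_val; apply: dF.
  by rewrite !ltW// xab.
Qed.

Lemma continuous_integrable f (a b : R) : continuous f ->
  lebesgue_measure.-integrable `[a, b] (EFin \o f).
Proof.
move=> cf; apply: continuous_compact_integrable; first exact: segment_compact.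
exact: continuous_subspaceT.
Qed.

(** Integrating from -1 makes the derivative two-sided around all of [0, 1], endpoints included. *)
Lemma primitive_exists f : continuous f ->
  exists F, forall x : R, -1 < x < 2 -> is_derive x 1 F (f x).
Proof.
move=> cf; exists (fun x => \int[lebesgue_measure]_(t in `[-1, x]) f t).
move=> x /andP[x1 x2].
have [d1 d2] := @continuous_FTC1_closed R f (-1) x 2 x2
  (continuous_integrable _ _ cf) x1 (cf x).
by have := derivableP d1; rewrite -derive1E d2.
Qed.

End complex_paths.

(** * Goursat's lemma for the pullback of a 1-form *)

Section goursat.
Variable R : realType.

Definition cdiff (q : R[i] -> R[i]) (w d : R[i]) := forall e : R, 0 < e ->
  exists2 dl : R, 0 < dl & forall w', nc (w' - w) < dl ->
    nc (q w' - q w - d * (w' - w)) <= e * nc (w' - w).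

Lemma pderiv_lipschitz (phi phi' : R -> R[i]) (a b L : R) :
  0 <= a <= 1 -> 0 <= b <= 1 ->
  (forall t, pderiv phi t (phi' t)) ->
  (forall t, 0 <= t <= 1 -> nc (phi' t) <= L) ->
  nc (phi b - phi a) <= 2 * L * `|b - a|.
Proof.
move=> a01 b01 dphi bphi.
wlog ab : a b a01 b01 / a <= b.
  move=> H; have [/H|/ltW/H] := leP a b; first exact.
  by rewrite distrC ncB; exact.
rewrite (le_trans (nc_le_ReIm _))// (ger0_norm (_ : 0 <= b - a)) ?subr_ge0//.
rewrite cReD cReN cImD cImN -mulrA mulr_natl mulr2n lerD//.
  apply: (@ler_incr_derive _ (fun t => Re (phi t)) (fun t => Re (phi' t))) => //.
    by move=> x _; have [] := dphi x.
  move=> x xab; rewrite (le_trans (Re_le_nc _))// bphi//; lra.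
apply: (@ler_incr_derive _ (fun t => Im (phi t)) (fun t => Im (phi' t))) => //.
  by move=> x _; have [] := dphi x.
move=> x xab; rewrite (le_trans (Im_le_nc _))// bphi//; lra.
Qed.

(** Boundary integral of a 1-form over a square, bottom minus top plus right minus left. [PA] and
    [PB] are primitives of the form along horizontal and vertical lines, so additivity under
    subdivision is a polynomial identity and no integral has to be split. *)
Definition circulation (PA PB : R -> R -> R) (x y h : R) :=
  ((PA (x + h) y - PA x y) - (PA (x + h) (y + h) - PA x (y + h))) +
  ((PB (x + h) (y + h) - PB (x + h) y) - (PB x (y + h) - PB x y)).

(* The pullback of the 1-form [q dw] along [Phi] differs on a small square
   from an exact form by a term of the second order in the size of the square;
   only the differentiability of [q] is used, not the continuity of [q']. *)
Lemma goursat_pullback (q : R[i] -> R[i]) (Phi Phis Phit : R -> R -> R[i])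
    (L : R) (c : R[i]) (PA PB : R -> R -> R) : 0 < L ->
  (forall s t, pderiv (fun x => Phi x t) s (Phis s t)) ->
  (forall s t, pderiv (fun x => Phi s x) t (Phit s t)) ->
  (forall s t, 0 <= s <= 1 -> 0 <= t <= 1 -> nc (Phis s t) <= L) ->
  (forall s t, 0 <= s <= 1 -> 0 <= t <= 1 -> nc (Phit s t) <= L) ->
  (forall s t, 0 <= s <= 1 -> 0 <= t <= 1 -> exists d, cdiff q (Phi s t) d) ->
  (forall s t : R, -1 < s < 2 ->
    is_derive s 1 (fun x => PA x t) (Re (c * (q (Phi s t) * Phis s t)))) ->
  (forall s t : R, -1 < t < 2 ->
    is_derive t 1 (PB s) (Re (c * (q (Phi s t) * Phit s t)))) ->
  circulation PA PB 0 0 1 = 0.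
Proof.
move=> L0 dPs dPt bPs bPt dq dPA dPB.
apply: square_goursat.
  move=> x y h; rewrite /circulation.
  rewrite (_ : x + h / 2 + h / 2 = x + h); last by field.
  rewrite (_ : y + h / 2 + h / 2 = y + h); last by field.
  ring.
move=> x0 y0 x01 y01 e e0.
have [d dP] := dq _ _ x01 y01.
set w0 := Phi x0 y0 in dP; set al := q w0 in dP.
(* Sixteen is 4 for the sides of the square times the 4 in the bound [4 * L * h] on the distance to
   [w0]. One [L] comes from that bound, the other from the velocity of [Phi]; [nc c + 1] replaces
   [nc c] to be positive. *)
pose eta := e / (16 * (nc c + 1) * L ^+ 2).
have nc1 : 0 < nc c + 1 by rewrite ltr_wpDl// nc_ge0.
have eta0 : 0 < eta by rewrite divr_gt0// !mulr_gt0// exprn_gt0.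
have [dl1 dl10 H1] := dP eta eta0.
exists (dl1 / (4 * L)); first by rewrite divr_gt0// mulr_gt0.
move=> x y h /andP[h0 hdl] x0' xx x1 y0' yy y1.
have near_w0 s t : x <= s <= x + h -> y <= t <= y + h ->
    nc (Phi s t - w0) <= 4 * L * h.
  move=> sx ty.
  have -> : Phi s t - w0 = (Phi s t - Phi x0 t) + (Phi x0 t - w0) by ring.
  rewrite (le_trans (ncD _ _))//.
  have -> : 4 * L * h = 2 * L * h + 2 * L * h by ring.
  apply: lerD.
    apply: (@le_trans _ _ (2 * L * `|s - x0|)).
      apply: (pderiv_lipschitz (phi := fun x => Phi x t)
        (phi' := fun x => Phis x t)) => //; first by lra.
      by move=> u u01; apply: bPs => //; lra.
    by rewrite ler_wpM2l ?mulr_ge0 ?(ltW L0)// ler_norml; lra.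
  apply: (@le_trans _ _ (2 * L * `|t - y0|)).
    apply: (pderiv_lipschitz (phi := Phi x0) (phi' := Phit x0)) => //; first by lra.
    by move=> u u01; exact: bPt.
  by rewrite ler_wpM2l ?mulr_ge0 ?(ltW L0)// ler_norml; lra.
(* [F] is a primitive of [c] times the first-order expansion of [q] at [w0]. Subtracting its
   pullback [W] from both [PA] and [PB] does not change the circulation, and leaves only the
   remainder of [q] to estimate. *)
pose F w := c * (al * w + d * (2^-1)%:C%C * ((w - w0) * (w - w0))).
pose W s t := Re (F (Phi s t)).
have dF phi t phi't : pderiv phi t phi't ->
    pderiv (fun s => F (phi s)) t (c * ((al + d * (phi t - w0)) * phi't)).
  move=> dphi.
  have dw : pderiv (fun s => phi s - w0) t phi't.
    by apply: pderiv_eq (pderivD dphi (pderiv_cst _ _)) _; rewrite addr0.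
  apply: pderiv_eq.
    apply: pderivM (pderiv_cst c t) (pderivD (pderivM (pderiv_cst al t) dphi)
      (pderivM (pderiv_cst (d * (2^-1)%:C%C) t) (pderivM dw dw))).
  have h2 : (2^-1)%:C%C + (2^-1)%:C%C = 1 :> R[i].
    by rewrite -rmorphD/= -[LHS]/((2^-1 + 2^-1)%:C%C) (_ : 2^-1 + 2^-1 = 1 :> R)//; field.
  rewrite [in RHS](_ : d = d * ((2^-1)%:C%C + (2^-1)%:C%C)); last by rewrite h2 mulr1.
  ring.
have small s t v : x <= s <= x + h -> y <= t <= y + h -> nc v <= L ->
    `|Re (c * (q (Phi s t) * v)) - Re (c * ((al + d * (Phi s t - w0)) * v))| <=
    e / 4 * h.
  move=> sx ty vL; rewrite -cReN -cReD (le_trans (Re_le_nc _))//.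
  have -> : c * (q (Phi s t) * v) - c * ((al + d * (Phi s t - w0)) * v) =
            c * ((q (Phi s t) - al - d * (Phi s t - w0)) * v) by ring.
  have nw := near_w0 _ _ sx ty.
  have := H1 (Phi s t) (le_lt_trans nw _).
  rewrite -(ltr_pdivlMl _ _ (_ : 0 < 4 * L)) ?mulr_gt0// mulrC => /(_ hdl) Hq.
  rewrite !ncM.
  apply: (@le_trans _ _ ((nc c + 1) * (eta * (4 * L * h) * L))).
    apply: ler_pM; rewrite ?nc_ge0 ?mulr_ge0 ?nc_ge0//; first by rewrite lerDl.
    apply: ler_pM; rewrite ?nc_ge0//.
    by rewrite (le_trans Hq)// ler_wpM2l// ltW.
  rewrite le_eqVlt; apply/orP; left; apply/eqP; rewrite /eta; field.
  by rewrite (lt0r_neq0 nc1) (lt0r_neq0 L0).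
have -> : circulation PA PB x y h =
  circulation (fun s t => PA s t - W s t) (fun s t => PB s t - W s t) x y h.
  by rewrite /circulation; ring.
have incA t : y <= t <= y + h ->
    `|(PA (x + h) t - W (x + h) t) - (PA x t - W x t)| <= e / 4 * h * h.
  move=> ty; have -> : e / 4 * h * h = e / 4 * h * (x + h - x) by ring.
  apply: (@ler_incr_derive _ (fun s => PA s t - W s t)
    (fun s => Re (c * (q (Phi s t) * Phis s t)) -
              Re (c * ((al + d * (Phi s t - w0)) * Phis s t)))); first by lra.
    move=> s sx; apply: is_derive1B; first by apply: dPA; lra.
    by have [] := dF _ _ _ (dPs s t).
  by move=> s sx; apply: small => //; apply: bPs; lra.
have incB s : x <= s <= x + h ->
    `|(PB s (y + h) - W s (y + h)) - (PB s y - W s y)| <= e / 4 * h * h.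
  move=> sx; have -> : e / 4 * h * h = e / 4 * h * (y + h - y) by ring.
  apply: (@ler_incr_derive _ (fun t => PB s t - W s t)
    (fun t => Re (c * (q (Phi s t) * Phit s t)) -
              Re (c * ((al + d * (Phi s t - w0)) * Phit s t)))); first by lra.
    move=> t ty; apply: is_derive1B; first by apply: dPB; lra.
    by have [] := dF _ _ _ (dPt s t).
  by move=> t ty; apply: small => //; apply: bPt; lra.
have A1 := incA y ltac:(lra); have A2 := incA (y + h) ltac:(lra).
have B1 := incB x ltac:(lra); have B2 := incB (x + h) ltac:(lra).
rewrite /circulation (le_trans (ler_normD _ _))//.
rewrite (le_trans (lerD (ler_normB _ _) (ler_normB _ _)))//.
rewrite expr2; move: A1 A2 B1 B2; lra.
Qed.

End goursat.

(** * Fourier coefficients and Taylor expansion *)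

Section circle.
Variable R : realType.
Implicit Types (s t : R) (phi : R -> R[i]).

(** Period 1, so that integrals over [0, 1] are means over the circle without a normalizing
    factor. *)
Definition cis t : R[i] := Complex (cos (2 * pi * t)) (sin (2 * pi * t)).

Definition tau_i : R[i] := Complex 0 (2 * pi).

Lemma tau_i_neq0 : tau_i != 0.
Proof.
rewrite eq_complex /= negb_and; apply/orP; right.
by rewrite lt0r_neq0// mulr_gt0// pi_gt0.
Qed.

Lemma cisD s t : cis (s + t) = cis s * cis t.
Proof. by rewrite /cis mulrDr cosD sinD; congr Complex; ring. Qed.

Lemma cis0 : cis 0 = 1. Proof. by rewrite /cis mulr0 cos0 sin0. Qed.

Lemma cis1 : cis 1 = 1.
Proof. by rewrite /cis mulr1 mulr_natl cos2pi sin2pi. Qed.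

Lemma nc_cis t : nc (cis t) = 1.
Proof. by rewrite /= cos2Dsin2 sqrtr1. Qed.

Lemma cis_conj t : cis t * ((cis t)^*)%R = 1.
Proof. by rewrite mulr_conj nc_cis expr1n. Qed.

Lemma cis_neq0 t : cis t != 0.
Proof. by rewrite -nc_gt0 nc_cis. Qed.

Lemma cisMn t k : cis (k%:R * t) = cis t ^+ k.
Proof.
elim: k => [|k IH]; first by rewrite mul0r cis0.
by rewrite -natr1 mulrDl mul1r cisD IH exprSr.
Qed.

Lemma pderiv_cis t : pderiv cis t (tau_i * cis t).
Proof.
have dlin : is_derive t 1 (fun x : R => 2 * pi * x) (2 * pi).
  have := is_derive1M (is_derive_cst (2 * pi : R) t 1) (is_derive_id t (1 : R)).
  by rewrite mul0r add0r mulr1.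
split.
  rewrite (_ : Re _ = - sin (2 * pi * t) * (2 * pi)).
    exact: is_derive1_comp (is_derive_cos _) dlin.
  by rewrite cReM /=; ring.
rewrite (_ : Im _ = cos (2 * pi * t) * (2 * pi)).
  exact: is_derive1_comp (is_derive_sin _) dlin.
by rewrite cImM /=; ring.
Qed.

Lemma pcont_cis : pcont cis.
Proof. exact: pderiv_pcont pderiv_cis. Qed.

Lemma pderiv_cisX t k : pderiv (fun s => cis s ^+ k) t (k%:R * tau_i * cis t ^+ k).
Proof.
elim: k => [|k IH].
  by apply: pderiv_eq (pderiv_cst 1 t) _; rewrite !mul0r.
under eq_fun do rewrite exprS.
apply: pderiv_eq (pderivM (pderiv_cis t) IH) _.
by rewrite exprS -natr1; ring.
Qed.

Definition cmean phi : R[i] := cint lebesgue_measure `[0, 1] phi.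

Lemma pcont_cintegrable phi : pcont phi ->
  cintegrable lebesgue_measure `[0, 1] phi.
Proof. by move=> [h1 h2]; split; exact: continuous_integrable. Qed.

Lemma cmean_FTC phi (phi' : R -> R[i]) : pcont phi' ->
  (forall t, pderiv phi t (phi' t)) -> cmean phi' = phi 1 - phi 0.
Proof.
move=> [c1 c2] d; rewrite /cmean /cint.
rewrite (Rintegral_FTC ltr01 c1 (fun t _ => (d t).1)).
rewrite (Rintegral_FTC ltr01 c2 (fun t _ => (d t).2)).
by case: (phi 1) (phi 0) => ? ? [].
Qed.

Lemma cmean_cst c : cmean (fun=> c) = c.
Proof.
rewrite /cmean /cint !Rintegral_cst//= lebesgue_measure_itv/= lte01.
by rewrite sube0 !mulr1; case: c.
Qed.

Lemma cmean_cisX k : cmean (fun t => cis t ^+ k) = (k == 0%N)%:R.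
Proof.
case: k => [|k]; first by under eq_fun do rewrite expr0; rewrite cmean_cst.
have pc : pcont (fun t => cis t ^+ k.+1) by apply/pcontX/pcont_cis.
have := @cmean_FTC (fun t => cis t ^+ k.+1)
  (fun t => k.+1%:R * tau_i * cis t ^+ k.+1).
rewrite /cmean cintZ//; last exact: pcont_cintegrable.
rewrite cis0 cis1 subrr => /(_ _ (fun t => pderiv_cisX t _))/eqP.
rewrite !mulf_eq0 pnatr_eq0 (negbTE tau_i_neq0)/= => H.
by apply/eqP/H; apply: pcontM => //; exact: pcont_cst.
Qed.

Definition fcoef phi k := cmean (fun t => phi t * ((cis t)^* ^+ k)%R).

Lemma pcont_fcoef phi k : pcont phi -> pcont (fun t => phi t * ((cis t)^* ^+ k)%R).
Proof.
by move=> pp; apply: pcontM => //; exact/pcontX/pcont_conj/pcont_cis.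
Qed.

Lemma fcoef_cisX j k : fcoef (fun t => cis t ^+ j) k = (j == k)%:R.
Proof.
rewrite /fcoef; have [jk|kj] := leqP k j.
  transitivity (cmean (fun t => cis t ^+ (j - k))).
    apply: eq_cint => t _.
    by rewrite -{1}(subnK jk) exprD -mulrA -exprMn cis_conj expr1n mulr1.
  by rewrite cmean_cisX subn_eq0 eqn_leq jk andbT.
transitivity (cmean (fun t => ((cis t ^+ (k - j))^*)%R)).
  apply: eq_cint => t _; rewrite -(subnK (ltnW kj)) addnK exprD mulrCA -exprMn.
  by rewrite cis_conj expr1n mulr1 rmorphXn.
rewrite /cmean cint_conj//; last exact/pcont_cintegrable/pcontX/pcont_cis.
rewrite -/(cmean _) cmean_cisX subn_eq0 leqNgt kj /= (ltn_eqF kj).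
by rewrite rmorph0.
Qed.

Lemma nc_cmean_le phi (M : R) : pcont phi -> (forall t, nc (phi t) <= M) ->
  nc (cmean phi) <= 2 * M.
Proof.
move=> pp bM; rewrite (le_trans (nc_cint_le (g := cst M) _ _ _ _))//.
- exact/cintegrable_measurable/pcont_cintegrable.
- by apply: continuous_integrable => t; exact: cvg_cst.
rewrite Rintegral_cst//= lebesgue_measure_itv/= lte01 sube0 mulr1.
by [].
Qed.

Lemma nc_fcoef_le phi k (M : R) : pcont phi -> (forall t, nc (phi t) <= M) ->
  nc (fcoef phi k) <= 2 * M.
Proof.
move=> pp bM; apply: nc_cmean_le; first exact: pcont_fcoef.
by move=> t; rewrite ncM ncX nc_conj nc_cis expr1n mulr1.
Qed.

Lemma fcoefB phi psi k : pcont phi -> pcont psi ->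
  fcoef (fun t => phi t - psi t) k = fcoef phi k - fcoef psi k.
Proof.
move=> p1 p2; rewrite /fcoef /cmean -cintB//; try exact/pcont_cintegrable/pcont_fcoef.
by apply: eq_cint => t _; rewrite mulrBl.
Qed.

End circle.

(** * Cauchy's theorem for a difference quotient and Taylor's formula *)

Section cauchy.
Variable R : realType.
Implicit Types (g q : R[i] -> R[i]).

Lemma Rintegral01_FTC (f F : R -> R) : continuous f ->
  (forall x : R, -1 < x < 2 -> is_derive x 1 F (f x)) ->
  \int[lebesgue_measure]_(x in `[0, 1]) f x = F 1 - F 0.
Proof.
by move=> cf dF; apply: Rintegral_FTC => // x x01; apply: dF; lra.
Qed.

Lemma cdiff_continuous q w d (e : R) : cdiff q w d -> 0 < e ->
  exists2 dl : R, 0 < dl &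
    forall w', nc (w' - w) < dl -> nc (q w' - q w) < e.
Proof.
move=> dP e0; have [dl dl0 H] := dP 1 ltr01.
have K0 : 0 < 1 + nc d by rewrite ltr_pwDl// nc_ge0.
exists (Num.min dl (e / (1 + nc d))); first by rewrite lt_min dl0 divr_gt0.
move=> w'; rewrite lt_min => /andP[wdl]; rewrite ltr_pdivlMr// => we.
have -> : q w' - q w = (q w' - q w - d * (w' - w)) + d * (w' - w) by ring.
rewrite (le_lt_trans (ncD _ _))// (le_lt_trans _ we)// [leRHS]mulrDr mulr1.
apply: lerD; last by rewrite ncM mulrC.
by rewrite (le_trans (H _ wdl))// mul1r.
Qed.

Lemma cdiff_ccont q : (forall w, exists d, cdiff q w d) -> ccont q.
Proof. by move=> dq w e e0; have [d dP] := dq w; exact: cdiff_continuous dP e0. Qed.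

Section quotient.
Variables (g : R[i] -> R[i]) (z d0 : R[i]).
Hypothesis g_z : cdiff g z d0.
Hypothesis g_diff : forall w, exists d, cdiff g w d.

(** Difference quotient of [g] at [z], the singularity being filled by the derivative.
    Differentiability is proved away from [z], and continuity everywhere. *)
Let q w := if w == z then d0 else (g w - g z) / (w - z).

Let q_diff w : w != z -> exists d, cdiff q w d.
Proof.
move=> wz; have [d dP] := g_diff w.
pose Q := (g w - g z) / (w - z).
have wz0 : w - z != 0 by rewrite subr_eq0.
pose m := nc (w - z); have m0 : 0 < m by rewrite nc_gt0.
exists ((d - Q) / (w - z)) => e e0.
have [dl dl0 H] := dP (e * m / 4) ltac:(by rewrite divr_gt0// mulr_gt0).
pose K := nc (d - Q) + 1; have K0 : 0 < K by rewrite ltr_wpDl// nc_ge0.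
(* The first bound controls the remainder of [g], the second keeps [w'] at distance at least [m / 2]
   from [z], the third controls the term quadratic in [w' - w]. *)
exists (Num.min dl (Num.min (m / 2) (e * m ^+ 2 / (4 * K)))).
  by rewrite !lt_min dl0 !divr_gt0// !mulr_gt0.
move=> w'; rewrite !lt_min => /and3P[wdl wm wK].
have m' : m / 2 <= nc (w' - z).
  have := ncD (w' - z) (w - w'); rewrite (_ : w' - z + (w - w') = w - z); last by ring.
  by rewrite -/m (ncB w); move: wm; lra.
have m'0 : 0 < nc (w' - z) by rewrite (lt_le_trans _ m')// divr_gt0.
have w'z0 : w' - z != 0 by rewrite -nc_gt0.
have w'z : w' != z by rewrite -subr_eq0.
rewrite /q (negbTE wz) (negbTE w'z) -/Q.
set r := g w' - g w - d * (w' - w).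
have -> : (g w' - g z) / (w' - z) - Q - (d - Q) / (w - z) * (w' - w) =
   r / (w' - z) - (d - Q) * (w' - w) * (w' - w) / ((w' - z) * (w - z)).
  by rewrite /r /Q; field; rewrite w'z0 wz0.
have H' := H _ wdl.
rewrite (le_trans (ncD _ _))// ncN !ncM !ncV !ncM -/m.
have -> : e * nc (w' - w) = e / 2 * nc (w' - w) + e / 2 * nc (w' - w) by field.
apply: lerD.
  rewrite ler_pdivrMr// (le_trans H')//.
  have -> : e * m / 4 * nc (w' - w) = e / 2 * nc (w' - w) * (m / 2) by field.
  by rewrite ler_wpM2l// mulr_ge0 ?nc_ge0// divr_ge0// ltW.
rewrite ler_pdivrMr ?mulr_gt0//.
apply: (@le_trans _ _ (e / 2 * nc (w' - w) * (m / 2 * m))); last first.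
  rewrite ler_wpM2l// ?ler_wpM2r// ?(ltW m0)//.
  by rewrite mulr_ge0 ?nc_ge0// divr_ge0// ltW.
have -> : e / 2 * nc (w' - w) * (m / 2 * m) = (e * m ^+ 2 / 4) * nc (w' - w).
  by field.
rewrite ler_wpM2r ?nc_ge0//.
apply: (@le_trans _ _ (K * nc (w' - w))).
  by rewrite ler_wpM2r ?nc_ge0// lerDl.
move: wK; rewrite ltr_pdivlMr ?mulr_gt0// => wK.
by move: wK; rewrite expr2; lra.
Qed.

Let q_cont : ccont q.
Proof.
move=> w e e0; have [wz|wz] := eqVneq w z; last first.
  by have [d dP] := q_diff wz; exact: cdiff_continuous dP e0.
have [dl dl0 H] := g_z (divr_gt0 e0 (ltr0n R 2)).
exists dl => // w'; rewrite wz => w'dl.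
rewrite /q eqxx; case: eqVneq => [_|w'z]; first by rewrite subrr nc0.
have w'z0 : w' - z != 0 by rewrite subr_eq0.
have -> : (g w' - g z) / (w' - z) - d0 =
          (g w' - g z - d0 * (w' - z)) / (w' - z) by field.
rewrite ncM ncV ltr_pdivrMr ?nc_gt0// (le_lt_trans (H _ w'dl))//.
by rewrite ltr_pM2r ?nc_gt0// ltr_pdivrMr// ltr_pMr// ltr1n.
Qed.

(** Cauchy's theorem for [q] on the unit circle. [Phi dl] contracts the circle towards [z] by
    homotheties of ratio between 1 and [dl]. Stopping at a positive [dl] avoids the point [z], where
    only the continuity of [q] is available; the inner loop contributes O(dl) since [q] is bounded
    near [z]. *)
Lemma cauchy_kernel : nc z < 1 ->
  cmean (fun t => (g (cis t) - g z) * (cis t / (cis t - z))) = 0.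
Proof.
move=> z1.
pose sg (dl s : R) := dl + (1 - dl) * s.
pose Phi dl s t := z + (sg dl s)%:C%C * (cis t - z).
pose Phis (dl s t : R) := (1 - dl)%:C%C * (cis t - z).
pose Phit (dl s t : R) := (sg dl s)%:C%C * (tau_i R * cis t).
pose L : R := 2 + nc (tau_i R).
have L0 : 0 < L by rewrite ltr_pwDl// nc_ge0.
have cisz t : nc (cis t - z) <= 2.
  by rewrite (le_trans (ncD _ _))// ncN nc_cis; move: z1; lra.
have sg01 dl s : 0 < dl < 1 -> 0 <= s <= 1 -> 0 < sg dl s <= 1.
  move=> /andP[dl0 dl1] /andP[s0 s1]; rewrite /sg.
  rewrite ltr_pwDl//; last by rewrite mulr_ge0// subr_ge0 ltW.
  have : (1 - dl) * s <= (1 - dl) * 1 by rewrite ler_wpM2l// subr_ge0 ltW.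
  lra.
have cisz0 t : cis t - z != 0.
  by rewrite subr_eq0; apply: contraTneq z1 => <-; rewrite nc_cis ltxx.
have dPs dl s t : pderiv (fun x => Phi dl x t) s (Phis dl s t).
  have dsg : is_derive s 1 (sg dl) (1 - dl).
    have := is_derive1D (is_derive_cst dl s (1 : R)) (is_derive1M
      (is_derive_cst (1 - dl) s 1) (is_derive_id s (1 : R))).
    by rewrite mul0r !add0r mulr1.
  apply: pderiv_eq (pderivD (pderiv_cst z s) (pderivM (pderiv_real dsg)
    (pderiv_cst (cis t - z) s))) _.
  by rewrite mulr0 addr0 add0r.
have dPt dl s t : pderiv (fun x => Phi dl s x) t (Phit dl s t).
  apply: pderiv_eq (pderivD (pderiv_cst z t) (pderivM
    (pderiv_cst (sg dl s)%:C%C t) (pderivD (pderiv_cis t) (pderiv_cst (- z) t)))) _.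
  by rewrite mul0r !add0r addr0.
have cs dl t : pcont (fun s => q (Phi dl s t) * Phis dl s t).
  apply: pcontM; last exact: pcont_cst.
  exact: (ccont_path q_cont (pderiv_pcont (fun s => dPs dl s t))).
have ct dl s : pcont (fun t => q (Phi dl s t) * Phit dl s t).
  apply: pcontM; first exact: (ccont_path q_cont (pderiv_pcont (dPt dl s))).
  by do 2 (apply: pcontM; first exact: pcont_cst); exact: pcont_cis.
have [eta eta0 Heta] := q_cont z ltr01.
pose K := (nc d0 + 1) * nc (tau_i R).
have K0 : 0 <= K by rewrite mulr_ge0 ?nc_ge0// addr_ge0 ?nc_ge0.
(* Real parts suffice because [c] is arbitrary: the choices 1 and -i recover both components at the
   end. *)
have main c : Re (c * cmean (fun t => q (cis t) * (tau_i R * cis t))) = 0.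
  have pcq : pcont (fun t => q (cis t) * (tau_i R * cis t)).
    have := ct 0 1; rewrite /Phi /Phit /sg.
    by under eq_fun do rewrite add0r subr0 mulr1 !mul1r addrC subrK.
  suff small (dl : R) : 0 < dl < 1 -> dl * 2 < eta ->
      `|Re (c * cmean (fun t => q (cis t) * (tau_i R * cis t)))| <=
      nc c * K * dl.
    apply/eqP; rewrite -normr_le0; apply/ler_addgt0Pl => e e0.
    rewrite addr0; pose B := nc c * K + 1.
    have B0 : 0 < B by rewrite ltr_wpDl// mulr_ge0// nc_ge0.
    (* The three bounds ensure a ratio below 1, an inner loop (of radius at most [2 * dl] around
       [z]) where [q] varies by less than 1, and an error of at most [e]. *)
    pose dl := Num.min (2^-1) (Num.min (eta / 4) (e / B)).
    have dl0 : 0 < dl by rewrite !lt_min invr_gt0 ltr0n !divr_gt0.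
    have [d1 [d2 d3]] : dl <= 2^-1 /\ dl <= eta / 4 /\ dl <= e / B.
      by rewrite !ge_min !lexx !orbT.
    have dl01 : 0 < dl < 1 by rewrite dl0 (le_lt_trans d1)// invf_lt1// ltr1n.
    have dl2 : dl * 2 < eta by move: eta0 d2; lra.
    rewrite (le_trans (small dl dl01 dl2))//.
    have cK0 : 0 <= nc c * K by rewrite mulr_ge0// nc_ge0.
    rewrite (le_trans (ler_wpM2l cK0 d3))//.
    rewrite mulrCA ler_piMr ?(ltW e0)// ler_pdivrMr// mul1r lerDl//.
  move=> dl01 dleta; have [dl0 dl1] := andP dl01.
  have PAex t : exists F : R -> R, forall s : R, -1 < s < 2 ->
      is_derive s 1 F (Re (c * (q (Phi dl s t) * Phis dl s t))).
    by apply: primitive_exists; have [] := pcontM (pcont_cst c) (cs dl t).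
  have PBex s : exists F : R -> R, forall t : R, -1 < t < 2 ->
      is_derive t 1 F (Re (c * (q (Phi dl s t) * Phit dl s t))).
    by apply: primitive_exists; have [] := pcontM (pcont_cst c) (ct dl s).
  have [PA' PAP] := choice PAex; have [PB PBP] := choice PBex.
  pose PA s t := PA' t s.
  have : circulation PA PB 0 0 1 = 0.
    apply: (@goursat_pullback _ q (Phi dl) (Phis dl) (Phit dl) L c) => //.
    - move=> s t s01 t01; rewrite /Phis ncM ncC ger0_norm ?subr_ge0 ?(ltW dl1)//.
      apply: (@le_trans _ _ (1 * 2)).
        by apply: ler_pM; rewrite ?nc_ge0 ?subr_ge0 ?(ltW dl1)// lerBlDl lerDr ltW.
      by rewrite mul1r lerDl nc_ge0.
    - move=> s t s01 t01; have /andP[s0 s1] := sg01 _ _ dl01 s01.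
      rewrite /Phit !ncM nc_cis mulr1 ncC gtr0_norm//.
      apply: (@le_trans _ _ (1 * nc (tau_i R))).
        by rewrite ler_wpM2r ?nc_ge0.
      by rewrite mul1r lerDr.
    - move=> s t s01 t01; apply: q_diff; have /andP[s0 s1] := sg01 _ _ dl01 s01.
      rewrite /Phi -subr_eq0 addrAC subrr add0r mulf_neq0//.
      by rewrite -nc_gt0 ncC normr_gt0 lt0r_neq0.
    - by move=> s t; exact: PAP.
  (* The two sides at [t = 0] and [t = 1] run along the same segment, since [cis] has period 1, and
     cancel in the circulation. *)
  have PA01 : PA 1 0 - PA 0 0 = PA 1 1 - PA 0 1.
    rewrite -(Rintegral01_FTC (pcontM (pcont_cst c) (cs dl 0)).1 (PAP 0)).
    rewrite -(Rintegral01_FTC (pcontM (pcont_cst c) (cs dl 1)).1 (PAP 1)).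
    by apply: eq_Rintegral => s _; rewrite /Phi /Phis cis0 cis1.
  have PB1 : PB 1 1 - PB 1 0 =
      Re (c * cmean (fun t => q (cis t) * (tau_i R * cis t))).
    rewrite -(Rintegral01_FTC (pcontM (pcont_cst c) (ct dl 1)).1 (PBP 1)).
    rewrite /cmean -cintZ//; last exact: pcont_cintegrable.
    rewrite /cint /=; apply: eq_Rintegral => t _.
    rewrite /Phi /Phit (_ : sg dl 1 = 1); last by rewrite /sg mulr1 addrC subrK.
    by rewrite !mul1r addrC subrK.
  have PB0 : `|PB 0 1 - PB 0 0| <= nc c * K * dl.
    have -> : nc c * K * dl = nc c * K * dl * (1 - 0) by rewrite subr0 mulr1.
    apply: (@ler_incr_derive _ (PB 0)
      (fun t => Re (c * (q (Phi dl 0 t) * Phit dl 0 t))) 0 1 _ ler01).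
      by move=> t t01; apply: PBP; lra.
    move=> t t01; rewrite (le_trans (Re_le_nc _))// !ncM nc_cis mulr1 ncC.
    have sg0 : sg dl 0 = dl by rewrite /sg mulr0 addr0.
    rewrite sg0 gtr0_norm// /K -!mulrA ler_wpM2l ?nc_ge0//.
    rewrite [nc (tau_i R) * dl]mulrC ler_wpM2r ?mulr_ge0 ?nc_ge0 ?(ltW dl0)//.
    have qz : q z = d0 by rewrite /q eqxx.
    have := ncD (q (Phi dl 0 t) - q z) (q z); rewrite subrK => h.
    rewrite (le_trans h)// addrC qz lerD2l -qz ltW// Heta//.
    rewrite /Phi addrAC subrr add0r ncM ncC sg0 gtr0_norm//.
    by rewrite (le_lt_trans _ dleta)// ler_wpM2l// ltW.
  rewrite /circulation !add0r PA01 subrr add0r PB1 => /eqP.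
  by rewrite subr_eq0 => /eqP ->.
have z0 : cmean (fun t => q (cis t) * (tau_i R * cis t)) = 0.
  have m1 := main 1; have m2 := main (Complex 0 (-1)).
  move: m1 m2; case: (cmean _) => a b /=; rewrite !mul1r !mul0r subr0 sub0r => -> /eqP.
  by rewrite mulN1r opprK => /eqP ->.
have pcr : pcont (fun t => (g (cis t) - g z) * (cis t / (cis t - z))).
  have H : (fun t => (g (cis t) - g z) * (cis t / (cis t - z))) =
      (fun t => q (cis t) * cis t).
    apply/funext => t; rewrite /q -subr_eq0 (negbTE (cisz0 t)) -!mulrA.
    by congr (_ * _); rewrite mulrC.
  by rewrite H; apply: pcontM (ccont_path q_cont (@pcont_cis R)) (@pcont_cis R).
have : tau_i R * cmean (fun t => (g (cis t) - g z) * (cis t / (cis t - z))) = 0.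
  rewrite /cmean -cintZ//; last exact: pcont_cintegrable.
  rewrite -z0; apply: eq_cint => t _.
  rewrite /q -subr_eq0 (negbTE (cisz0 t)); field.
  by rewrite cisz0.
by move=> /eqP; rewrite mulf_eq0 (negbTE (tau_i_neq0 R)) => /eqP.
Qed.

End quotient.

(** On the circle, cis t / (cis t - z) = 1 / (1 - z conj(cis t)) is a finite geometric sum plus a
    remainder, and its product with [G] has mean zero by [cauchy_kernel]. Keeping the sum finite
    avoids exchanging a limit with the integral and makes the geometric rate explicit. *)
Lemma taylor_remainder g z (M : R) N :
  (forall w, exists d, cdiff g w d) -> nc z < 1 -> (forall t, nc (g (cis t)) <= M) ->
  nc (g z - \sum_(k < N.+1) z ^+ k * fcoef (fun t => g (cis t)) k) <=
  nc z ^+ N.+1 * (2 * ((M + nc (g z)) / (1 - nc z))).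
Proof.
move=> gd z1 bM.
have gc := cdiff_ccont gd.
have cisz0 t : cis t - z != 0.
  by rewrite subr_eq0; apply: contraTneq z1 => <-; rewrite nc_cis ltxx.
have [d0 dz] := gd z.
have := cauchy_kernel dz gd z1.
pose G t := g (cis t) - g z.
pose E t : R[i] := ((cis t)^*)%R.
pose rem t := G t * E t ^+ N.+1 * (1 - z * E t)^-1.
have cE t : cis t - z = cis t * (1 - z * E t).
  by rewrite mulrBr mulr1 mulrCA cis_conj mulr1.
have Ez t : 1 - z * E t != 0.
  by apply: contraNneq (cisz0 t) => H; rewrite cE H mulr0.
have kE t : G t * (cis t / (cis t - z)) =
    \sum_(k < N.+1) z ^+ k * (G t * E t ^+ k) + z ^+ N.+1 * rem t.
  have -> : cis t / (cis t - z) = (1 - z * E t)^-1.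
    by rewrite cE invfM mulrA divff ?mul1r// cis_neq0.
  under eq_bigr do rewrite mulrCA -exprMn.
  rewrite -mulr_sumr.
  have -> : z ^+ N.+1 * rem t = G t * ((z * E t) ^+ N.+1 / (1 - z * E t)).
    by rewrite exprMn /rem; ring.
  rewrite -mulrDr; congr (_ * _); apply: (mulfI (Ez t)).
  rewrite divff// mulrDr mulrCA divff// mulr1.
  by rewrite -opprB mulNr -subrX1 opprB subrK.
have pG : pcont G.
  by apply: pcontD; [exact: ccont_path gc (@pcont_cis R)|exact: pcont_cst].
have pE : pcont E by exact/pcont_conj/pcont_cis.
have pGE k : pcont (fun t => G t * E t ^+ k) by apply: pcontM => //; exact: pcontX.
have pinv : pcont (fun t => (1 - z * E t)^-1).
  have H : (fun t => (1 - z * E t)^-1) =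
           (fun t => ((nc (1 - z * E t) ^+ 2)^-1)%:C%C * ((1 - z * E t)^*)%R).
    apply/funext => t; apply: (mulfI (Ez t)); rewrite divff// mulrCA mulr_conj.
    by rewrite -rmorphM/= mulVf// expf_neq0// nc_eq0.
  have pzE : pcont (fun t => 1 - z * E t).
    under eq_fun do rewrite -mulN1r mulrA.
    exact: (pcontD (pcont_cst 1) (pcontM (pcont_cst (-1 * z)) pE)).
  rewrite H; apply: pcontM; last exact: pcont_conj.
  apply: pcont_real => t; apply: cvgV; first by rewrite expf_neq0// nc_eq0.
  have [c1 c2] := pzE.
  under eq_fun do rewrite nc_sqr !expr2.
  by rewrite nc_sqr !expr2; exact: cvgD (cvgM (c1 t) (c1 t)) (cvgM (c2 t) (c2 t)).
have prem : pcont rem by apply: pcontM.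
(* The constant [g z] inside [G] only affects the coefficient of index 0; this is where the value
   [g z] of the formula comes from. *)
have fc k : cmean (fun t => G t * E t ^+ k) =
    fcoef (fun t => g (cis t)) k - (k == 0%N)%:R * g z.
  rewrite -/(fcoef G k) fcoefB; [|exact: ccont_path gc (@pcont_cis R)|exact: pcont_cst].
  congr (_ - _); rewrite /fcoef /cmean cintZ//; last first.
    exact/pcont_cintegrable/pcontX.
  rewrite mulrC; congr (_ * _).
  have := fcoef_cisX R 0 k; rewrite eq_sym => <-.
  by apply: eq_cint => t _; rewrite expr0 mul1r.
have -> : cmean (fun t => (g (cis t) - g z) * (cis t / (cis t - z))) =
    \sum_(k < N.+1) z ^+ k * cmean (fun t => G t * E t ^+ k) +
    z ^+ N.+1 * cmean rem.
  rewrite /cmean -cintZ//; last exact: pcont_cintegrable.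
  under [X in _ = X + _]eq_bigr => k _.
    rewrite -cintZ//; last exact: pcont_cintegrable.
    over.
  rewrite -cint_sum//; last by move=> k; apply/cintegrableZ/pcont_cintegrable.
  rewrite -cintD//; [by apply: eq_cint => t _; exact: kE| |].
    by apply: cintegrable_sum => // k; apply/cintegrableZ/pcont_cintegrable.
  exact/cintegrableZ/pcont_cintegrable.
under eq_bigr do rewrite fc mulrBr.
rewrite sumrB [X in _ - X](_ : _ = g z); last first.
  rewrite big_ord_recl big1 ?addr0//= ?expr0 ?mul1r// => i _.
  by rewrite mul0r mulr0.
move=> E0.
have -> : g z - \sum_(k < N.+1) z ^+ k * fcoef (fun t => g (cis t)) k =
    z ^+ N.+1 * cmean rem.
  by apply/eqP; rewrite -subr_eq0 -oppr_eq0; apply/eqP; rewrite -[RHS]E0; ring.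
rewrite ncM ncX ler_wpM2l ?exprn_ge0 ?nc_ge0//.
apply: nc_cmean_le => // t.
rewrite /rem !ncM ncX nc_conj nc_cis expr1n mulr1 ncV.
have z10 : 0 < 1 - nc z by rewrite subr_gt0.
have M0 : 0 <= M by rewrite (le_trans _ (bM 0))// nc_ge0.
apply: ler_pM; rewrite ?nc_ge0 ?invr_ge0 ?nc_ge0//.
  by rewrite (le_trans (ncD _ _))// ncN lerD2r.
rewrite lef_pV2 ?posrE ?nc_gt0//.
have := ncD (1 - z * E t) (z * E t); rewrite subrK nc1 ncM nc_conj nc_cis mulr1.
lra.
Qed.

End cauchy.

(** * Interpolation at roots of unity *)

Section roots_of_unity.
Variable R : realType.
Implicit Types (g : R[i] -> R[i]).

Lemma nc_nat m : nc (m%:R : R[i]) = m%:R.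
Proof. by rewrite (_ : m%:R = (m%:R)%:C%C) ?ncC ?ger0_norm// rmorph_nat. Qed.

Lemma cis_neq1 (t : R) : 0 < t < 1 -> cis t != 1.
Proof.
move=> /andP[t0 t1]; apply/negP => /eqP[] h _.
have : 0 < sin (pi * t).
  by apply: sin_gt0_pi; rewrite mulr_gt0 ?pi_gt0//= gtr_pMr// pi_gt0.
have e : cos (2 * pi * t) = 1 - (sin (pi * t) ^+ 2) *+ 2.
  by rewrite -mulrA mulr_natl mulr2n cosD -!expr2 cos2sin2; ring.
move: h; rewrite e => /eqP; rewrite -subr_eq0 addrAC subrr add0r oppr_eq0.
by rewrite mulrn_eq0/= sqrf_eq0 => /eqP ->; rewrite ltxx.
Qed.

Section interpolation.
Variable N : nat.
Let om (l : nat) : R[i] := cis (l%:R / N.+1%:R).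

Lemma nc_om l : nc (om l) = 1. Proof. exact: nc_cis. Qed.

Let om_conj l : om l * ((om l)^*)%R = 1. Proof. exact: cis_conj. Qed.

Let omX (l i : nat) : om l ^+ i = om 1 ^+ (l * i).
Proof.
by rewrite exprM; congr (_ ^+ _); rewrite /om -cisMn mul1r.
Qed.

Let omN : om 1 ^+ N.+1 = 1.
Proof. by rewrite /om -cisMn mul1r divff ?pnatr_eq0// cis1. Qed.

Let om_neq1 i : (0 < i < N.+1)%N -> om 1 ^+ i != 1.
Proof.
move=> /andP[i0 iN]; rewrite /om -cisMn mul1r; apply: cis_neq1.
by rewrite divr_gt0 ?ltr0n//= ltr_pdivrMr ?ltr0n// mul1r ltr_nat.
Qed.

Lemma om_orthogonal (i k : nat) : (i < N.+1)%N -> (k < N.+1)%N ->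
  \sum_(l < N.+1) om l ^+ i * ((om l)^* ^+ k)%R = (i == k)%:R * N.+1%:R.
Proof.
have lt_case a b : (a < b)%N -> (b < N.+1)%N ->
    \sum_(l < N.+1) om l ^+ b * ((om l)^* ^+ a)%R = 0.
  move=> ab bN; pose x := om 1 ^+ (b - a).
  have xE (l : 'I_N.+1) : om l ^+ b * ((om l)^* ^+ a)%R = x ^+ l.
    rewrite -(subnK (ltnW ab)) exprD -mulrA -exprMn om_conj expr1n mulr1 omX.
    by rewrite /x -exprM mulnC.
  under eq_bigr do rewrite xE.
  have x1 : x != 1 by apply: om_neq1; rewrite subn_gt0 ab (leq_ltn_trans (leq_subr _ _)).
  have : (x - 1) * (\sum_(l < N.+1) x ^+ l) = 0.
    by rewrite -subrX1 /x -exprM mulnC exprM omN expr1n subrr.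
  by move=> /eqP; rewrite mulf_eq0 subr_eq0 (negbTE x1) => /eqP.
move=> iN kN; case: (ltngtP i k) => [ik|ki|->].
- have := congr1 (@Num.conj _) (lt_case _ _ ik kN).
  rewrite rmorph0 rmorph_sum/= mul0r; apply: etrans.
  by apply: eq_bigr => l _; rewrite rmorphM/= !rmorphXn/= conjCK mulrC.
- by rewrite mul0r lt_case.
- rewrite mul1r; under eq_bigr do rewrite -exprMn om_conj expr1n.
  by rewrite sumr_const card_ord.
Qed.

(* The polynomial of degree at most N interpolating g at the points
   om l / 2. *)
Definition interp g z : R[i] := \sum_(k < N.+1) z ^+ k *
  (\sum_(l < N.+1) N.+1%:R^-1 * 2 ^+ k * ((om l)^* ^+ k)%R * g (om l / 2)).

Lemma interpD g1 g2 z :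
  interp (fun w => g1 w + g2 w) z = interp g1 z + interp g2 z.
Proof.
rewrite /interp -big_split; apply: eq_bigr => k _.
under eq_bigr do rewrite mulrDr.
by rewrite big_split mulrDr.
Qed.

Lemma interp_poly (b : nat -> R[i]) z :
  interp (fun w => \sum_(i < N.+1) w ^+ i * b i) z = \sum_(i < N.+1) z ^+ i * b i.
Proof.
apply: eq_bigr => k _; congr (_ * _).
under eq_bigr do rewrite mulr_sumr.
rewrite exchange_big/= (bigD1 k)//= [X in _ + X]big1 ?addr0.
  transitivity (\sum_(l < N.+1)
      N.+1%:R^-1 * b k * (om l ^+ k * ((om l)^* ^+ k)%R)).
    apply: eq_bigr => l _; rewrite expr_div_n.
    have : (2 : R[i]) ^+ k != 0 by rewrite expf_neq0// pnatr_eq0.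
    by move: (N.+1%:R^-1) => y x0; field.
  rewrite -mulr_sumr om_orthogonal// eqxx mul1r.
  by rewrite mulrAC mulVf ?mul1r// pnatr_eq0.
move=> i ik.
transitivity (\sum_(l < N.+1)
    N.+1%:R^-1 * 2 ^+ k / 2 ^+ i * b i * (om l ^+ i * ((om l)^* ^+ k)%R)).
  apply: eq_bigr => l _; rewrite expr_div_n.
  have : (2 : R[i]) ^+ i != 0 by rewrite expf_neq0// pnatr_eq0.
  by move: (N.+1%:R^-1) => y x0; field.
rewrite -mulr_sumr om_orthogonal// (_ : (i == k :> nat) = false) ?mul0r ?mulr0//.
exact/negbTE.
Qed.

(** The nodes have modulus 1/2, so the k-th coefficient is at most [2 ^+ k * e], which [nc z ^+ k]
    compensates; each of the [N.+1] terms is then at most [e]. This linear loss is harmless against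
    a geometric error. *)
Lemma nc_interp_le g z (e : R) : nc z <= 2^-1 ->
  (forall w, nc w <= 2^-1 -> nc (g w) <= e) -> nc (interp g z) <= N.+1%:R * e.
Proof.
move=> z2 ge.
rewrite /interp (le_trans (nc_sum _ _ _))//.
apply: (@le_trans _ _ (\sum_(k < N.+1) e)); last first.
  by rewrite sumr_const card_ord mulr_natl.
apply: ler_sum => k _; rewrite ncM ncX.
have H : nc (\sum_(l < N.+1) N.+1%:R^-1 * 2 ^+ k * ((om l)^* ^+ k)%R * g (om l / 2))
    <= 2 ^+ k * e.
  rewrite (le_trans (nc_sum _ _ _))//.
  apply: (@le_trans _ _ (\sum_(l < N.+1) N.+1%:R^-1 * (2 ^+ k * e))).
    apply: ler_sum => l _.
    rewrite !ncM !ncX ncV nc_conj nc_om expr1n mulr1 !nc_nat.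
    rewrite -mulrA ler_wpM2l ?invr_ge0// ler_wpM2l ?exprn_ge0//.
    by apply: ge; rewrite ncM nc_om mul1r ncV nc_nat.
  by rewrite sumr_const card_ord -[X in X <= _]mulr_natl mulrA mulfV ?mul1r ?pnatr_eq0.
apply: (@le_trans _ _ (2^-1 ^+ k * (2 ^+ k * e))).
  by apply: ler_pM => //; rewrite ?exprn_ge0 ?nc_ge0// lerXn2r ?nnegrE ?nc_ge0// invr_ge0.
by rewrite mulrA -exprMn mulVf ?expr1n ?mul1r// pnatr_eq0.
Qed.

(** Interpolation fixes the Taylor polynomial [T], so the error is that of [g - T] minus its
    interpolant: one remainder, plus [N.+1] times its bound. The constant is 8 because the quotient
    in the Taylor remainder is at most 2 M / (1/2) = 4 M on the half disc. *)
Lemma interp_error g z (M : R) : (forall w, exists d, cdiff g w d) ->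
  (forall w, nc w <= 1 -> nc (g w) <= M) -> nc z <= 2^-1 ->
  nc (g z - interp g z) <= N.+2%:R * (2^-1 ^+ N.+1 * (8 * M)).
Proof.
move=> gd gM z2.
pose T w := \sum_(i < N.+1) w ^+ i * fcoef (fun t => g (cis t)) i.
pose e := 2^-1 ^+ N.+1 * (8 * M).
have M0 : 0 <= M by rewrite (le_trans (nc_ge0 (g 0)))// gM// nc0.
have err w : nc w <= 2^-1 -> nc (g w - T w) <= e.
  move=> w2.
  have w1 : nc w < 1 by rewrite (le_lt_trans w2)// invf_lt1// ltr1n.
  rewrite (le_trans (@taylor_remainder _ g w M N gd w1 _))//.
    by move=> t; apply: gM; rewrite nc_cis.
  apply: ler_pM.
  - by rewrite exprn_ge0// nc_ge0.
  - apply: mulr_ge0 => //; apply: divr_ge0; first exact: addr_ge0 M0 (nc_ge0 _).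
    by rewrite subr_ge0 ltW.
  - by rewrite lerXn2r ?nnegrE ?nc_ge0// invr_ge0.
  have gw : nc (g w) <= M by apply/gM/ltW.
  have w12 : 2^-1 <= 1 - nc w by lra.
  have : (M + nc (g w)) / (1 - nc w) <= (M + M) / 2^-1.
    apply: ler_pM; rewrite ?addr_ge0 ?nc_ge0 ?invr_ge0 ?subr_ge0 ?(ltW w1)//.
      by rewrite lerD2l.
    by rewrite lef_pV2 ?posrE// subr_gt0.
  by rewrite invrK; lra.
have -> : g z - interp g z = (g z - T z) - interp (fun w => g w - T w) z.
  have -> : interp g z = interp (fun w => (g w - T w) + T w) z.
    by congr interp; apply/funext => w; rewrite subrK.
  by rewrite interpD (_ : interp T z = T z) ?interp_poly//; ring.
rewrite (le_trans (ncD _ _))// ncN -natr1 addrC mulrDl mul1r lerD// ?err//.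
exact: nc_interp_le.
Qed.

End interpolation.

Lemma sqr_le_exp2 k : (k ^ 2 <= 2 ^ k.+1)%N.
Proof.
elim: k => [|[|[|[|k]]] IH] //; rewrite [leqRHS]expnS.
by rewrite (leq_trans _ (leq_mul (leqnn 2) IH))// -!mulnn; nia.
Qed.

Lemma geometric_small (M e : R) : 0 <= M -> 0 < e ->
  exists N, N.+2%:R * (2^-1 ^+ N.+1 * M) <= e.
Proof.
(* The 4 comes from (N+2)^2 <= 4 * 2^(N+1), an instance of [sqr_le_exp2]. One factor N+2 is the one
   of the statement, the other beats [K]. *)
move=> M0 e0; pose K := 4 * M / e.
have K0 : 0 <= K by rewrite divr_ge0 ?mulr_ge0// ltW.
exists (Num.bound K); have := archi_boundP K0; set N := Num.bound K => KN.
have NN : N.+2%:R ^+ 2 <= 4 * 2 ^+ N.+1 :> R.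
  have := sqr_le_exp2 N.+2; rewrite -(ler_nat R) !natrX !exprS; lra.
have p0 : 0 < 2 ^+ N.+1 :> R by rewrite exprn_gt0.
have KN2 : K <= N.+2%:R by rewrite (le_trans (ltW KN))// ler_nat; lia.
rewrite exprVn mulrCA mulrC ler_pdivrMr//.
have : N.+2%:R * (N.+2%:R * M) <= N.+2%:R * (e * 2 ^+ N.+1); last first.
  by rewrite ler_pM2l// mulrC.
apply: (@le_trans _ _ (4 * 2 ^+ N.+1 * M)).
  by rewrite mulrA -expr2 ler_wpM2r.
have : K * (e * 2 ^+ N.+1) <= N.+2%:R * (e * 2 ^+ N.+1).
  by rewrite ler_wpM2r// mulr_ge0 ?ltW.
apply: le_trans; rewrite /K le_eqVlt; apply/orP; left; apply/eqP; field.
by rewrite gt_eqF.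
Qed.

End roots_of_unity.

(** * Polynomial approximation of holomorphic functions *)

Section holomorphic_functions.
Variables (R : realType) (n : nat).
Notation V := 'cV[R[i]]_n.
Implicit Types (U : V -> R[i]) (z v : V).

Lemma differentiable_cdiff (f : R[i] -> R[i]) (l : R[i]) :
  differentiable (f : R[i]^o -> R[i]^o) (l : R[i]^o) -> exists d, cdiff f l d.
Proof.
move=> /derivable1_diffP df.
exists ('D_1 (f : R[i]^o -> R[i]^o) l) => e e0.
have e0C : 0 < e%:C%C :> R[i] by rewrite ltcR.
have /cvgrPdist_le/(_ _ e0C) := df.
rewrite /dnbhs near_withinE => /nbhs_ballP[dl /= dl0 H].
(* The radius is an element of [R[i]]; being positive for the order of [R[i]] forces its imaginary
   part to vanish. *)
have [dlI dlR] : Im dl = 0 /\ 0 < Re dl.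
  by move: dl0; rewrite ltcE /= => /andP[/eqP -> ->].
exists (Re dl) => // w' w'dl.
have [->|w'l] := eqVneq w' l; first by rewrite !subrr mulr0 subr0 nc0 mulr0.
have w'l0 : w' - l != 0 by rewrite subr_eq0.
have dlw : (nc (w' - l))%:C%C < dl by rewrite ltcE /= dlI eqxx w'dl.
have := H (w' - l); rewrite /ball /= sub0r normrN nc_normr => /(_ dlw w'l0).
rewrite nc_normr lecR /GRing.scale /= mulr1 subrK.
set d := derive _ _ _ => Hd.
have -> : f w' - f l - d * (w' - l) =
          - (d - (w' - l)^-1 * (f w' - f l)) * (w' - l) by field.
by rewrite ncM ncN ler_wpM2r// nc_ge0.
Qed.

Lemma holomorphic_slice U z v : holomorphic U ->
  forall l, exists d, cdiff (fun w => U (z + w *: v)) l d.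
Proof.
move=> hU l; apply: differentiable_cdiff.
apply: (@differentiable_comp _ R[i]^o V R[i]^o (fun w : R[i]^o => z + w *: v) U).
  apply: differentiableD; first exact: differentiable_cst.
  by apply: ex_diff; exact: is_diff_scalel.
exact: hU.
Qed.

Definition polydisc (r : R) : set V := [set z | forall j, nc (z j 0) <= r].

Lemma compact_square (r : R) :
  compact ([set c : R[i] | `|Re c| <= r /\ `|Im c| <= r] : set R[i]^o).
Proof.
pose F (p : R * R) : R[i]^o := Complex p.1 p.2.
have -> : [set c : R[i] | `|Re c| <= r /\ `|Im c| <= r] =
    F @` (`[- r, r] `*` `[- r, r]).
  apply/seteqP; split => [[a b] /= [ar br]|_ [[a b] /= [ar br] <-]].
    by exists (a, b) => //=; rewrite !in_itv/= -!ler_norml.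
  by move: ar br; rewrite !in_itv/= -!ler_norml.
apply: continuous_compact; last first.
  by apply: compact_setX; exact: segment_compact.
apply: continuous_subspaceT => -[a b].
apply/cvgrPdist_lt => e; rewrite ltcE /= => /andP[/eqP eI eR].
have e2 : 0 < Re e / 2 by rewrite divr_gt0.
near=> p.
rewrite nc_normr ltcE /= eI eqxx /=.
change (nc (F (a, b) - F p) < Re e).
rewrite (le_lt_trans (nc_le_ReIm _))// (_ : Re e = Re e / 2 + Re e / 2); last by field.
rewrite /= ltrD//.
- near: p; have : (@fst R R) p @[p --> (a, b)] --> a by exact: cvg_fst.
  by move=> /cvgrPdist_lt/(_ _ e2).
- near: p; have : (@snd R R) p @[p --> (a, b)] --> b by exact: cvg_snd.
  by move=> /cvgrPdist_lt/(_ _ e2).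
Unshelve. all: by end_near. Qed.

(** The polydisc is enlarged to a product of squares, compact as images of real squares.
    Transposition passes to row vectors, to which [rV_compact] applies. *)
Lemma holomorphic_bounded U r : holomorphic U ->
  exists2 M : R, 0 <= M & forall z, polydisc r z -> nc (U z) <= M.
Proof.
move=> hU.
pose A (j : 'I_n) : set R[i]^o := [set c : R[i] | `|Re c| <= r /\ `|Im c| <= r].
have cA : compact [set v : 'rV[R[i]^o]_n | forall j, A j (v ord0 j)].
  by apply: rV_compact => j; exact: compact_square.
pose f (v : 'rV[R[i]^o]_n) : R := nc (U v^T).
have cf : forall v : 'rV[R[i]^o]_n, f x @[x --> v] --> f v.
  move=> v.
  have cU : (U : V -> R[i]^o) x @[x --> v^T] --> (U v^T : R[i]^o).
    exact: differentiable_continuous (hU v^T).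
  have ct : (fun v : 'rV[R[i]^o]_n => v^T : 'cV[R[i]^o]_n) x @[x --> v] -->
      (v^T : 'cV[R[i]^o]_n).
    move=> B [P nP sPB]; exists (fun i j => P j i).
      by move=> i j; have := nP j i; rewrite mxE.
    by move=> x Px; apply: sPB => i j; rewrite mxE; exact: Px.
  have /cvgrPdist_lt cc := cvg_comp _ _ ct cU.
  have FF : Filter (nbhs v) by exact: nbhs_filter.
  apply: (iffRL (@cvgrPdist_lt R R _ (nbhs v) FF f (f v))) => e e0.
  have e0C : 0 < e%:C%C :> R[i] by rewrite ltcR.
  apply: filterS (cc _ e0C) => x /=.
  rewrite nc_normr ltcR; apply: le_lt_trans.
  have := ncD (U v^T - U x^T) (U x^T); have := ncD (U x^T - U v^T) (U v^T).
  by rewrite !subrK (ncB (U x^T)) /f ler_norml; lra.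
have := compact_bounded (continuous_compact (continuous_subspaceT cf) cA).
move=> [M [_ HM]]; exists (`|M| + 1); first by rewrite addr_ge0.
move=> z zr; have := HM (`|M| + 1) ltac:(by rewrite (le_lt_trans (ler_norm _))// ltrDl).
move=> G; have := G (f z^T); rewrite /f /= trmxK ger0_norm ?nc_ge0//; apply.
exists z^T; rewrite ?trmxK// => j /=.
by rewrite mxE; split; rewrite (le_trans _ (zr j))// ?Re_le_nc ?Im_le_nc.
Qed.

Definition mono (e : 'I_n -> nat) z : R[i] := \prod_j z j 0 ^+ e j.

Definition polyfun (s : seq (R[i] * ('I_n -> nat))) z : R[i] :=
  \sum_(p <- s) p.1 * mono p.2 z.

Definition poly_approx (r : R) (f : V -> R[i]) := forall e : R, 0 < e ->
  exists s, forall z, polydisc r z -> nc (f z - polyfun s z) <= e.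

Lemma poly_approx_cst r c : poly_approx r (fun=> c).
Proof.
move=> e e0; exists [:: (c, fun=> 0%N)] => z _; rewrite /polyfun big_seq1 /mono.
by rewrite big1 ?mulr1 ?subrr ?nc0 ?(ltW e0)// => j _; rewrite expr0.
Qed.

Lemma poly_approxD r f g : poly_approx r f -> poly_approx r g ->
  poly_approx r (fun z => f z + g z).
Proof.
move=> af ag e e0; have e2 : 0 < e / 2 by rewrite divr_gt0.
have [s Hs] := af _ e2; have [t Ht] := ag _ e2; exists (s ++ t) => z zr.
rewrite /polyfun big_cat /= opprD addrACA (le_trans (ncD _ _))//.
by rewrite [leRHS](_ : e = e / 2 + e / 2) ?lerD ?Hs ?Ht//; field.
Qed.

Lemma poly_approx_sum r I (s : seq I) (F : I -> V -> R[i]) :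
  (forall i, poly_approx r (F i)) -> poly_approx r (fun z => \sum_(i <- s) F i z).
Proof.
move=> aF; elim: s => [|i s IH].
  by under eq_fun do rewrite big_nil; exact: poly_approx_cst.
by under eq_fun do rewrite big_cons; exact: poly_approxD.
Qed.

Lemma poly_approxM r c (j : 'I_n) k f : 0 <= r -> poly_approx r f ->
  poly_approx r (fun z => c * z j 0 ^+ k * f z).
Proof.
move=> r0 af e e0; pose K := nc c * r ^+ k + 1.
have K0 : 0 < K by rewrite ltr_wpDl// mulr_ge0 ?nc_ge0// exprn_ge0.
have [s Hs] := af _ (divr_gt0 e0 K0).
exists [seq (c * p.1, fun i => (p.2 i + (i == j) * k)%N) | p <- s] => z zr.
have -> : polyfun [seq (c * p.1, fun i => (p.2 i + (i == j) * k)%N) | p <- s] z =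
    c * z j 0 ^+ k * polyfun s z.
  rewrite /polyfun big_map mulr_sumr; apply: eq_bigr => p _ /=.
  rewrite (_ : mono _ z = z j 0 ^+ k * mono p.2 z); first by ring.
  rewrite /mono; under eq_bigr do rewrite exprD.
  rewrite big_split/= mulrC; congr (_ * _).
  rewrite (bigD1 j)//= eqxx mul1n big1 ?mulr1// => i /negbTE ->.
  by rewrite mul0n expr0.
rewrite -mulrBr !ncM ncX.
apply: (@le_trans _ _ (K * (e / K))); last by rewrite mulrCA divff ?mulr1// gt_eqF.
apply: ler_pM; rewrite ?mulr_ge0 ?nc_ge0 ?exprn_ge0 ?nc_ge0//; last exact: Hs.
rewrite ler_wpDr// ler_wpM2l ?nc_ge0// lerXn2r ?nnegrE ?nc_ge0//; exact: zr.
Qed.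

Lemma poly_approx_lim r f : (forall e : R, 0 < e -> exists2 g, poly_approx r g &
    forall z, polydisc r z -> nc (f z - g z) <= e) -> poly_approx r f.
Proof.
move=> H e e0; have e2 : 0 < e / 2 by rewrite divr_gt0.
have [g ag fg] := H _ e2; have [s Hs] := ag _ e2; exists s => z zr.
have -> : f z - polyfun s z = (f z - g z) + (g z - polyfun s z) by ring.
rewrite (le_trans (ncD _ _))// [leRHS](_ : e = e / 2 + e / 2); last by field.
by rewrite lerD ?fg ?Hs.
Qed.

Lemma eq_poly_approx r f g : (forall z, f z = g z) -> poly_approx r f ->
  poly_approx r g.
Proof. by move=> /funext ->. Qed.

Definition mix k z v : V := \col_i (if (i < k)%N then v i 0 else z i 0).

Definition setc v (j : 'I_n) (c : R[i]) : V :=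
  \col_i (if i == j then c else v i 0).

(* The variables are replaced one at a time by interpolation nodes; k is the
   number of variables already replaced. *)
Lemma holomorphic_poly_approx U r : 0 < r -> holomorphic U -> poly_approx r U.
Proof.
move=> r0 hU.
suff H k : (k <= n)%N -> forall v, polydisc r v ->
    poly_approx r (fun z => U (mix (n - k) z v)).
  apply: eq_poly_approx (H n (leqnn n) 0 _) => [z|j]; last first.
    by rewrite mxE nc0 ltW.
  by congr U; apply/colP => i; rewrite mxE subnn.
elim: k => [_ v vr|k IH kn v vr].
  apply: eq_poly_approx (poly_approx_cst r (U v)) => z.
  by congr U; apply/colP => i; rewrite mxE subn0 ltn_ord.
have jn : (n - k.+1 < n)%N by lia.
pose j := Ordinal jn.
have knE : (n - k = j.+1)%N by rewrite /j/=; lia.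
have mixE z c : mix (n - k) z (setc v j c) =
    mix (n - k) z (setc v j 0) + c *: delta_mx j 0.
  apply/colP => i; rewrite !mxE knE ltnS eqxx andbT.
  have [->|ij] := eqVneq i j; first by rewrite leqnn mulr1 add0r.
  by rewrite mulr0 addr0.
have mix_z z : mix (n - k.+1) z v = mix (n - k) z (setc v j (z j 0)).
  apply/colP => i; rewrite !mxE knE ltnS.
  have [->|ij] := eqVneq i j; first by rewrite leqnn ltnn.
  by rewrite [in RHS]leq_eqVlt (_ : (i == j :> nat) = false)//; exact/negbTE.
have [M M0 UM] := holomorphic_bounded (2 * r) hU.
apply: poly_approx_lim => e e0.
have [N HN] := geometric_small (mulr_ge0 (ler0n R 8) M0) e0.
pose g z c := U (mix (n - k) z (setc v j 0) + (2 * r)%:C%C * c *: delta_mx j 0).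
have r2 : (2 * r)%:C%C != 0 :> R[i].
  by rewrite -nc_gt0 ncC normr_gt0 mulf_neq0// ?pnatr_eq0 ?gt_eqF.
exists (fun z => interp N (g z) (z j 0 / (2 * r)%:C%C)).
  pose w (m : nat) : R[i] := cis (m%:R / N.+1%:R).
  pose c (l m : nat) := N.+1%:R^-1 * 2 ^+ l * ((w m)^* ^+ l)%R / (2 * r)%:C%C ^+ l.
  apply: (@eq_poly_approx _ (fun z => \sum_(l < N.+1) \sum_(m < N.+1)
      c l m * z j 0 ^+ l * U (mix (n - k) z (setc v j ((2 * r)%:C%C * (w m / 2)))))).
    move=> z; rewrite /interp; apply: eq_bigr => l _; rewrite mulr_sumr.
    apply: eq_bigr => m _; rewrite /g -mixE -/(w m) [RHS]mulrA; congr (_ * _).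
    rewrite expr_div_n /c; move: (_ ^- l) (N.+1%:R^-1) => x y; ring.
  apply: poly_approx_sum => l; apply: poly_approx_sum => m.
  apply: poly_approxM (ltW r0) _.
  apply: IH (ltnW kn) _ _ => i; rewrite mxE; case: eqVneq => [_|_]; last exact: vr.
  rewrite !ncM nc_cis mul1r ncC ncV ger0_norm ?mulr_ge0 ?(ltW r0)//.
  rewrite nc_nat.
  by rewrite mulrAC divff ?mul1r// pnatr_eq0.
move=> z zr.
have -> : U (mix (n - k.+1) z v) = g z (z j 0 / (2 * r)%:C%C).
  rewrite /g mix_z mixE; congr (U (_ + _ *: _)).
  by rewrite mulrC divfK.
have gd w : exists d, cdiff (g z) w d.
  pose dl : V := (2 * r)%:C%C *: delta_mx j 0.
  have [d dP] := holomorphic_slice (mix (n - k) z (setc v j 0)) dl hU w.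
  exists d; rewrite /g (_ : (fun c => _) =
    fun w => U (mix (n - k) z (setc v j 0) + w *: dl))//.
  by apply/funext => c; rewrite /dl scalerA mulrC.
rewrite (le_trans (interp_error N gd (M := M) _ _))//.
  move=> w w1; rewrite /g; apply: UM => i.
  rewrite -mixE !mxE; case: ifP => [_|_]; last first.
    by rewrite (le_trans (zr i))// ler_peMl ?(ltW r0)// ler1n.
  case: eqVneq => _.
    by rewrite ncM ncC ger0_norm ?mulr_ge0 ?(ltW r0)// ler_piMr// mulr_ge0// ltW.
  by rewrite (le_trans (vr i))// ler_peMl ?(ltW r0)// ler1n.
rewrite ncM ncV ncC gtr0_norm ?mulr_gt0// invfM mulrCA -[leRHS]mulr1.
by rewrite ler_wpM2l ?invr_ge0// ler_pdivrMr// mul1r.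
Qed.

End holomorphic_functions.

(** * Integration in polar coordinates *)

Section plane_measure.
Local Open Scope ereal_scope.
Variable R : realType.
Notation leb := (@lebesgue_measure R).
Notation T := (measurableTypeR R).

(** Lebesgue measure is determined by its values on half-open intervals, so checking these
    identifies the whole image measure. *)
Lemma lebesgue_pushforward_unique d (X : measurableType d)
    (m : {measure set X -> \bar R}) (phi : X -> T) :
  measurable_fun setT phi ->
  (forall c e : R, leb `]c, e]%classic = m (phi @^-1` `]c, e]%classic)) ->
  forall f : R -> \bar R, measurable_fun setT f -> (forall x, 0 <= f x) ->
  \int[m]_x f (phi x) = \int[leb]_x f x.
Proof.
move=> mphi itvE f mf f0.
have mE A : measurable A -> leb A = m (phi @^-1` A).
  apply: (@lebesgue_measure_unique R
    (measure_function_pushforward__canonical__measure_function_Measure m mphi)).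
  by move=> _ [[c e] _ <-]; exact: itvE.
rewrite -(@ge0_integral_pushforward _ _ _ _ R phi mphi m setT f)//.
apply: eq_measure_integral => A mA _.
exact/esym/mE.
Qed.

Lemma ge0_integral_shift (f : R -> \bar R) (a : R) :
  measurable_fun setT f -> (forall x, 0 <= f x) ->
  \int[leb]_x f (x + a)%R = \int[leb]_x f x.
Proof.
move=> mf f0.
apply: (@lebesgue_pushforward_unique _ T leb (fun x => x + a)%R) => //.
  by apply: measurable_funD => //; exact: measurable_cst.
move=> c e.
rewrite (_ : _ @^-1` _ = `](c - a)%R, (e - a)%R]%classic); last first.
  by apply/seteqP; split => x /=; rewrite !in_itv/= ltrBlDr lerBrDr.
apply: etrans (lebesgue_measure_itv _) _; apply: esym.
apply: etrans (lebesgue_measure_itv _) _.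
rewrite /= !lte_fin ltrD2r -!EFinD.
by rewrite (_ : e - a - (c - a) = e - c)%R//; ring.
Qed.

Notation leb2 := (sigma_prod leb leb).

Lemma ge0_integral_prod d1 d2 (T1 : measurableType d1) (T2 : measurableType d2)
    (m1 : {sigma_finite_measure set T1 -> \bar R})
    (m2 : {sigma_finite_measure set T2 -> \bar R}) (F : T1 * T2 -> \bar R) :
  measurable_fun setT F -> (forall p, 0 <= F p) ->
  \int[sigma_prod m1 m2]_p F p = \int[m1]_x \int[m2]_y F (x, y).
Proof. by move=> mF F0; rewrite /sigma_prod fubini_tonelli1. Qed.

Lemma ge0_integral_prod_swap d1 d2 (T1 : measurableType d1) (T2 : measurableType d2)
    (m1 : {sigma_finite_measure set T1 -> \bar R})
    (m2 : {sigma_finite_measure set T2 -> \bar R}) (F : T1 * T2 -> \bar R) :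
  measurable_fun setT F -> (forall p, 0 <= F p) ->
  \int[sigma_prod m1 m2]_p F p = \int[m2]_y \int[m1]_x F (x, y).
Proof. by move=> mF F0; rewrite /sigma_prod fubini_tonelli2. Qed.

Lemma measurable_affine2 (a b : R) :
  measurable_fun setT (fun p : T * T => (a * p.1 + b * p.2)%R : T).
Proof.
by apply: measurable_funD; apply: measurable_funM; [exact: measurable_cst|exact: measurable_fst|exact: measurable_cst|exact: measurable_snd].
Qed.

Definition shear1 (a : R) (p : T * T) : T * T := (p.1 + a * p.2, p.2)%R.
Definition shear2 (a : R) (p : T * T) : T * T := (p.1, a * p.1 + p.2)%R.

Lemma measurable_shear1 a : measurable_fun setT (shear1 a).
Proof.
apply/measurable_fun_pairP; split; last exact: measurable_snd.
by have := measurable_affine2 1 a; under eq_fun do rewrite mul1r.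
Qed.

Lemma measurable_shear2 a : measurable_fun setT (shear2 a).
Proof.
apply/measurable_fun_pairP; split; first exact: measurable_fst.
by have := measurable_affine2 a 1; under eq_fun do rewrite mul1r.
Qed.

(** With the second coordinate fixed, the shear translates the first; Tonelli's theorem reduces the
    claim to translation invariance. *)
Lemma ge0_integral_shear1 a (F : T * T -> \bar R) :
  measurable_fun setT F -> (forall p, 0 <= F p) ->
  \int[leb2]_p F (shear1 a p) = \int[leb2]_p F p.
Proof.
move=> mF F0; rewrite ge0_integral_prod_swap//; last first.
  exact: measurableT_comp mF (measurable_shear1 a).
rewrite [RHS]ge0_integral_prod_swap//; apply: eq_integral => y _.
rewrite /shear1 /=.
apply: (@ge0_integral_shift (fun x => F (x, y)) (a * y)%R) => //.
exact: measurableT_comp mF (measurable_pair2 y).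
Qed.

Lemma ge0_integral_shear2 a (F : T * T -> \bar R) :
  measurable_fun setT F -> (forall p, 0 <= F p) ->
  \int[leb2]_p F (shear2 a p) = \int[leb2]_p F p.
Proof.
move=> mF F0; rewrite ge0_integral_prod//; last first.
  exact: measurableT_comp mF (measurable_shear2 a).
rewrite [RHS]ge0_integral_prod//; apply: eq_integral => x _.
rewrite /shear2 /=; under eq_integral do rewrite addrC.
apply: (@ge0_integral_shift (fun y => F (x, y)) (a * x)%R) => //.
exact: measurableT_comp mF (measurable_pair1 x).
Qed.

Definition rot (u : R[i]) (p : T * T) : T * T :=
  (Re u * p.1 - Im u * p.2, Im u * p.1 + Re u * p.2)%R.

Lemma measurable_rot u : measurable_fun setT (rot u).
Proof.
apply/measurable_fun_pairP; split; last exact: measurable_affine2.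
have := measurable_affine2 (Re u) (- Im u).
by under eq_fun do rewrite mulNr.
Qed.

(* A rotation is a product of three shears. *)
Lemma ge0_integral_rot (u : R[i]) (F : T * T -> \bar R) :
  nc u = 1%R -> (1 + Re u != 0)%R ->
  measurable_fun setT F -> (forall p, 0 <= F p) ->
  \int[leb2]_p F (rot u p) = \int[leb2]_p F p.
Proof.
(* [t] is the tangent of half the rotation angle; the hypothesis on [1 + Re u] excludes the half
   turn, where it is infinite. *)
move=> u1 u0 mF F0; pose t := (Im u / (1 + Re u))%R.
have cs : (Re u ^+ 2 + Im u ^+ 2 = 1)%R by rewrite -nc_sqr u1 expr1n.
have tE : (t * Im u = 1 - Re u)%R.
  rewrite /t mulrAC -expr2 (_ : Im u ^+ 2 = (1 - Re u) * (1 + Re u))%R.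
    by rewrite mulfK.
  by move: cs; rewrite !expr2; lra.
have rotE p : rot u p = shear1 (- t) (shear2 (Im u) (shear1 (- t) p)).
  case: p => x y; rewrite /rot /shear1 /shear2 /=; congr (_, _).
    have t1 : (t * (1 + Re u) = Im u)%R by rewrite /t divfK.
    rewrite (_ : x + - t * y + - t * (Im u * (x + - t * y) + y) =
      (1 - t * Im u) * x - (t + (1 - t * Im u) * t) * y)%R; last by ring.
    rewrite tE (_ : 1 - (1 - Re u) = Re u)%R; last by ring.
    by rewrite -[in LHS]t1; ring.
  rewrite (_ : Im u * (x + - t * y) + y = Im u * x + (1 - t * Im u) * y)%R.
    by rewrite tE; ring.
  ring.
under eq_integral do rewrite rotE.
have m1 : measurable_fun setT (fun p => F (shear1 (- t) p)).
  exact: measurableT_comp mF (measurable_shear1 _).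
have m2 : measurable_fun setT (fun p => F (shear1 (- t) (shear2 (Im u) p))).
  exact: measurableT_comp m1 (measurable_shear2 _).
rewrite (ge0_integral_shear1 (- t) m2)// (ge0_integral_shear2 (Im u) m1)//.
by rewrite ge0_integral_shear1.
Qed.

Definition sqn (p : T * T) : T := (p.1 ^+ 2 + p.2 ^+ 2)%R.

Lemma measurable_sqn : measurable_fun setT sqn.
Proof.
by apply: measurable_funD; apply: measurable_funX; [exact: measurable_fst|exact: measurable_snd].
Qed.

(** Area of the disc of radius [Num.sqrt b] summed over vertical chords, by the substitution x =
    sqrt(b) sin(theta). It is the source of the factor pi in the polar formula. *)
Lemma integral_half_disc (b : R) : (0 < b)%R ->
  \int[leb]_(x in `[(- Num.sqrt b)%R, Num.sqrt b]%classic)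
    (2 * Num.sqrt (b - x ^+ 2))%:E = (pi * b)%:E.
Proof.
move=> b0; pose r : R := Num.sqrt b.
have r0 : (0 < r)%R by rewrite sqrtr_gt0.
have rr : (r ^+ 2 = b)%R by rewrite sqr_sqrtr// ltW.
pose F (x : R) : R := (r * sin x)%R.
pose G (x : R) : R := (2 * Num.sqrt (b - x ^+ 2))%R.
have cG : continuous G.
  move=> x; apply: cvgM; first exact: cvg_cst.
  apply: (@continuous_comp _ _ _ (fun x : R => b - x ^+ 2)%R (@Num.sqrt R)).
    by apply: cvgB; [exact: cvg_cst|exact: exprn_continuous].
  exact: sqrt_continuous.
have dF (x : R) : is_derive x 1%R F (r * cos x)%R.
  have := is_derive1M (is_derive_cst r x 1%R) (is_derive_sin x).
  by rewrite mul0r add0r.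
have F'E : F^`()%classic = (fun x => r * cos x)%R.
  by apply/funext => x; rewrite derive1E; exact: derive_val.
have cF' : continuous (fun x : R => r * cos x)%R.
  by move=> x; apply: cvgM; [exact: cvg_cst|exact: continuous_cos].
have cF (x : R) : {for x, continuous F} by exact: is_derive1_continuous (dF x).
have p2 : (0 < (pi : R) / 2)%R by rewrite divr_gt0 ?pi_gt0.
have ab : (- ((pi : R) / 2) < (pi : R) / 2)%R by lra.
have FaE : F (- (pi / 2))%R = (- r)%R by rewrite /F sinN sin_pihalf mulrN1.
have FbE : F (pi / 2)%R = r by rewrite /F sin_pihalf mulr1.
have := @integration_by_substitution_increasing R F G (- (pi / 2))%R (pi / 2)%R
  (ltW ab).
rewrite FaE FbE -/r => ->.
- rewrite F'E.
  transitivity (\int[leb]_(x in `[(- (pi / 2))%R, (pi / 2)%R])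
     (b * (1 + cos (2 * x)))%:E).
    apply: eq_integral => x; rewrite inE /= in_itv/= => xab; congr EFin.
    have cx : (0 <= cos x)%R by apply: cos_ge0_pihalf.
    have sq : Num.sqrt (b - (r * sin x) ^+ 2) = (r * cos x)%R.
      rewrite -[RHS]ger0_norm ?mulr_ge0 ?(ltW r0)// -sqrtr_sqr; congr Num.sqrt.
      by rewrite !exprMn rr cos2sin2; ring.
    change (G (F x) * (r * cos x) = b * (1 + cos (2 * x)))%R.
    have c2 : (cos (2 * x) = cos x ^+ 2 - sin x ^+ 2)%R.
      by rewrite mulr_natl mulr2n cosD -!expr2.
    rewrite /G /F sq c2 -rr.
    have := cos2Dsin2 x; move: (cos x) (sin x) => c s h.
    by rewrite (_ : s ^+ 2 = 1 - c ^+ 2)%R; [ring|rewrite -h; ring].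
  pose H (x : R) : R := (b * (x + sin (2 * x) / 2))%R.
  have d2 (x : R) : is_derive x 1%R (fun x : R => 2 * x)%R 2%R.
    have := is_derive1M (is_derive_cst (2%R : R) x 1%R) (is_derive_id x 1%R).
    by rewrite mul0r add0r mulr1.
  have dH (x : R) : is_derive x 1%R H (b * (1 + cos (2 * x)))%R.
    have h1 : is_derive x 1%R (fun x => sin (2 * x))%R (cos (2 * x) * 2)%R.
      exact: is_derive1_comp (is_derive_sin _) (d2 x).
    have := is_derive1M (is_derive_cst b x 1%R) (is_derive1D
      (is_derive_id x 1%R) (is_derive1M h1 (is_derive_cst (2^-1 : R)%R x 1%R))).
    by rewrite mul0r add0r mulr0 addr0 mulfK.
  rewrite (@continuous_FTC2 _ _ H)//.
  + rewrite /H mulrN sinN (_ : 2 * (pi / 2) = pi)%R ?sinpi; last by field.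
    by rewrite -EFinB; congr EFin; field.
  + apply: continuous_subspaceT => x; apply: cvgM; first exact: cvg_cst.
    apply: cvgD; first exact: cvg_cst.
    apply: (@continuous_comp _ _ _ (fun x : R => 2 * x)%R (@cos R)).
      exact: is_derive1_continuous (d2 x).
    exact: continuous_cos.
  + split.
    * by move=> x _; apply: ex_derive; exact: dH.
    * by apply: cvg_at_right_filter; exact: is_derive1_continuous (dH _).
    * by apply: cvg_at_left_filter; exact: is_derive1_continuous (dH _).
  + by move=> x _; rewrite derive1E; apply: derive_val; exact: dH.
- move=> x y xab yab xy; rewrite /F ltr_pM2l//.
  by rewrite ltr_sin.
- by move=> x _; rewrite F'E; exact: cF'.
- rewrite F'E; apply/cvg_ex; exists (r * cos (- (pi / 2)))%R.
  by apply: cvg_at_right_filter; exact: cF'.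
- rewrite F'E; apply/cvg_ex; exists (r * cos (pi / 2))%R.
  by apply: cvg_at_left_filter; exact: cF'.
- split.
  * by move=> x _; apply: ex_derive; exact: dF.
  * by apply: cvg_at_right_filter; exact: cF.
  * by apply: cvg_at_left_filter; exact: cF.
- exact: continuous_subspaceT.
Qed.

Lemma xsectionE (P : T * T -> bool) x y : xsection [set p | P p] x y = P (x, y).
Proof. by rewrite /xsection /=; apply/propext; split; rewrite inE. Qed.

Lemma disc_area (b : R) : leb2 [set p | (sqn p <= b)%R] = (pi * Num.max 0 b)%:E.
Proof.
have mD : measurable [set p | (sqn p <= b)%R].
  rewrite (_ : [set _ | _] = sqn @^-1` `]-oo, b]%classic).
    by rewrite -[X in measurable X]setTI; apply: measurable_sqn.
  by apply/seteqP; split => p /=; rewrite in_itv/=.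
have [b0|b0] := leP b 0%R.
  rewrite mulr0; apply/eqP; rewrite eq_le measure_ge0 andbT.
  (* For [b <= 0] the set lies in the line where the first coordinate vanishes, which has measure
     zero. *)
  have -> : 0%:E = leb2 ([set 0%R] `*` [set: T]).
    have z0 : leb [set (0%R : T)] = 0 := lebesgue_measure_set1 0%R.
    have m0 : measurable [set (0%R : T)] by exact: measurable_set1.
    apply: esym; apply: etrans (product_measure1E leb leb m0 measurableT) _.
    by apply: etrans (congr1 (fun w => w * _) z0) _; rewrite mul0e.
  apply: le_measure; rewrite ?inE//; first exact: measurableX.
  move=> [x y] /=; rewrite /sqn /= => h; split => //=; apply/eqP.
  rewrite -sqrf_eq0 eq_le sqr_ge0 andbT (le_trans _ (le_trans h b0))//.
  by rewrite lerDl sqr_ge0.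
rewrite -(integral_half_disc b0) /sigma_prod /product_measure1.
pose r : R := Num.sqrt b.
rewrite [RHS]integral_mkcond; apply: eq_integral => x _ /=.
rewrite patchE; case: ifPn => [|xr].
  rewrite inE /= in_itv /= => xr.
  rewrite (_ : xsection _ _ = `[(- Num.sqrt (b - x ^+ 2))%R, Num.sqrt (b - x ^+ 2)]%classic).
    rewrite lebesgue_measure_itv/= lte_fin.
    have := sqrtr_ge0 (b - x ^+ 2)%R; rewrite le_eqVlt => /predU1P[<-|s0].
      by rewrite oppr0 ltxx mulr0.
    by rewrite ifT -?EFinD ?opprK ?mulr_natl//; lra.
  have bx : (0 <= b - x ^+ 2)%R.
    rewrite subr_ge0 -[leRHS](@sqr_sqrtr _ b) ?(ltW b0)//.
    by rewrite -(real_normK (num_real x)) lerXn2r ?nnegrE ?sqrtr_ge0// ler_norml.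
  apply/seteqP; split => y /=; rewrite xsectionE.
    rewrite /sqn /= => h; rewrite in_itv/= -ler_norml -sqrtr_sqr.
    by rewrite ler_wsqrtr// lerBrDl.
  rewrite in_itv/= -ler_norml -sqrtr_sqr ler_sqrt// /sqn/= => h.
  by rewrite -lerBrDl.
rewrite (_ : xsection _ _ = set0) ?measure0//.
apply/seteqP; split => y //; rewrite xsectionE /sqn /= => h.
move: xr; rewrite notin_setE /= in_itv /=; apply.
rewrite -ler_norml -sqrtr_sqr ler_wsqrtr// (le_trans _ h)// lerDl sqr_ge0//.
Qed.

Lemma annulus_area (c e : R) : (c <= e)%R ->
  leb2 (sqn @^-1` `]c, e]%classic) = (pi * (Num.max 0 e - Num.max 0 c))%:E.
Proof.
move=> ce.
have mD b : measurable [set p | (sqn p <= b)%R].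
  rewrite (_ : [set _ | _] = sqn @^-1` `]-oo, b]%classic).
    by rewrite -[X in measurable X]setTI; apply: measurable_sqn.
  by apply/seteqP; split => p /=; rewrite in_itv/=.
rewrite (_ : _ @^-1` _ = [set p | (sqn p <= e)%R] `\` [set p | (sqn p <= c)%R]).
  have dfin : leb2 [set p | (sqn p <= e)%R] < +oo by rewrite disc_area ltry.
  rewrite measureD//.
  rewrite (_ : _ `&` _ = [set p | (sqn p <= c)%R]); last first.
    by apply/setIidr => p /= /le_trans; apply.
  by apply: etrans (congr2 (fun x y => x - y) (disc_area e) (disc_area c)) _; rewrite -EFinB mulrBr.
apply/seteqP; split => p /=; rewrite in_itv/=.
  by move=> /andP[h1 h2]; split => //; apply/negP; rewrite -ltNge.
by move=> [h1 /negP]; rewrite -ltNge => h2; rewrite h2.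
Qed.

(** The area of {|z|^2 <= b} is linear in b >= 0, so the image of planar measure under [sqn] is pi
    times Lebesgue measure on the half-line. *)
Lemma ge0_integral_radial (h : R -> \bar R) :
  measurable_fun setT h -> (forall x, 0 <= h x) ->
  \int[leb2]_p h (sqn p) = pi%:E * \int[leb]_(s in `[0%R, +oo[%classic) h s.
Proof.
move=> mh h0.
have ipi0 : (0 <= (pi : R)^-1)%R by rewrite invr_ge0 pi_ge0.
pose nu := measure_function_pushforward__canonical__measure_function_Measure
  leb2 measurable_sqn.
have mN : measurable (`]-oo, 0%R[%classic : set T) by exact: measurable_itv.
(* The normalized image measure is completed by Lebesgue measure on the negative reals, so that
   uniqueness of Lebesgue measure on the whole line applies. *)
pose mu := measure_add (mscale (NngNum ipi0) nu) (mrestr leb mN).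
have muA A : mu A = (pi^-1)%:E * leb2 (sqn @^-1` A) + leb (A `&` `]-oo, 0%R[%classic).
  by rewrite /mu measure_addE.
have muE A : measurable A -> leb A = mu A.
  apply: (@lebesgue_measure_unique R mu) => _ [[c e] _ <-].
  apply: etrans _ (esym (muA _)); rewrite /=.
  have [ec|ce] := leP e c.
    by rewrite set_itv_ge ?bnd_simp -?leNgt// set0I !measure0 mule0 adde0.
  rewrite annulus_area ?(ltW ce)// -EFinM mulrA mulVf ?gt_eqF ?pi_gt0//.
  rewrite mul1r; apply: etrans (lebesgue_measure_itv _) _; rewrite /= lte_fin ce.
  have [e0|e0] := ltP e 0%R.
    rewrite (_ : _ `&` _ = `]c, e]%classic); last first.
      apply/setIidl => x /=; rewrite !in_itv/= => /andP[_ xe].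
      exact: le_lt_trans xe e0.
    apply: esym; rewrite [X in _ + X](_ : _ = (e - c)%:E).
      by rewrite !max_l ?(ltW e0) ?(ltW (lt_trans ce e0))// subrr add0e EFinB.
    by apply: etrans (lebesgue_measure_itv _) _; rewrite /= lte_fin ce.
  have [c0|c0] := ltP c 0%R.
    rewrite (_ : _ `&` _ = `]c, 0%R[%classic); last first.
      apply/seteqP; split => x /=; rewrite !in_itv/=.
        by move=> [/andP[-> _] ->].
      by move=> /andP[-> x0]; rewrite x0 (le_trans (ltW x0)).
    apply: esym; rewrite [X in _ + X](_ : _ = (0 - c)%:E).
      by rewrite subr0 sub0r.
    by apply: etrans (lebesgue_measure_itv _) _; rewrite /= lte_fin c0.
  rewrite (_ : _ `&` _ = set0) ?measure0; last first.
    apply/seteqP; split => x //=; rewrite !in_itv/= => -[/andP[cx _]].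
    by rewrite ltNge (le_trans c0 (ltW cx)).
  by rewrite adde0 EFinB.
rewrite (@eq_measure_integral _ _ _ _ (mscale (NngNum ipi0) nu)); last first.
  move=> A mA Apos; apply: etrans (muE _ mA) _; apply: etrans (muA _) _.
  rewrite (_ : A `&` _ = set0) ?measure0 ?adde0//.
  apply/seteqP; split => x // -[/Apos] /=; rewrite !in_itv/= andbT leNgt.
  by move=> /negbTE ->.
rewrite ge0_integral_mscale//=; last exact: measurable_funTS.
rewrite muleA -EFinM divff ?gt_eqF ?pi_gt0// mul1e.
rewrite (ge0_integral_pushforward measurable_sqn)//=; last exact: measurable_funTS.
apply: (congr1 (fun D => integral leb2 D (h \o sqn))).
apply/seteqP; split => p //= _; rewrite in_itv/= andbT.
by rewrite addr_ge0// sqr_ge0.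
Qed.


(** Extended by zero to negative reals, so that integrals over half-lines and over [0, v] become
    integrals over the whole line, where translation and Tonelli's theorem apply directly. *)
Definition hpow (k : nat) (x : R) : R := if (0 <= x)%R then (x ^+ k)%R else 0%R.

Lemma hpow_ge0 k x : (0 <= hpow k x)%R.
Proof. by rewrite /hpow; case: ifP => // x0; rewrite exprn_ge0. Qed.

Lemma measurable_hpow k : measurable_fun [set: T] (hpow k : T -> T).
Proof.
apply: measurable_fun_if => //=.
by apply: measurable_fun_ler => //; exact: measurable_cst.
Qed.

Definition hmoment (k : nat) (h : R -> \bar R) : \bar R :=
  \int[leb]_s ((hpow k s)%:E * h s).

Lemma hmoment_itv k h :
  hmoment k h = \int[leb]_(s in `[0%R, +oo[%classic) ((s ^+ k)%:E * h s).
Proof.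
rewrite /hmoment [RHS]integral_mkcond; apply: eq_integral => s _.
rewrite patchE; case: ifPn => [|].
  by rewrite inE /= in_itv/= andbT /hpow => ->.
by rewrite notin_setE /= in_itv/= andbT /hpow => /negP/negbTE ->; rewrite mul0e.
Qed.

Lemma ge0_integral_plane k (h : R -> \bar R) :
  measurable_fun setT h -> (forall x, 0 <= h x) ->
  \int[leb2]_p ((sqn p ^+ k)%:E * h (sqn p)) = pi%:E * hmoment k h.
Proof.
move=> mh h0; pose H (s : R) := (hpow k s)%:E * h s.
transitivity (\int[leb2]_p H (sqn p)).
  apply: eq_integral => p _; rewrite /H /hpow.
  by rewrite addr_ge0// sqr_ge0.
rewrite ge0_integral_radial.
- congr (_ * _); rewrite hmoment_itv; apply: eq_integral => s.
  by rewrite inE /= in_itv/= andbT /H /hpow => ->.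
- apply: emeasurable_funM => //; apply/measurable_EFinP; exact: measurable_hpow.
- by move=> x; rewrite mule_ge0// lee_fin hpow_ge0.
Qed.

Lemma is_derive1X (f : R -> R) (x df : R) k : is_derive x 1%R f df ->
  is_derive x 1%R (fun t => f t ^+ k.+1)%R (k.+1%:R * f x ^+ k * df)%R.
Proof.
move=> hf; elim: k => [|k IH].
  by rewrite expr0 mulr1 mul1r; under eq_fun do rewrite expr1.
under eq_fun do rewrite exprS.
rewrite (_ : (_ * df)%R = (df * f x ^+ k.+1 + f x * (k.+1%:R * f x ^+ k * df))%R).
  exact: is_derive1M.
by rewrite -[in LHS]natr1 exprS; ring.
Qed.

Lemma Rintegral_beta a M (v : R) : (0 < v)%R ->
  (\int[leb]_(t in `[0%R, v]) (t ^+ a * (v - t) ^+ M) =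
   (a`! * M`!)%:R / (a + M).+1`!%:R * v ^+ (a + M).+1)%R.
Proof.
move=> v0.
have dvt (x : R) : is_derive x 1%R (fun t : R => v - t)%R (-1)%R.
  have := is_derive1B (is_derive_cst v x 1%R) (is_derive_id x 1%R).
  by rewrite sub0r.
have cvt b : continuous (fun t : R => (v - t) ^+ b)%R.
  move=> x; case: b => [|b]; first by under eq_fun do rewrite expr0; exact: cvg_cst.
  exact: is_derive1_continuous (is_derive1X b (dvt x)).
have ct b : continuous (fun t : R => t ^+ b)%R by exact: exprn_continuous.
have factR b : (b`!%:R != 0 :> R)%R by rewrite pnatr_eq0 -lt0n fact_gt0.
elim: a M => [|a IH] M.
  have c0 : continuous (fun t : R => t ^+ 0 * (v - t) ^+ M)%R.
    by move=> x; apply: cvgM; [exact: ct|exact: cvt].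
  have d0 (x : R) : is_derive x 1%R
      (fun t : R => - (M.+1%:R)^-1 * (v - t) ^+ M.+1)%R (x ^+ 0 * (v - x) ^+ M)%R.
    have := is_derive1M (is_derive_cst (- (M.+1%:R)^-1 : R)%R x 1%R) (is_derive1X M (dvt x)).
    rewrite mul0r add0r (_ : (_ * (M.+1%:R * _ * -1))%R = x ^+ 0 * (v - x) ^+ M)%R//.
    rewrite expr0 /=; field.
    by rewrite nat1r pnatr_eq0.
  rewrite (Rintegral_FTC v0 c0 (fun x _ => d0 x)).
  rewrite subrr subr0 expr0n/= mulr0 sub0r mulNr opprK add0n fact0 mul1n factS natrM.
  by field; rewrite nat1r factR pnatr_eq0.
(* Integration by parts: [F] vanishes at both ends, and its derivative trades a power of [t] for a
   power of [v - t]. *)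
pose F (t : R) : R := (t ^+ a.+1 * (v - t) ^+ M.+1)%R.
have dF (x : R) : is_derive x 1%R F
   (a.+1%:R * (x ^+ a * (v - x) ^+ M.+1) - M.+1%:R * (x ^+ a.+1 * (v - x) ^+ M))%R.
  have := is_derive1M (is_derive1X a (is_derive_id x 1%R)) (is_derive1X M (dvt x)).
  by rewrite (_ : (_ + _)%R = (a.+1%:R * (x ^+ a * (v - x) ^+ M.+1) - M.+1%:R * (x ^+ a.+1 * (v - x) ^+ M))%R)//; ring.
have c1 b c : continuous (fun t : R => t ^+ b * (v - t) ^+ c)%R.
  by move=> x; apply: cvgM; [exact: ct|exact: cvt].
have ci k b c : leb.-integrable `[0%R, v] (EFin \o (fun t : R => k * (t ^+ b * (v - t) ^+ c)))%R.
  by apply: continuous_integrable => x; apply: cvgM; [exact: cvg_cst|exact: c1].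
have := @Rintegral_FTC R (fun x => a.+1%:R * (x ^+ a * (v - x) ^+ M.+1) -
  M.+1%:R * (x ^+ a.+1 * (v - x) ^+ M))%R F 0%R v v0.
have ci1 b c : leb.-integrable `[0%R, v] (EFin \o (fun t : R => t ^+ b * (v - t) ^+ c))%R.
  exact: continuous_integrable.
rewrite RintegralB// !RintegralZl//.
rewrite IH /F subrr expr0n/= mulr0 expr0n/= mul0r subrr => H.
have {}H := H _ (fun x _ => dF x).
have {}H : (M.+1%:R * \int[leb]_(x in `[0%R, v]) (x ^+ a.+1 * (v - x) ^+ M) =
  a.+1%:R * ((a`! * M.+1`!)%:R / (a + M.+1).+1`!%:R * v ^+ (a + M.+1).+1))%R.
  apply/eqP; rewrite eq_sym -subr_eq0; apply/eqP/H => x.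
  by apply: cvgB; apply: cvgM; do ?[exact: cvg_cst|exact: c1].
have M0 : (M.+1%:R != 0 :> R)%R by rewrite pnatr_eq0.
apply: (mulfI M0); rewrite H addSnnS !factS !natrM; field.
by rewrite factR /= gt_eqF// ltr_pwDl// !addr_ge0.
Qed.


Lemma integral_hpowM a M (v : R) :
  \int[leb]_t (hpow a t * hpow M (v - t))%:E =
  ((a`! * M`!)%:R / (a + M).+1`!%:R * hpow (a + M).+1 v)%:E.
Proof.
have -> : \int[leb]_t (hpow a t * hpow M (v - t))%:E =
    \int[leb]_(t in `[0%R, v]) (t ^+ a * (v - t) ^+ M)%:E.
  rewrite [RHS]integral_mkcond; apply: eq_integral => t _.
  rewrite patchE /hpow subr_ge0.
  have -> : (t \in `[0%R, v]%classic) = (0 <= t <= v)%R.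
    by apply/idP/idP; rewrite inE /= in_itv.
  by case: (0 <= t)%R; case: (t <= v)%R; rewrite /= ?mul0r ?mulr0.
rewrite /hpow; have [v0|v0|<-] := ltgtP 0%R v.
- rewrite -Rintegral_beta// /Rintegral fineK//.
  apply: integrable_fin_num => //; apply: continuous_integrable => x.
  apply: cvgM; first exact: exprn_continuous.
  case: M => [|M]; first by under eq_fun do rewrite expr0; exact: cvg_cst.
  have dvt : is_derive x 1%R (fun t : R => v - t)%R (0 - 1)%R.
    exact: is_derive1B (is_derive_cst v x 1%R) (is_derive_id x 1%R).
  exact: is_derive1_continuous (is_derive1X M dvt).
- by rewrite set_itv_ge ?bnd_simp -?ltNge// integral_set0 mulr0.
- by rewrite set_itv1 integral_set1 expr0n/= mulr0.
Qed.

Lemma measurable_conv k (h : R -> \bar R) : measurable_fun setT h ->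
  measurable_fun setT (fun p : T * T => (hpow k p.2)%:E * h (p.1 + p.2)%R).
Proof.
move=> mh; apply: emeasurable_funM.
  apply/measurable_EFinP; apply: (measurableT_comp (measurable_hpow k)).
  exact: measurable_snd.
apply: (measurableT_comp mh).
by have := measurable_affine2 1 1; under eq_fun do rewrite !mul1r.
Qed.

Lemma measurable_hmoment_shift k (h : R -> \bar R) :
  measurable_fun setT h -> (forall x, 0 <= h x) ->
  measurable_fun setT (fun s : T => hmoment k (fun u => h (s + u)%R)).
Proof.
move=> mh h0.
apply: (@measurable_fun_fubini_tonelli_F _ _ T T R leb _ (measurable_conv k mh)).
by move=> p; rewrite mule_ge0// lee_fin hpow_ge0.
Qed.

Lemma hmoment_ge0 k (h : R -> \bar R) : (forall x, 0 <= h x) -> 0 <= hmoment k h.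
Proof. by move=> h0; apply: integral_ge0 => x _; rewrite mule_ge0// lee_fin hpow_ge0. Qed.

(** In the variables t and v = t + u, the integral over t for fixed v is a Beta integral. This is
    what adding one complex coordinate does to the radial moments. *)
Lemma hmoment_convolution a M (h : R -> \bar R) :
  measurable_fun setT h -> (forall x, 0 <= h x) ->
  hmoment a (fun t => hmoment M (fun u => h (t + u)%R)) =
  ((a`! * M`!)%:R / (a + M).+1`!%:R)%:E * hmoment (a + M).+1 h.
Proof.
move=> mh h0; pose G (p : T * T) := (hpow a p.1 * hpow M (p.2 - p.1))%:E * h p.2.
have mG1 : measurable_fun setT (fun p : T * T => (hpow a p.1 * hpow M (p.2 - p.1))%:E).
  apply/measurable_EFinP; apply: measurable_funM.
    exact: measurableT_comp (measurable_hpow a) measurable_fst.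
  apply: (measurableT_comp (measurable_hpow M)).
  have := measurable_affine2 (-1) 1.
  by under eq_fun do rewrite mulN1r mul1r addrC.
have mG : measurable_fun setT G.
  by apply: emeasurable_funM mG1 _; exact: measurableT_comp mh measurable_snd.
have G0 p : 0 <= G p by rewrite mule_ge0// lee_fin mulr_ge0 ?hpow_ge0.
transitivity (\int[leb]_t \int[leb]_v G (t, v)).
  apply: eq_integral => t _.
  rewrite /hmoment -ge0_integralZl//; first last.
  - by rewrite lee_fin hpow_ge0.
  - by move=> u _; rewrite mule_ge0// lee_fin hpow_ge0.
  - exact: measurableT_comp (measurable_conv M mh) (measurable_pair1 t).
  rewrite -(ge0_integral_shift (f := fun v => G (t, v)) t)//.
    apply: eq_integral => u _; rewrite /G /= addrK EFinM -muleA.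
    by rewrite [(u + t)%R]addrC.
  exact: measurableT_comp mG (measurable_pair1 t).
rewrite fubini_tonelli//.
rewrite /hmoment -ge0_integralZl//; first last.
- by move=> u _; rewrite mule_ge0// lee_fin hpow_ge0.
- by apply: emeasurable_funM => //; apply/measurable_EFinP; exact: measurable_hpow.
apply: eq_integral => v _; rewrite /G /=.
rewrite ge0_integralZr//; first by rewrite integral_hpowM EFinM muleA.
- exact: measurableT_comp mG1 (measurable_pair2 v).
- by move=> t _; rewrite lee_fin mulr_ge0 ?hpow_ge0.
Qed.

End plane_measure.

(** * Integrals over C^n of functions of the squared moduli, and coordinate rotations *)

Section tuple_integrals.
Local Open Scope ereal_scope.
Variable R : realType.
Notation leb := (@lebesgue_measure R).
Notation T := (measurableTypeR R).
Notation leb2 := (sigma_prod leb leb).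

Lemma ge0_integral_tupleS d (X : measurableType d)
    (m : {sigma_finite_measure set X -> \bar R}) n (F : n.+1.-tuple X -> \bar R) :
  measurable_fun setT F -> (forall t, 0 <= F t) ->
  \int[tuple_measure m n.+1]_t F t =
  \int[m]_x \int[tuple_measure m n]_t F (cons_pair (x, t)).
Proof.
move=> mF F0.
have mFc : measurable_fun setT (F \o @cons_pair _ X n).
  by apply: measurableT_comp => //; exact: measurable_cons_pair.
rewrite -(ge0_integral_prod m (tuple_measure m n) (F := F \o @cons_pair _ X n))//; last first.
  by move=> p; exact: F0.
exact: (@ge0_integral_pushforward _ _ _ _ R _ (@measurable_cons_pair _ X n)
  (sigma_prod m (tuple_measure m n)) setT F).
Qed.

Definition sqnt n (t : n.-tuple (T * T)) : R := \sum_j sqn (tnth t j).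

Definition sqmono n (e : 'I_n -> nat) (t : n.-tuple (T * T)) : R :=
  \prod_j sqn (tnth t j) ^+ e j.

Lemma measurable_sqnt n : measurable_fun setT (@sqnt n : _ -> T).
Proof.
apply: measurable_sum => j.
exact: measurableT_comp (@measurable_sqn R) (measurable_tnth j).
Qed.

Lemma measurable_sqmono n e : measurable_fun setT (@sqmono n e : _ -> T).
Proof.
apply: measurable_prod => j _; apply: measurable_funX.
exact: measurableT_comp (@measurable_sqn R) (measurable_tnth j).
Qed.

Lemma sqmono_ge0 n e t : (0 <= @sqmono n e t)%R.
Proof. by apply: prodr_ge0 => j _; rewrite exprn_ge0// addr_ge0// sqr_ge0. Qed.

Lemma sqnt_cons n x t : (@sqnt n.+1 (cons_pair (x, t)) = sqn x + sqnt t)%R.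
Proof.
rewrite /sqnt big_ord_recl; congr (_ + _)%R.
by apply: eq_bigr => j _; rewrite tnthS.
Qed.

Lemma sqmono_cons n e x t : (@sqmono n.+1 e (cons_pair (x, t)) =
  sqn x ^+ e ord0 * sqmono (e \o lift ord0) t)%R.
Proof.
rewrite /sqmono big_ord_recl; congr (_ * _)%R.
by apply: eq_bigr => j _; rewrite tnthS.
Qed.

(** Dirichlet's integral, in squared moduli. Once the first coordinate [x] is fixed, the induction
    hypothesis is applied to [h] shifted by [sqn x]; the remaining planar integral is then a
    convolution of moments. *)
Lemma ge0_integral_sqmono n (e : 'I_n.+1 -> nat) (h : R -> \bar R) :
  measurable_fun setT h -> (forall x, 0 <= h x) ->
  \int[@lebesgue_Cn R n.+1]_t ((sqmono e t)%:E * h (sqnt t)) =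
  (pi ^+ n.+1 * (\prod_j (e j)`!)%:R / (\sum_j e j + n)`!%:R)%:E *
  hmoment (\sum_j e j + n) h.
Proof.
elim: n e h => [|n IH] e h mh h0.
  have mF : measurable_fun setT (fun t => (sqmono e t)%:E * h (sqnt t)).
    apply: emeasurable_funM; last exact: measurableT_comp mh (@measurable_sqnt _).
    by apply/measurable_EFinP; exact: measurable_sqmono.
  rewrite ge0_integral_tupleS//; last first.
    by move=> t; rewrite mule_ge0// lee_fin sqmono_ge0.
  transitivity (\int[leb2]_x ((sqn x ^+ e ord0)%:E * h (sqn x))).
    apply: eq_integral => x _ /=.
    (* The measure on 0-tuples is the Dirac mass at the empty tuple, so the inner integral is
       evaluation there. *)
    apply: etrans (integral_dirac _ _ _) _ => //.
      exact: measurableT_comp mF (measurableT_comp (@measurable_cons_pair _ _ 0)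
        (measurable_pair1 x)).
    rewrite diracE mem_set// mul1e.
    by rewrite sqmono_cons sqnt_cons /sqnt /sqmono !big_ord0 mulr1 addr0.
  rewrite ge0_integral_plane// !big_ord_recl !big_ord0 addn0 muln1 addn0 expr1.
  by rewrite mulfK// pnatr_eq0 -lt0n fact_gt0.
rewrite ge0_integral_tupleS//; last 2 first.
- apply: emeasurable_funM; last exact: measurableT_comp mh (@measurable_sqnt _).
  by apply/measurable_EFinP; exact: measurable_sqmono.
- by move=> t; rewrite mule_ge0// lee_fin sqmono_ge0.
pose e' := e \o lift ord0.
pose k := (\sum_j e' j + n)%N.
pose c : R := (pi ^+ n.+1 * (\prod_j (e' j)`!)%:R / k`!%:R)%R.
have c0 : (0 <= c)%R by rewrite divr_ge0// mulr_ge0// exprn_ge0// pi_ge0.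
pose H s := c%:E * hmoment k (fun u => h (s + u)%R).
have mshift s : measurable_fun setT (fun u : R => h (s + u)%R).
  by apply: measurableT_comp mh _; apply: measurable_funD => //; exact: measurable_cst.
transitivity (\int[leb2]_x ((sqn x ^+ e ord0)%:E * H (sqn x))).
  apply: eq_integral => x _; rewrite /H.
  rewrite -(IH e' (fun u => h (sqn x + u)%R))//.
  rewrite -ge0_integralZl//; first last.
  - by rewrite lee_fin exprn_ge0// addr_ge0// sqr_ge0.
  - by move=> t _; rewrite mule_ge0// lee_fin sqmono_ge0.
  - apply: emeasurable_funM; first by apply/measurable_EFinP; exact: measurable_sqmono.
    exact: measurableT_comp (mshift _) (@measurable_sqnt _).
  apply: eq_integral => t _.
  by rewrite sqmono_cons sqnt_cons EFinM muleA.
rewrite ge0_integral_plane; first last.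
- by move=> s; rewrite mule_ge0// hmoment_ge0.
- apply: measurable_funeM; exact: measurable_hmoment_shift.
have -> : hmoment (e ord0) H = c%:E * hmoment (e ord0)
    (fun s => hmoment k (fun u => h (s + u)%R)).
  rewrite /hmoment -ge0_integralZl//; first last.
  - by move=> s _; rewrite mule_ge0// ?lee_fin ?hpow_ge0//; exact: hmoment_ge0.
  - apply: emeasurable_funM; first by apply/measurable_EFinP; exact: measurable_hpow.
    exact: measurable_hmoment_shift.
  by apply: eq_integral => s _; rewrite /H muleCA.
rewrite hmoment_convolution// !muleA -!EFinM.
have -> : (\sum_j e j + n.+1)%N = (e ord0 + k).+1.
  by rewrite big_ord_recl addnS addnA.
congr (_%:E * _); rewrite big_ord_recl /c [in RHS]exprS.
change (\prod_(i < n.+1) (e (lift ord0 i))`!)%N with (\prod_j (e' j)`!)%N.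
have : (k`!%:R != 0 :> R)%R by rewrite pnatr_eq0 -lt0n fact_gt0.
move: (k`!)%N ((e ord0 + k).+1`!)%N => kf K.
by rewrite !natrM; move: (K%:R^-1)%R (kf%:R)%R => x z z0; field.
Qed.


Definition rott n (u : 'I_n -> R[i]) (t : n.-tuple (T * T)) : n.-tuple (T * T) :=
  [tuple rot (u j) (tnth t j) | j < n].

Lemma measurable_rott n u : measurable_fun setT (@rott n u).
Proof.
apply/measurable_fun_tnthP => j.
rewrite (_ : _ \o _ = fun t => rot (u j) (tnth t j)); last first.
  by apply/funext => t /=; rewrite tnth_mktuple.
exact: measurableT_comp (measurable_rot (u j)) (measurable_tnth j).
Qed.

Lemma rott_cons n u x t :
  @rott n.+1 u (cons_pair (x, t)) = cons_pair (rot (u ord0) x, rott (u \o lift ord0) t).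
Proof.
apply: eq_from_tnth => j; rewrite tnth_mktuple.
have [i ->|->] := unliftP ord0 j; last by [].
by rewrite !tnthS tnth_mktuple.
Qed.

Lemma ge0_integral_rott n (u : 'I_n -> R[i]) (F : n.-tuple (T * T) -> \bar R) :
  (forall j, nc (u j) = 1 /\ 1 + Re (u j) != 0)%R ->
  measurable_fun setT F -> (forall t, 0 <= F t) ->
  \int[@lebesgue_Cn R n]_t F (rott u t) = \int[@lebesgue_Cn R n]_t F t.
Proof.
elim: n u F => [|n IH] u F u1 mF F0.
  by apply: eq_integral => t _; congr F; apply: eq_from_tnth; case.
rewrite ge0_integral_tupleS//; last exact: measurableT_comp mF (measurable_rott u).
rewrite [RHS]ge0_integral_tupleS//.
pose G x := \int[@lebesgue_Cn R n]_t F (cons_pair (x, t)).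
have mFc : measurable_fun setT (fun p => F (cons_pair p)).
  exact: measurableT_comp mF (@measurable_cons_pair _ _ n).
transitivity (\int[leb2]_x G (rot (u ord0) x)).
  apply: eq_integral => x _.
  under eq_integral do rewrite rott_cons.
  rewrite (IH (u \o lift ord0) (fun t => F (cons_pair (rot (u ord0) x, t))))//.
  - by move=> j; exact: u1.
  - exact: measurableT_comp mFc (measurable_pair1 _).
have [u01 u02] := u1 ord0.
rewrite ge0_integral_rot//.
- exact: (measurable_fun_fubini_tonelli_F _ mFc).
- by move=> x; apply: integral_ge0.
Qed.

Lemma sqn_rot (u : R[i]) (p : T * T) : nc u = 1%R -> sqn (rot u p) = sqn p.
Proof.
move=> u1; have := nc_sqr u; rewrite u1 expr1n => h.
rewrite /sqn /rot /=; transitivity ((Re u ^+ 2 + Im u ^+ 2) * (p.1 ^+ 2 + p.2 ^+ 2))%R.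
  by ring.
by rewrite -h mul1r.
Qed.

Lemma sqnt_rott n u t : (forall j, nc (u j) = 1)%R -> sqnt (@rott n u t) = sqnt t.
Proof.
by move=> u1; apply: eq_bigr => j _; rewrite tnth_mktuple sqn_rot.
Qed.

Lemma cvec_rott n u t j : (cvec (@rott n u t) j 0 = u j * cvec t j 0)%R.
Proof.
rewrite !mxE tnth_mktuple; case: (u j) (tnth t j) => a b [x y].
by apply/eqP; rewrite eq_complex /= !eqxx/= addrC eqxx.
Qed.

End tuple_integrals.

(** * Reproduction by kernel powers *)

Section multinomial.
Variables (K : numFieldType) (n m : nat).
Notation expo := {ffun 'I_n -> 'I_m.+1}.
Implicit Types (x : 'I_n -> K) (e : expo).

Let deg e := (\sum_j e j)%N.
Let w x e : K := \prod_j (x j ^+ e j / (e j)`!%:R).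

Let S x k := \sum_(e : expo | deg e == k) w x e.

(** Raising and lowering the j-th exponent. [inord] falls back to 0 beyond the bound, which
    [deg e < m] excludes for [up]; natural subtraction makes [dn] the identity when the exponent is
    0. *)
Let up (j : 'I_n) e : expo := [ffun i => inord (e i + (i == j))].
Let dn (j : 'I_n) e : expo := [ffun i => inord (e i - (i == j))].

Let deg_le e j : (e j <= deg e)%N.
Proof. by rewrite /deg (bigD1 j)//= leq_addr. Qed.

Let upE j e i : (deg e < m)%N -> up j e i = (e i + (i == j))%N :> nat.
Proof.
by move=> em; rewrite ffunE inordK//; have := deg_le e i; case: (i == j); lia.
Qed.

Let dnE j e i : dn j e i = (e i - (i == j))%N :> nat.
Proof.
by rewrite ffunE inordK// (leq_ltn_trans (leq_subr _ _)).
Qed.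

Let deg_up j e : (deg e < m)%N -> deg (up j e) = (deg e).+1.
Proof.
move=> em; rewrite /deg; under eq_bigr => i _ do rewrite upE//.
rewrite big_split /= (_ : \sum_i (i == j) = 1)%N ?addn1//.
by rewrite (bigD1 j)//= eqxx big1// => i /negbTE ->.
Qed.

Let deg_dn j e : (0 < e j)%N -> deg e = (deg (dn j e)).+1.
Proof.
move=> ej; rewrite /deg; under [in RHS]eq_bigr => i _ do rewrite dnE.
rewrite (bigD1 j)//= [in RHS](bigD1 j)//= eqxx subn1 -addSn prednK//.
by congr addn; apply: eq_bigr => i /negbTE ->; rewrite subn0.
Qed.

(** Multiplying a divided monomial by [x j] raises its j-th exponent and produces that new exponent
    as a factor. Summed over j, these factors add up to the degree [k.+1]. *)
Let S_rec x k : (k < m)%N -> (\sum_j x j) * S x k = k.+1%:R * S x k.+1.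
Proof.
move=> km.
have wE e j : deg e == k.+1 -> (e j)%:R * w x e =
    if (0 < e j)%N then x j * w x (dn j e) else 0.
  move=> _; case: posnP => [->|ej]; first by rewrite mul0r.
  rewrite /w (bigD1 j)//= [in RHS](bigD1 j)//= dnE eqxx subn1.
  rewrite [in RHS](eq_bigr (fun i => x i ^+ e i / (e i)`!%:R)); last first.
    by move=> i /negbTE ij; rewrite dnE ij subn0.
  rewrite -[in LHS](prednK ej) /= exprS factS natrM prednK//.
  have : (e j)%:R != 0 :> K by rewrite pnatr_eq0 -lt0n.
  have : ((e j).-1)`!%:R != 0 :> K by rewrite pnatr_eq0 -lt0n fact_gt0.
  move: (\prod_(_ | _) _) (_ ^+ _) ((e j).-1`!%:R) ((e j)%:R) => a b c d c0 d0.
  by field; rewrite c0 d0.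
rewrite /S [RHS]mulr_sumr.
transitivity (\sum_(e : expo | deg e == k.+1) \sum_j (e j)%:R * w x e); last first.
  by apply: eq_bigr => e /eqP <-; rewrite -mulr_suml -natr_sum.
rewrite exchange_big /= mulr_suml; apply: eq_bigr => j _.
transitivity (\sum_(e : expo | (deg e == k.+1) && (0 < e j)%N) x j * w x (dn j e)).
  rewrite mulr_sumr [RHS](reindex_onto (up j) (dn j)) /=; last first.
    move=> e /andP[ek ej]; apply/ffunP => i; apply/val_inj.
    have := deg_dn ej; rewrite (eqP ek) => -[dk].
    rewrite /= upE -?dk// dnE; case: eqVneq => [->|_]; last by rewrite subn0 addn0.
    by rewrite subnK.
  have up_dn e : (deg e < m)%N -> dn j (up j e) = e.
    move=> em; apply/ffunP => i; apply/val_inj.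
    by rewrite /= dnE upE// addnK.
  apply: eq_big => [e|e /eqP ek]; last by rewrite up_dn ?ek.
  apply/idP/idP => [/eqP ek|/andP[/andP[/eqP h1 h2] /eqP h3]].
    by rewrite deg_up ?ek// eqxx /= upE ?ek// eqxx addn1 /= up_dn ?ek.
  have := deg_dn h2; rewrite h1 h3 => -[->]; exact: eqxx.
rewrite [RHS]big_mkcond [LHS]big_mkcond/=; apply: eq_bigr => e _.
by case: ifPn => /= [/andP[ek ej]|]; [rewrite ek wE// ej|case: ifPn => //= ek; rewrite wE// => /negbTE ->].
Qed.

(** The bound [m] makes the exponents a finite type. It is kept apart from [k] so that the induction
    on [k] takes place in a single type. *)
Lemma multinomial x k : (k <= m)%N -> (\sum_j x j) ^+ k =
  \sum_(e : {ffun 'I_n -> 'I_m.+1} | (\sum_j e j)%N == k)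
    k`!%:R / (\prod_j (e j)`!)%:R * \prod_j x j ^+ e j.
Proof.
move=> km.
suff -> : (\sum_j x j) ^+ k = k`!%:R * S x k.
  rewrite /S mulr_sumr; apply: eq_bigr => e _.
  rewrite /w -mulrA; congr (_ * _).
  by rewrite prodf_div natr_prod mulrC.
elim: k km => [_|k IH km].
  rewrite expr0 fact0 mul1r /S (bigD1 [ffun=> ord0])//=; last first.
    by rewrite /deg big1// => j _; rewrite ffunE.
  rewrite /w big1 ?big1 ?addr0//; last by move=> j _; rewrite ffunE expr0 fact0 divr1.
  move=> e /andP[/eqP e0 /eqP []]; apply/ffunP => j; apply/val_inj; rewrite ffunE /=.
  by have := deg_le e j; rewrite e0 leqn0 => /eqP.
rewrite exprS IH ?(ltnW km)// mulrCA S_rec// mulrA; congr (_ * _).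
by rewrite factS natrM mulrC.
Qed.

End multinomial.

(** * Tails of integrable functions *)

Section tail.
Context d (T : measurableType d) (R : realType).
Variable mu : {measure set T -> \bar R}.

(** Dominated convergence, [g] being its own bound. The cut function [phi] is left general because
    two tails are needed: one on C^n cut by |z|^2, one on the line for the radial moment. *)
Lemma integral_tail_small (g : T -> R) (phi : T -> R) (e : R) :
  mu.-integrable setT (EFin \o g) -> (forall x, 0 <= g x) ->
  measurable_fun setT phi -> 0 < e ->
  \forall N \near \oo, mu.-integrable setT (EFin \o (fun x => if phi x <= N%:R then 0 else g x)) /\
    \int[mu]_x (if phi x <= N%:R then 0 else g x) <= e.
Proof.
move=> ig g0 mphi e0.
have mg : measurable_fun setT g by move/measurable_int : ig => /measurable_EFinP.
pose gN (N : nat) x : R := if phi x <= N%:R then 0 else g x.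
have mgN N : measurable_fun setT (gN N).
  by apply: measurable_fun_ifT => //; apply: measurable_fun_ler => //; exact: measurable_cst.
have gN0 N x : 0 <= gN N x by rewrite /gN; case: ifP.
have gNg N x : gN N x <= g x by rewrite /gN; case: ifP.
have igN N : mu.-integrable setT (EFin \o gN N).
  apply: le_integrable ig => //; first exact/measurable_EFinP.
  by move=> x _ /=; rewrite lee_fin !ger0_norm.
have [|||||_ _] := @dominated_convergence _ T R mu setT measurableT
    (fun N => EFin \o gN N) (fun=> 0%E) (EFin \o g).
- by move=> N; exact/measurable_EFinP.
- exact: measurable_cst.
- apply/aeW => x _; apply: cvg_near_cst.
  exists (Num.bound `|phi x|) => // N /= bN.
  rewrite /gN ifT// (le_trans (ler_norm _))// (le_trans (ltW (archi_boundP _)))//.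
  by rewrite ler_nat.
- exact: ig.
- apply/aeW => x N _ /=; rewrite lee_fin ger0_norm//.
rewrite integral0 => /fine_cvgP[_] /cvgrPdist_le/(_ _ e0); apply: filterS => N.
rewrite /= sub0r normrN => H; split; first exact: igN.
exact: le_trans (ler_norm _) H.
Qed.

End tail.

(** * Pairing holomorphic functions with kernel powers *)

Section reproduction.
Variables (R : realType) (n : nat).
Notation leb := (@lebesgue_measure R).
Notation T := (measurableTypeR R).
Notation TT := (n.+1.-tuple (T * T)).
Notation lebC := (@lebesgue_Cn R n.+1).
Notation V := 'cV[R[i]]_n.+1.
Implicit Types (t : TT) (e : 'I_n.+1 -> nat) (p z : V).

Lemma integral_rott (u : 'I_n.+1 -> R[i]) (F : TT -> \bar R) :
  (forall j, nc (u j) = 1 /\ 1 + Re (u j) != 0) ->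
  measurable_fun setT F ->
  (\int[lebC]_t F (rott u t) = \int[lebC]_t F t)%E.
Proof.
move=> u1 mF; rewrite integralE [RHS]integralE; congr (_ - _)%E.
  rewrite -(ge0_integral_rott u1 (measurable_funepos mF) (funepos_ge0 F)).
  by apply: eq_integral => t _; rewrite !funeposE.
rewrite -(ge0_integral_rott u1 (measurable_funeneg mF) (funeneg_ge0 F)).
by apply: eq_integral => t _; rewrite !funenegE.
Qed.

Lemma cint_rott (u : 'I_n.+1 -> R[i]) (F : TT -> R[i]) :
  (forall j, nc (u j) = 1 /\ 1 + Re (u j) != 0) ->
  cmeasurable setT F ->
  cint lebC setT (fun t => F (rott u t)) = cint lebC setT F.
Proof.
move=> u1 [m1 m2]; rewrite /cint /Rintegral; congr Complex; congr fine.
  by apply: (@integral_rott u (fun t => (Re (F t))%:E)) => //; exact/measurable_EFinP.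
by apply: (@integral_rott u (fun t => (Im (F t))%:E)) => //; exact/measurable_EFinP.
Qed.

Lemma cmeasurable_cvec j : cmeasurable setT (fun t => cvec t j 0).
Proof.
have mt := measurable_tnth j : measurable_fun setT (fun t => tnth t j).
split.
  apply: (eq_measurable_fun (fun t => (tnth t j).1)); first by move=> t _ /=; rewrite mxE.
  exact: measurableT_comp measurable_fst mt.
apply: (eq_measurable_fun (fun t => (tnth t j).2)); first by move=> t _ /=; rewrite mxE.
exact: measurableT_comp measurable_snd mt.
Qed.

Lemma nc_cvec t j : nc (cvec t j 0) ^+ 2 = sqn (tnth t j).
Proof. by rewrite nc_sqr mxE. Qed.

Lemma sqnt_ge0 t : 0 <= sqnt t.
Proof. by apply: sumr_ge0 => j _; rewrite addr_ge0// sqr_ge0. Qed.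

Lemma cnorm2_cvec t : cnorm2 (cvec t) = sqnt t.
Proof.
rewrite /cnorm2 /cdot /sqnt.
under eq_bigr do rewrite mulr_conj nc_cvec.
by rewrite -rmorph_sum.
Qed.

Lemma nc_cvec_le t j (r : R) : 0 <= r -> sqnt t <= r ^+ 2 -> nc (cvec t j 0) <= r.
Proof.
move=> r0 tr; rewrite -(@ler_pXn2r _ 2)// ?nnegrE ?nc_ge0//.
rewrite (le_trans _ tr)// nc_cvec /sqnt (bigD1 j)//= lerDl.
by apply: sumr_ge0 => i _; rewrite addr_ge0// sqr_ge0.
Qed.

Lemma cmeasurable_mono e : cmeasurable setT (fun t => mono e (cvec t)).
Proof.
by apply: cmeasurable_prod => // j; apply: cmeasurableX => //; exact: cmeasurable_cvec.
Qed.

Lemma cmeasurable_polyfun s : cmeasurable setT (fun t => polyfun s (cvec t)).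
Proof.
apply: cmeasurable_sum => // q; apply: cmeasurableM => //; first exact: cmeasurable_cst.
exact: cmeasurable_mono.
Qed.

Lemma cmeasurable_kernel p k : cmeasurable setT (fun t => cdot (cvec t) p ^+ k).
Proof.
apply: cmeasurableX => //; apply: cmeasurable_sum => // j.
by apply: cmeasurableM => //; [exact: cmeasurable_cvec|exact: cmeasurable_cst].
Qed.

(** The N-th polynomial is within 1/(N+1) of [f] on the polydisc of radius N+1. These polydiscs
    exhaust the space, so the polynomials converge to [f] at every point. *)
Lemma cmeasurable_holomorphic (f : V -> R[i]) : holomorphic f ->
  cmeasurable setT (fun t => f (cvec t)).
Proof.
move=> hf.
have /choice[s sP] : forall N : nat, exists s, forall z, polydisc N.+1%:R z ->
    nc (f z - polyfun s z) <= N.+1%:R^-1.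
  by move=> N; apply: (holomorphic_poly_approx (r := N.+1%:R)) => //; rewrite invr_gt0.
have H t (e : R) : 0 < e -> \forall N \near \oo,
    nc (f (cvec t) - polyfun (s N) (cvec t)) <= e.
  move=> e0; near=> N; rewrite (le_trans (sP N _ _))//.
    move=> j; apply: nc_cvec_le => //.
    apply: (@le_trans _ _ N.+1%:R).
      by rewrite -natr1 ler_wpDr//; near: N; exact: nbhs_infty_ger.
    by rewrite expr2 ler_peMl// ler1n.
  by apply: ltW; near: N; exact: (near_infty_natSinv_lt (PosNum e0)).
split.
  apply: (@measurable_fun_cvg _ _ _ _ (fun N t => Re (polyfun (s N) (cvec t)))).
    by move=> N; have [] := cmeasurable_polyfun (s N).
  move=> t _; apply/cvgrPdist_le => e e0; apply: filterS (H t e e0) => N.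
  by apply: le_trans; rewrite -cReN -cReD Re_le_nc.
apply: (@measurable_fun_cvg _ _ _ _ (fun N t => Im (polyfun (s N) (cvec t)))).
  by move=> N; have [] := cmeasurable_polyfun (s N).
move=> t _; apply/cvgrPdist_le => e e0; apply: filterS (H t e e0) => N.
by apply: le_trans; rewrite -cImN -cImD Im_le_nc.
Unshelve. all: by end_near. Qed.

Lemma fcoef_sum I (s : seq I) (b : I -> R[i]) (d : I -> nat) k :
  fcoef (fun t : R => \sum_(c <- s) b c * cis t ^+ d c) k =
  \sum_(c <- s) b c * (d c == k)%:R.
Proof.
have ic c : cintegrable leb `[0, 1] (fun t : R => cis t ^+ d c * ((cis t)^* ^+ k)%R).
  by apply/pcont_cintegrable/pcont_fcoef/pcontX/pcont_cis.
transitivity (cmean (fun t : R => \sum_(c <- s) b c * (cis t ^+ d c * ((cis t)^* ^+ k)%R))).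
  apply: eq_cint => t _; rewrite mulr_suml; apply: eq_bigr => c _.
  by rewrite mulrA.
rewrite /cmean cint_sum//; last by move=> c; apply: cintegrableZ.
apply: eq_bigr => c _; rewrite cintZ//; congr (_ * _); exact: fcoef_cisX.
Qed.

Lemma pcont_polyfun s p : pcont (fun t : R => polyfun s (cis t *: p)).
Proof.
rewrite /polyfun; elim: s => [|c s IH].
  by under eq_fun do rewrite big_nil; exact: pcont_cst.
under eq_fun do rewrite big_cons; apply: pcontD => //.
apply: pcontM; first exact: pcont_cst.
rewrite /mono; elim: (index_enum _) => [|j js IHj].
  by under eq_fun do rewrite big_nil; exact: pcont_cst.
under eq_fun do rewrite big_cons mxE.
by apply: pcontM => //; apply/pcontX/pcontM; [exact: pcont_cis|exact: pcont_cst].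
Qed.

Section weight.
Variable h : R -> R.
Hypothesis mh : measurable_fun setT h.
Hypothesis h0 : forall s, 0 <= h s.
Hypothesis hfin : forall k, (hmoment k (EFin \o h) < +oo)%E.

Let H t := h (sqnt t).

Let mH : measurable_fun setT H.
Proof. exact: measurableT_comp mh (@measurable_sqnt R n.+1). Qed.

Let mh' : measurable_fun setT (EFin \o h). Proof. exact/measurable_EFinP. Qed.
Let h0' s : (0 <= (EFin \o h) s)%E. Proof. by rewrite lee_fin. Qed.

Let integrable_sqmono e :
  lebC.-integrable setT (EFin \o (fun t => sqmono e t * H t)).
Proof.
apply/integrableP; split.
  apply/measurable_EFinP; apply: measurable_funM => //; exact: measurable_sqmono.
under eq_integral => t _.
  rewrite /= ger0_norm; last by rewrite mulr_ge0 ?sqmono_ge0 ?h0.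
  rewrite EFinM; over.
rewrite (ge0_integral_sqmono e mh' h0') lte_mul_pinfty ?lee_fin ?divr_ge0//.
by rewrite mulr_ge0// exprn_ge0// pi_ge0.
Qed.

Let mm e e' t := mono e (cvec t) * ((mono e' (cvec t))^*)%R * (H t)%:C%C.

Let nc_mono e t : nc (mono e (cvec t)) ^+ 2 = sqmono e t.
Proof.
rewrite /mono nc_prod -prodrXl; apply: eq_bigr => j _.
by rewrite ncX -exprM mulnC exprM nc_cvec.
Qed.

Let cintegrable_mm e e' : cintegrable lebC setT (mm e e').
Proof.
have ig := integrableD measurableT (integrable_sqmono e) (integrable_sqmono e').
apply: (cintegrable_dom measurableT _ ig) => //.
  apply: cmeasurableM => //; last exact: cmeasurable_real.
  apply: cmeasurableM => //; first exact: cmeasurable_mono.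
  by apply: cmeasurable_conj => //; exact: cmeasurable_mono.
move=> t _; rewrite /mm !ncM nc_conj ncC ger0_norm ?h0// -mulrDl ler_wpM2r ?h0//.
rewrite -!nc_mono; move: (nc _) (nc _) (nc_ge0 (mono e (cvec t))) (nc_ge0 (mono e' (cvec t))) => a b a0 b0.
have := sqr_ge0 (a - b); rewrite !expr2; nra.
Qed.

Let cint_mm_diag e : cint lebC setT (mm e e) =
  (pi ^+ n.+1 * (\prod_j (e j)`!)%:R / (\sum_j e j + n)`!%:R *
   fine (hmoment (\sum_j e j + n) (EFin \o h)))%:C%C.
Proof.
transitivity (cint lebC setT (fun t => (sqmono e t * H t)%:C%C)).
  by apply: eq_cint => t _; rewrite /mm mulr_conj nc_mono -rmorphM.
rewrite cint_real// /Rintegral; congr (_%:C)%C.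
under eq_integral do rewrite EFinM.
rewrite (ge0_integral_sqmono e mh' h0') fineM// ge0_fin_numE//.
exact: hmoment_ge0.
Qed.

(** Rotating coordinate [j] preserves the integral and multiplies the integrand by a constant, so
    the integral vanishes once this constant is not 1. The angle 2 pi / (4 m), with [m] the gap
    between the two exponents, makes it i or -i, and stays within a quarter turn, so that
    [1 + Re om] is nonzero as rotation invariance requires. *)
Let cint_mm_off e e' : (exists j, e j != e' j) -> cint lebC setT (mm e e') = 0.
Proof.
move=> [j ee'].
pose m := maxn (e j - e' j) (e' j - e j).
have m0 : (0 < m)%N by rewrite /m; lia.
pose om : R[i] := cis (4 * m%:R)^-1.
have omm : om ^+ m = cis (4^-1).
  rewrite /om -cisMn invfM mulrCA divff ?mulr1// pnatr_eq0 -lt0n//.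
have om4 : cis (4^-1) != 1 :> R[i].
  by apply: cis_neq1; rewrite invr_gt0 ltr0n invf_lt1// ltr1n.
have omR : 1 + Re om != 0.
  rewrite gt_eqF// ltr_pwDl//= cos_ge0_pihalf//.
  have p0 := pi_gt0 R; have m1 : 1 <= m%:R :> R by rewrite ler1n.
  have x0 : 0 <= 2 * pi * (4 * m%:R)^-1 :> R.
    by rewrite !mulr_ge0 ?invr_ge0 ?mulr_ge0// ltW.
  apply/andP; split; first by rewrite (le_trans _ x0)// oppr_le0 divr_ge0// ltW.
  rewrite ler_pdivrMr ?mulr_gt0 ?ltr0n//.
  rewrite (_ : pi / 2 * (4 * m%:R) = 2 * pi * m%:R); last by field.
  by rewrite ler_peMr// mulr_ge0// ltW.
pose u i : R[i] := if i == j then om else 1.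
have u1 i : nc (u i) = 1 /\ 1 + Re (u i) != 0.
  rewrite /u; case: eqP => _; first by split => //; exact: nc_cis.
  by split; [exact: nc1|rewrite /= gt_eqF].
have [mmm1 mmm2] := cintegrable_measurable (cintegrable_mm e e').
have mono_rott e1 t : mono e1 (cvec (rott u t)) = om ^+ e1 j * mono e1 (cvec t).
  rewrite /mono; under eq_bigr do rewrite cvec_rott exprMn.
  rewrite big_split /=; congr (_ * _); rewrite (bigD1 j)//= /u eqxx big1 ?mulr1//.
  by move=> i /negbTE ->; rewrite expr1n.
have mm_rott t : mm e e' (rott u t) = om ^+ e j * ((om^*)%R ^+ e' j) * mm e e' t.
  rewrite /mm /H sqnt_rott ?mono_rott; last by move=> i; have [] := u1 i.
  by rewrite rmorphM/= rmorphXn/=; ring.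
have om1 : om * (om^*)%R = 1 by exact: cis_conj.
have neq1 : om ^+ e j * ((om^*)%R ^+ e' j) != 1.
  have [ltee|gtee|eee] := ltngtP (e j) (e' j); last by rewrite eee eqxx in ee'.
    rewrite -(subnK (ltnW ltee)) [X in _ * X]exprD mulrCA -exprMn om1 expr1n mulr1.
    rewrite -rmorphXn/= (_ : (e' j - e j)%N = m); last by rewrite /m; lia.
    by rewrite omm; apply: contra om4 => /eqP/(congr1 (@Num.conj _)); rewrite conjCK rmorph1 => ->.
  rewrite -(subnK (ltnW gtee)) exprD -mulrA -exprMn om1 expr1n mulr1.
  by rewrite (_ : (e j - e' j)%N = m) ?omm//; rewrite /m; lia.
have := cint_rott u1 (cintegrable_measurable (cintegrable_mm e e')).
under [X in cint _ _ X]eq_fun do rewrite mm_rott.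
rewrite (cintZ measurableT _ (cintegrable_mm e e')) => /eqP; rewrite -subr_eq0 -[X in _ - X]mul1r -mulrBl mulf_eq0.
by rewrite subr_eq0 (negbTE neq1) => /eqP.
Qed.

Let expansion p k (t : TT) : ((cdot (cvec t) p ^+ k)^* )%R =
  \sum_(e : {ffun 'I_n.+1 -> 'I_k.+1} | (\sum_j e j)%N == k)
    (k`!%:R / (\prod_j (e j)`!)%:R * mono (fun j => e j) p) *
    ((mono (fun j => e j) (cvec t))^*)%R.
Proof.
rewrite rmorphXn /cdot rmorph_sum/=.
under eq_bigr do rewrite rmorphM/= conjCK mulrC.
rewrite (multinomial _ (leqnn k)); apply: eq_bigr => e _.
rewrite -[RHS]mulrA; congr (_ * _); rewrite /mono rmorph_prod/= -big_split/=.
by apply: eq_bigr => j _; rewrite exprMn rmorphXn.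
Qed.

Let mono_kernelE e p k : (fun t : TT =>
    mono e (cvec t) * ((cdot (cvec t) p ^+ k)^* )%R * (H t)%:C%C) =
  (fun t => \sum_(e' <- [seq e' : {ffun 'I_n.+1 -> 'I_k.+1} <- index_enum _ |
       (\sum_j e' j)%N == k])
    (k`!%:R / (\prod_j (e' j)`!)%:R * mono (fun j => e' j) p) *
    mm e (fun j => e' j) t).
Proof.
apply/funext => t; rewrite big_filter expansion mulr_sumr mulr_suml.
by apply: eq_bigr => e' _; rewrite /mm; ring.
Qed.

Lemma cintegrable_mono_kernel e p k : cintegrable lebC setT
  (fun t => mono e (cvec t) * ((cdot (cvec t) p ^+ k)^* )%R * (h (sqnt t))%:C%C).
Proof.
rewrite mono_kernelE; apply: (cintegrable_sum measurableT) => e'.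
exact: (cintegrableZ measurableT).
Qed.

Definition hconst k : R := pi ^+ n.+1 * (k`!%:R / (k + n)`!%:R *
  fine (hmoment (k + n) (EFin \o h))).

(** In the multinomial expansion of the kernel power only the exponent [e] survives orthogonality.
    Its coefficient k! / prod e_j! cancels the prod e_j! of Dirichlet's integral, so what remains
    depends on the degree alone; this is why [hconst] is the same for all monomials of degree
    [k]. *)
Lemma cint_mono_kernel e p k : cint lebC setT
    (fun t => mono e (cvec t) * ((cdot (cvec t) p ^+ k)^* )%R * (h (sqnt t))%:C%C) =
  (hconst k)%:C%C * (mono e p * ((\sum_j e j)%N == k)%:R).
Proof.
rewrite mono_kernelE (cint_sum measurableT); last first.
  by move=> e'; exact: (cintegrableZ measurableT).
rewrite big_filter.
under eq_bigr do rewrite (cintZ measurableT _ (cintegrable_mm _ _)).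
case: eqVneq => [ek|ek]; last first.
  rewrite !mulr0; apply: big1 => e' /eqP e'k; rewrite cint_mm_off ?mulr0//.
  apply/existsP; apply: contraNT ek => /existsPn ee'; rewrite -e'k.
  by apply/eqP; apply: eq_bigr => j _; have := ee' j; rewrite negbK => /eqP.
(* An exponent of total degree [k] has all entries at most [k], so [e] does occur among the bounded
   exponents of the expansion. *)
have ej j : (e j < k.+1)%N by rewrite ltnS -ek (bigD1 j)//= leq_addr.
pose e0 : {ffun 'I_n.+1 -> 'I_k.+1} := [ffun j => inord (e j)].
have e0E : (fun j => e0 j : nat) = e.
  by apply/funext => j; rewrite ffunE inordK.
rewrite (bigD1 e0)/=; last by rewrite -[X in _ == X]ek -[in X in _ == X]e0E.
rewrite [X in _ + X]big1 ?addr0 => [|e' /andP[_ e'0]]; last first.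
  rewrite cint_mm_off ?mulr0//; apply/existsP; apply: contraNT e'0 => /existsPn ee'.
  apply/eqP/ffunP => j; apply/val_inj; have := ee' j; rewrite negbK => /eqP /= <-.
  by rewrite ffunE inordK.
rewrite mulr1 e0E (_ : (\prod_j (e0 j)`! = \prod_j (e j)`!)%N); last first.
  by apply: eq_bigr => j _; rewrite ffunE inordK.
rewrite cint_mm_diag ek /hconst.
have p0 : (\prod_j (e j)`!)%:R != 0 :> R[i].
  by rewrite pnatr_eq0 -lt0n; apply/prodn_gt0 => j; exact: fact_gt0.
have p1 : (k + n)`!%:R != 0 :> R[i] by rewrite pnatr_eq0 -lt0n fact_gt0.
rewrite !rmorphM/= !fmorphV/= !rmorph_nat.
move: (mono e p) (\prod_j _)%:R p0 (_`!%:R) p1 => a b b0 c c0.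
by field; rewrite b0 c0.
Qed.

Lemma integrable_kernel_sqr p k : lebC.-integrable setT
  (EFin \o (fun t => nc (cdot (cvec t) p ^+ k) ^+ 2 * h (sqnt t))).
Proof.
have : cintegrable lebC setT (fun t => cdot (cvec t) p ^+ k *
    ((cdot (cvec t) p ^+ k)^* )%R * (h (sqnt t))%:C%C).
  rewrite (_ : (fun t => _) = (fun t => \sum_(e <- [seq e : {ffun 'I_n.+1 -> 'I_k.+1} <-
      index_enum _ | (\sum_j e j)%N == k])
      ((k`!%:R / (\prod_j (e j)`!)%:R * mono (fun j => e j) p)^* )%R *
      (mono (fun j => e j) (cvec t) * ((cdot (cvec t) p ^+ k)^* )%R *
      (h (sqnt t))%:C%C))).
    apply: (cintegrable_sum measurableT) => e; apply: (cintegrableZ measurableT).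
    exact: cintegrable_mono_kernel.
  apply/funext => t; rewrite big_filter -[X in X * _ * _]conjCK expansion.
  rewrite [X in X * _ * _]rmorph_sum !mulr_suml; apply: eq_bigr => e _.
  by rewrite [in LHS]rmorphM/= conjCK -!mulrA.
move=> [+ _]; apply: eq_integrable => // t _ /=.
by rewrite mulr_conj -rmorphM.
Qed.

Lemma integrable_weight : lebC.-integrable setT (EFin \o (fun t => h (sqnt t))).
Proof.
apply: eq_integrable (integrable_sqmono (fun=> 0%N)) => // t _ /=.
by rewrite /sqmono big1 ?mul1r// => j _; rewrite expr0.
Qed.

Lemma cint_polyfun_kernel s p k : cint lebC setT
    (fun t => polyfun s (cvec t) * ((cdot (cvec t) p ^+ k)^* )%R * (h (sqnt t))%:C%C) =
  (hconst k)%:C%C * fcoef (fun t : R => polyfun s (cis t *: p)) k.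
Proof.
transitivity (cint lebC setT (fun t => \sum_(c <- s) c.1 * (mono c.2 (cvec t) *
    ((cdot (cvec t) p ^+ k)^* )%R * (h (sqnt t))%:C%C))).
  apply: eq_cint => t _; rewrite /polyfun !mulr_suml; apply: eq_bigr => c _.
  by rewrite -!mulrA.
rewrite (cint_sum measurableT); last first.
  by move=> c; apply: (cintegrableZ measurableT); exact: cintegrable_mono_kernel.
rewrite (_ : (fun t : R => _) =
    (fun t : R => \sum_(c <- s) (c.1 * mono c.2 p) * cis t ^+ (\sum_j c.2 j))); last first.
  apply/funext => t; apply: eq_bigr => c _; rewrite -mulrA; congr (_ * _).
  rewrite mulrC -prodrXr /mono -big_split/=; apply: eq_bigr => j _.
  by rewrite mxE exprMn.
rewrite fcoef_sum mulr_sumr; apply: eq_bigr => c _.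
rewrite (cintZ measurableT _ (cintegrable_mono_kernel _ _ _)) cint_mono_kernel.
by rewrite mulrCA !mulrA.
Qed.

(** The bound |f q| <= |f|^2 + |q|^2 takes the place of the Cauchy-Schwarz inequality, and gives a
    dominating function that also serves for the truncated weights. *)
Lemma holomorphic_kernel_dom (f : V -> R[i]) p k : holomorphic f ->
  lebC.-integrable setT (EFin \o (fun t => nc (f (cvec t)) ^+ 2 * h (sqnt t))) ->
  [/\ cmeasurable setT (fun t => f (cvec t) * ((cdot (cvec t) p ^+ k)^* )%R * (h (sqnt t))%:C%C),
    lebC.-integrable setT (EFin \o (fun t => (nc (f (cvec t)) ^+ 2 +
      nc (cdot (cvec t) p ^+ k) ^+ 2) * h (sqnt t))) &
    forall t, nc (f (cvec t) * ((cdot (cvec t) p ^+ k)^* )%R * (h (sqnt t))%:C%C) <=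
     (nc (f (cvec t)) ^+ 2 + nc (cdot (cvec t) p ^+ k) ^+ 2) * h (sqnt t)].
Proof.
move=> hf If; split.
- apply: cmeasurableM => //; last exact: cmeasurable_real.
  apply: cmeasurableM => //; first exact: cmeasurable_holomorphic.
  by apply: cmeasurable_conj => //; exact: cmeasurable_kernel.
- apply: eq_integrable (integrableD measurableT If (integrable_kernel_sqr p k)) => // t _.
  by rewrite /= mulrDl.
move=> t; rewrite !ncM nc_conj ncC ger0_norm ?h0// ler_wpM2r ?h0//.
move: (nc _) (nc _) (nc_ge0 (f (cvec t))) (nc_ge0 (cdot (cvec t) p ^+ k)) => a b a0 b0.
by have := sqr_ge0 (a - b); rewrite !expr2; nra.
Qed.

Lemma reproduction_bounded (f : V -> R[i]) p k (rho : R) : holomorphic f ->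
  0 < rho -> (forall s, rho ^+ 2 < s -> h s = 0) ->
  cint lebC setT
    (fun t => f (cvec t) * ((cdot (cvec t) p ^+ k)^* )%R * (h (sqnt t))%:C%C) =
  (hconst k)%:C%C * fcoef (fun t : R => f (cis t *: p)) k.
Proof.
move=> hf rho0 hrho.
(* The polydisc of radius [r] contains both the points where the weight is nonzero and the circle of
   the [cis t *: p], so one polynomial approximation serves both sides. *)
pose r := rho + \sum_j nc (p j 0).
have sp0 : 0 <= \sum_j nc (p j 0) by apply: sumr_ge0 => j _; exact: nc_ge0.
have r0 : 0 < r by rewrite ltr_pwDl.
pose B := 2 * \int[lebC]_t ((1 + nc (cdot (cvec t) p ^+ k) ^+ 2) * h (sqnt t)).
have B0 : 0 <= B.
  rewrite mulr_ge0// Rintegral_ge0// => t _.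
  by rewrite mulr_ge0 ?h0// addr_ge0// sqr_ge0.
have [M M0 fM] := holomorphic_bounded r hf.
have qle (t : TT) : nc (cdot (cvec t) p ^+ k) <= 1 + nc (cdot (cvec t) p ^+ k) ^+ 2.
  by move: (nc _) => a; have := sqr_ge0 (a - 1); rewrite !expr2; have := sqr_ge0 a; rewrite expr2; nra.
have IB : lebC.-integrable setT
    (EFin \o (fun t => (1 + nc (cdot (cvec t) p ^+ k) ^+ 2) * h (sqnt t))).
  apply: eq_integrable (integrableD measurableT integrable_weight (integrable_kernel_sqr p k)) => // t _.
  by rewrite /= mulrDl mul1r.
have ball t : h (sqnt t) != 0 -> polydisc r (cvec t).
  move=> ht j; apply: (@le_trans _ _ rho); last by rewrite /r lerDl.
  apply: nc_cvec_le; first exact: ltW.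
  by rewrite leNgt; apply: contra ht => /hrho ->.
have dom (g : V -> R[i]) (e : R) : cmeasurable setT (fun t => g (cvec t)) -> 0 <= e ->
    (forall z, polydisc r z -> nc (g z) <= e) ->
    cintegrable lebC setT (fun t => g (cvec t) * ((cdot (cvec t) p ^+ k)^* )%R * (h (sqnt t))%:C%C) /\
    nc (cint lebC setT (fun t => g (cvec t) * ((cdot (cvec t) p ^+ k)^* )%R * (h (sqnt t))%:C%C)) <= e * B.
  move=> mg e0 ge.
  have m1 : cmeasurable setT (fun t => g (cvec t) * ((cdot (cvec t) p ^+ k)^* )%R * (h (sqnt t))%:C%C).
    apply: cmeasurableM => //; last exact: cmeasurable_real.
    apply: cmeasurableM => //.
    by apply: cmeasurable_conj => //; exact: cmeasurable_kernel.
  have i1 := integrableZl measurableT e IB.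
  have d1 t : setT t -> nc (g (cvec t) * ((cdot (cvec t) p ^+ k)^* )%R * (h (sqnt t))%:C%C) <=
      e * ((1 + nc (cdot (cvec t) p ^+ k) ^+ 2) * h (sqnt t)).
    move=> _; rewrite !ncM nc_conj ncC ger0_norm ?h0//.
    have [->|ht] := eqVneq (h (sqnt t)) 0; first by rewrite !mulr0.
    rewrite mulrA ler_wpM2r ?h0// ler_pM ?nc_ge0//.
    exact: ge (ball _ ht).
  split; first exact: (cintegrable_dom measurableT m1 i1 d1).
  apply: (le_trans (nc_cint_le measurableT m1 i1 d1)).
  by rewrite (RintegralZl _ measurableT IB) mulrCA.
have pf (g : V -> R[i]) : holomorphic g -> pcont (fun t : R => g (cis t *: p)).
  move=> hg; have := ccont_path (cdiff_ccont (holomorphic_slice 0 p hg)) (@pcont_cis R).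
  by under eq_fun do rewrite add0r.
have [I1 _] := dom f M (cmeasurable_holomorphic hf) M0 fM.
apply/eqP; rewrite -subr_eq0 -nc_eq0 -normr_le0 (ger0_norm (nc_ge0 _)).
apply/ler_addgt0Pl => e e0; rewrite addr0.
(* [B] accounts for the error in the integral, the second term for that in the Fourier coefficient;
   adding 1 makes [K] positive. *)
pose K := B + nc (hconst k)%:C%C * 2 + 1.
have K0 : 0 < K by rewrite ltr_wpDl// addr_ge0// mulr_ge0 ?nc_ge0.
have eK : 0 < e / K by rewrite divr_gt0.
have [s sP] := holomorphic_poly_approx r0 hf eK.
have [|I2 J2] := dom (fun z => f z - polyfun s z) (e / K) _ (ltW eK) sP.
  have -> : (fun t => f (cvec t) - polyfun s (cvec t)) =
      (fun t => f (cvec t) + (fun=> -1) t * polyfun s (cvec t)).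
    by apply/funext => t; rewrite mulN1r.
  apply: cmeasurableD => //; first exact: cmeasurable_holomorphic.
  by apply: cmeasurableM => //; [exact: cmeasurable_cst|exact: cmeasurable_polyfun].
have I3 : cintegrable lebC setT (fun t => polyfun s (cvec t) *
    ((cdot (cvec t) p ^+ k)^* )%R * (h (sqnt t))%:C%C).
  have := cintegrableD measurableT I1 (cintegrableZ measurableT (-1) I2).
  by congr (cintegrable _ _ _); apply/funext => t; ring.
set c1 := cint _ _ _; set c2 := fcoef _ _.
set c3 := cint _ _ _ in J2.
have c3E : c3 = c1 - (hconst k)%:C%C * fcoef (fun t : R => polyfun s (cis t *: p)) k.
  rewrite -cint_polyfun_kernel /c1 -(cintB measurableT I1 I3).
  by apply: eq_cint => t _; ring.
have pp : pcont (fun t : R => polyfun s (cis t *: p)) by exact: pcont_polyfun.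
have pB : pcont (fun t : R => f (cis t *: p) - polyfun s (cis t *: p)).
  have := pcontD (pf f hf) (pcontM (pcont_cst (-1)) pp).
  by under eq_fun do rewrite mulN1r.
have := nc_fcoef_le k pB.
move=> /(_ (e / K)); rewrite (fcoefB k (pf f hf) pp) -/c2 => J3.
rewrite (_ : c1 - _ = c3 - (hconst k)%:C%C * (c2 - fcoef (fun t : R => polyfun s (cis t *: p)) k)); last first.
  by rewrite c3E; ring.
rewrite (le_trans (ncD _ _))// ncN ncM.
apply: (@le_trans _ _ (e / K * B + nc (hconst k)%:C%C * (2 * (e / K)))).
  rewrite lerD// ler_wpM2l ?nc_ge0// J3// => t; apply: sP => j.
  rewrite mxE ncM nc_cis mul1r /r (bigD1 j)//= addrCA lerDl addr_ge0 ?(ltW rho0)//.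
  by apply: sumr_ge0 => i _; exact: nc_ge0.
rewrite (_ : _ + _ = e * ((B + nc (hconst k)%:C%C * 2) / K)); last by ring.
by rewrite ler_piMr ?ltW// ltr_pdivrMr// mul1r /K ltrDl.
Qed.

End weight.

Lemma holomorphic_reproduction (h : R -> R) (f : V -> R[i]) p k :
  measurable_fun setT h -> (forall s, 0 <= h s) ->
  (forall k, (hmoment k (EFin \o h) < +oo)%E) -> holomorphic f ->
  lebC.-integrable setT (EFin \o (fun t => nc (f (cvec t)) ^+ 2 * h (sqnt t))) ->
  cint lebC setT
    (fun t => f (cvec t) * ((cdot (cvec t) p ^+ k)^* )%R * (h (sqnt t))%:C%C) =
  (hconst h k)%:C%C * fcoef (fun t : R => f (cis t *: p)) k.
Proof.
move=> mh h0 hfin hf If.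
have [m1 ig fg] := holomorphic_kernel_dom mh h0 hfin p k hf If.
set g := (fun t => _ * _ : R) in ig.
have g0 t : 0 <= g t by rewrite mulr_ge0 ?addr_ge0 ?sqr_ge0.
pose hN (N : nat) s : R := if s <= N%:R then h s else 0.
pose hT (N : nat) s : R := if s <= N%:R then 0 else h s.
have mhN N : measurable_fun setT (hN N : T -> T).
  by apply: measurable_fun_ifT => //; apply: measurable_fun_ler => //; exact: measurable_cst.
have hN0 N s : 0 <= hN N s by rewrite /hN; case: ifP.
have hNh N s : hN N s <= h s by rewrite /hN; case: ifP.
have hNT N s : h s = hN N s + hT N s.
  by rewrite /hN /hT; case: ifP; rewrite ?addr0 ?add0r.
have mhp (u : T -> T) j : measurable_fun setT u ->
    measurable_fun setT (fun s : T => (hpow j s)%:E * (EFin \o u) s)%E.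
  move=> mu; apply: emeasurable_funM; last exact/measurable_EFinP.
  by apply/measurable_EFinP; exact: measurable_hpow.
have hNfin N j : (hmoment j (EFin \o hN N) < +oo)%E.
  apply: le_lt_trans (hfin j); apply: ge0_le_integral => //.
  - by move=> s _; rewrite mule_ge0// lee_fin ?hpow_ge0.
  - exact: mhp.
  - exact: mhp.
  - by move=> s _; rewrite lee_wpmul2l// lee_fin ?hpow_ge0.
have ihp : leb.-integrable setT (EFin \o (fun s : T => hpow (k + n) s * h s)).
  apply/integrableP; split; first exact: mhp.
  apply: le_lt_trans (hfin (k + n)%N); rewrite le_eqVlt; apply/orP; left; apply/eqP.
  by apply: eq_integral => s _ /=; rewrite ger0_norm// mulr_ge0// hpow_ge0.
have [I1 _] := (cintegrable_dom measurableT m1 ig (fun t _ => fg t), tt).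
apply/eqP; rewrite -subr_eq0 -nc_eq0 -normr_le0 (ger0_norm (nc_ge0 _)).
apply/ler_addgt0Pl => e e0; rewrite addr0.
set c1 := cint _ _ _; set c2 := fcoef _ _.
pose a : R := pi ^+ n.+1 * (k`!%:R / (k + n)`!%:R).
have a0 : 0 <= a by rewrite mulr_ge0 ?divr_ge0// exprn_ge0// pi_ge0.
pose K := 2 + a * nc c2.
have K0 : 0 < K by rewrite ltr_pwDl// mulr_ge0 ?nc_ge0.
have eK : 0 < e / K by rewrite divr_gt0.
(* One cut [N] makes both tails small: that of the dominating function on C^n for the left side,
   that of the radial moment inside [hconst] for the right side. *)
have T1 := integral_tail_small ig g0 (@measurable_sqnt R n.+1) eK.
have T2 := integral_tail_small ihp (fun s => mulr_ge0 (hpow_ge0 _ s) (h0 s))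
  (@measurable_id _ T setT) eK.
have [N _ /(_ N (leqnn N))[[J1 K1] [J2 K2]]] := filterI T1 T2.
(* The radius is N+1: it is positive even for N = 0, and N <= (N+1)^2 places the truncated weight
   within it. *)
have N0 : (0 : R) < N.+1%:R by [].
have := reproduction_bounded (mhN N) (hN0 N) (hNfin N) p k hf N0.
set c3 := cint _ _ _ => c3E.
have {}c3E : c3 = (hconst (hN N) k)%:C%C * c2.
  apply: c3E => s sN; rewrite /hN leNgt ifF//; apply/negbTE; rewrite negbK.
  apply: le_lt_trans sN; apply: (@le_trans _ _ N.+1%:R); first by rewrite ler_nat.
  by rewrite expr2 ler_peMl// ler1n.
have hE : hconst h k = hconst (hN N) k +
    a * \int[leb]_s (if s <= N%:R then 0 else hpow (k + n) s * h s).
  rewrite /hconst !(mulrA (pi ^+ n.+1) (_ / _)) -/a -mulrDr; congr (_ * _).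
  rewrite -[LHS]/(\int[leb]_(s in setT) (hpow (k + n) s * h s)).
  rewrite -[X in X + _]/(\int[leb]_(s in setT) (hpow (k + n) s * hN N s)).
  rewrite -RintegralD//.
    by apply: eq_Rintegral => s _; rewrite /hN; case: ifP; rewrite ?addr0 ?mulr0 ?add0r.
  apply: le_integrable ihp => //; first exact: mhp.
  by move=> s _ /=; rewrite lee_fin !ger0_norm ?mulr_ge0 ?hpow_ge0// ler_wpM2l ?hpow_ge0.
have c1E : c1 = c3 + cint lebC setT (fun t => f (cvec t) * ((cdot (cvec t) p ^+ k)^* )%R *
    (hT N (sqnt t))%:C%C).
  have split_c u : (measurable_fun setT (u : T -> T)) -> (forall s, 0 <= u s <= h s) ->
      cintegrable lebC setT (fun t => f (cvec t) * ((cdot (cvec t) p ^+ k)^* )%R *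
        (u (sqnt t))%:C%C).
    move=> mu uh; apply: (cintegrable_dom measurableT _ ig) => [|t _].
      apply: cmeasurableM => //; last first.
        apply: cmeasurable_real => //.
        exact: measurableT_comp mu (@measurable_sqnt R n.+1).
      apply: cmeasurableM => //; first exact: cmeasurable_holomorphic.
      by apply: cmeasurable_conj => //; exact: cmeasurable_kernel.
    apply: le_trans (fg t); rewrite ncM [leRHS]ncM ler_wpM2l ?nc_ge0// !ncC.
    by have /andP[u0 ?] := uh (sqnt t); rewrite !ger0_norm.
  rewrite -(cintD measurableT).
  - by apply: eq_cint => t _; rewrite -mulrDr -rmorphD -hNT.
  - by apply: split_c => // s; rewrite hN0 hNh.
  - apply: split_c => [|s]; last by rewrite /hT; case: ifP; rewrite ?h0 ?lexx.
    by apply: measurable_fun_ifT => //; apply: measurable_fun_ler => //; exact: measurable_cst.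
set c4 := cint _ _ _ in c1E.
have c4e : nc c4 <= 2 * (e / K).
  apply: (le_trans (nc_cint_le measurableT _ J1 _)); last by rewrite ler_wpM2l.
    apply: cmeasurableM => //; last first.
      apply: cmeasurable_real => //; apply: measurableT_comp (@measurable_sqnt R n.+1).
      by apply: measurable_fun_ifT => //; apply: measurable_fun_ler => //; exact: measurable_cst.
    apply: cmeasurableM => //; first exact: cmeasurable_holomorphic.
    by apply: cmeasurable_conj => //; exact: cmeasurable_kernel.
  move=> t _; rewrite /hT; case: ifP => _; last exact: fg.
  by rewrite mulr0 nc0.
rewrite c1E c3E hE; set tau := Rintegral _ _ _ in hE K2 *.
rewrite (_ : _ - _ = c4 - (a * tau)%:C%C * c2); last first.
  by rewrite [in LHS]rmorphD/=; ring.
have tau0 : 0 <= tau.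
  by apply: Rintegral_ge0 => s _; case: ifP => // _; rewrite mulr_ge0 ?hpow_ge0.
rewrite (le_trans (ncD _ _))// ncN ncM ncC (ger0_norm (mulr_ge0 a0 tau0)).
apply: (@le_trans _ _ (2 * (e / K) + a * (e / K) * nc c2)).
  by rewrite lerD// ler_wpM2r ?nc_ge0// ler_wpM2l.
rewrite (_ : _ + _ = K * (e / K)); last by rewrite /K; ring.
by rewrite mulrCA divff ?mulr1// gt_eqF.
Qed.

End reproduction.

(** * The weight on the half-line *)

Section halfline.
Variable R : realType.
Implicit Types f psi : R -> R.

(** A convergent difference quotient is bounded near [y], which gives a Lipschitz estimate at [y],
    one-sided at 0. *)
Lemma hl_derivable_continuous f y (e : R) : hl_derivable f -> 0 <= y -> 0 < e ->
  exists2 dl : R, 0 < dl & forall x, 0 <= x -> `|x - y| < dl -> `|f x - f y| <= e.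
Proof.
move=> df y0 e0; have := df _ y0; rewrite cvg_ex => -[l].
move=> /cvgrPdist_lt/(_ _ ltr01); rewrite /hl_filter /within/= => -[d /= d0 H].
pose K := `|l| + 1; have K0 : 0 < K by rewrite ltr_wpDl.
exists (Num.min d (e / K)); first by rewrite lt_min d0 divr_gt0.
move=> x x0; rewrite lt_min => /andP[xd xe].
have [->|xy] := eqVneq x y; first by rewrite subrr normr0 ltW.
have xy0 : x - y != 0 by rewrite subr_eq0.
have := H (x - y); rewrite /ball_/= sub0r normrN subrK => /(_ xd xy0 x0).
rewrite /hl_quotient subrK => lq.
have : `|(x - y)^-1 * (f x - f y)| <= K.
  rewrite -(subrK l (_ * _)) (le_trans (ler_normD _ _))// addrC lerD2l.
  by rewrite distrC ltW.
rewrite normrM normfV mulrC ler_pdivrMr ?normr_gt0// => /le_trans; apply.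
by rewrite mulrC -ler_pdivlMr// ltW.
Qed.

(** At an interior point the condition [0 <= h + y] holds for all small [h], so the half-line filter
    is the usual punctured one. *)
Lemma hl_derivable_is_derive f (y : R) : hl_derivable f -> 0 < y ->
  is_derive y 1 f (hl_derive f y).
Proof.
move=> df y0.
have cv : hl_quotient f y @ 0^' --> hl_derive f y.
  move=> P /(df _ (ltW y0)); rewrite /hl_filter /within /nbhs/= => H.
  have A : \forall h \near 0^', 0 <= h + y.
    apply: nbhs_dnbhs; exists y => //= h.
    by rewrite /ball_/= sub0r normrN ltr_norml => /andP[yh _]; rewrite -lerBlDr sub0r ltW.
  by apply: filterS2 A H => h hA hP; exact: hP.
have E : (fun h : R => h^-1 *: (f (h *: (1 : R) + y) - f y)) = hl_quotient f y.
  by apply/funext => h; rewrite /hl_quotient /GRing.scale/= mulr1.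
apply: DeriveDef.
  by rewrite /derivable E; apply/cvg_ex; exists (hl_derive f y).
by rewrite /derive E; apply: cvg_lim.
Qed.

Lemma is_derive_ler f f' (a b : R) : a <= b ->
  (forall x, a <= x <= b -> is_derive x 1 f (f' x)) ->
  (forall x, a <= x <= b -> 0 <= f' x) -> f a <= f b.
Proof.
move=> ab df f'0.
have [||c cab fE] := @MVT_segment _ f f' a b ab.
- by move=> x /itvP xab; apply: df; rewrite !xab.
- apply: derivable_within_continuous => x /itvP xab.
  by apply: ex_derive; apply: df; rewrite !xab.
by rewrite -subr_ge0 fE mulr_ge0 ?subr_ge0// f'0// !(itvP cab).
Qed.

(** * Decay of the weight and its moments *)

Section weight_function.
Variable psi : R -> R.
Hypothesis psi_ge0 : forall y : R, 0 <= y -> 0 <= psi y.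
Hypothesis psi_d : hl_derivable psi.
Hypothesis psi_dd : hl_derivable (hl_derive psi).
Hypothesis psi1_gt0 : forall y : R, 0 <= y -> 0 < hl_derive psi y.
Hypothesis psi2_ge0 : forall y : R, 0 <= y -> 0 <= hl_derive (hl_derive psi) y.

(** [psi] is unconstrained on negative reals. Clipping its argument at 0 gives a function continuous
    on the whole line, hence measurable, with the same values where the weight is used. *)
Definition hpsi (s : R) : R := expR (- psi (Num.max s 0)).

Lemma hpsi_ge0 s : 0 <= hpsi s. Proof. exact: expR_ge0. Qed.

Lemma hpsiE s : 0 <= s -> hpsi s = expR (- psi s).
Proof. by move=> s0; rewrite /hpsi max_l. Qed.

Lemma measurable_hpsi : measurable_fun setT (hpsi : measurableTypeR R -> measurableTypeR R).
Proof.
apply: continuous_measurable_fun => s; apply: continuous_comp; last exact: continuous_expR.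
apply: cvgN; apply/cvgrPdist_le => e e0 /=.
have s0 : 0 <= Num.max s 0 by rewrite le_max lexx orbT.
have [dl dl0 H] := hl_derivable_continuous psi_d s0 e0.
exists dl => //= x; rewrite /ball_/= => xs; rewrite distrC; apply: H.
  by rewrite le_max lexx orbT.
rewrite distrC in xs; apply: le_lt_trans xs.
rewrite ler_norml; have := ler_norm (x - s); have := ler_norm (- (x - s)).
rewrite normrN; set q := `|_| => h1 h2.
by rewrite /Num.max; case: ltP => ?; case: ltP => ?; apply/andP; split; lra.
Qed.

Lemma psi_incr (a b : R) : 0 < a -> a <= b -> psi a <= psi b.
Proof.
move=> a0 ab; apply: (is_derive_ler ab (f' := hl_derive psi)).
  by move=> x /andP[ax _]; apply: hl_derivable_is_derive => //; exact: lt_le_trans ax.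
by move=> x /andP[ax _]; apply/ltW/psi1_gt0; rewrite ltW// (lt_le_trans a0).
Qed.

(** Convexity: beyond 1 the slope is at least the slope at 1, and before 1 the left side is
    nonpositive. The base point is 1 rather than 0 so that all derivatives involved are two-sided.
    It yields the exponential decay of the weight. *)
Lemma psi_linear (y : R) : 0 <= y -> hl_derive psi 1 * (y - 1) <= psi y.
Proof.
move=> y0; have [y1|y1] := leP y 1.
  apply: (@le_trans _ _ 0); last exact: psi_ge0.
  by rewrite mulr_ge0_le0 ?subr_le0// ltW// psi1_gt0.
rewrite -subr_ge0; apply: (@le_trans _ _ (psi 1 - hl_derive psi 1 * (1 - 1))).
  by rewrite subrr mulr0 subr0 psi_ge0.
apply: (is_derive_ler (ltW y1) (f := fun y => psi y - hl_derive psi 1 * (y - 1))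
  (f' := fun y => hl_derive psi y - hl_derive psi 1)) => x /andP[x1 _].
  have x0 : 0 < x by exact: lt_le_trans x1.
  have d1 := hl_derivable_is_derive psi_d x0.
  have d2 : is_derive x (1 : R) (fun y => hl_derive psi 1 * (y - 1)) (hl_derive psi 1).
    by apply: is_derive_eq; rewrite subr0 /GRing.scale/= !mulr1.
  exact: is_derive1B d1 d2.
rewrite subr_ge0; apply: (is_derive_ler x1 (f' := hl_derive (hl_derive psi))).
  by move=> z /andP[z1 _]; apply: hl_derivable_is_derive => //; exact: lt_le_trans z1.
by move=> z /andP[z1 _]; apply: psi2_ge0; exact: le_trans z1.
Qed.

Lemma hmoment_fin k : (hmoment k (EFin \o hpsi) < +oo)%E.
Proof.
pose c := hl_derive psi 1; have c0 : 0 < c by exact: psi1_gt0.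
(* Half of the decay rate absorbs the power [s ^+ k]; the other half leaves an integrable
   exponential density. *)
pose d := c / 2; have d0 : 0 < d by rewrite divr_gt0.
pose K := k`!%:R / d ^+ k * expR c / d.
have K0 : 0 <= K by rewrite !mulr_ge0 ?invr_ge0 ?exprn_ge0 ?expR_ge0 ?ltW.
have pow (s : R) : 0 <= s -> s ^+ k * expR (- (d * s)) <= k`!%:R / d ^+ k.
  move=> s0; rewrite expRN ler_pdivrMr ?expR_gt0// mulrAC ler_pdivlMr ?exprn_gt0//.
  rewrite -exprMn (mulrC s) [leRHS]mulrC -ler_pdivrMr ?ltr0n ?fact_gt0//.
  case: (k) => [|j]; first by rewrite expr0 fact0 divr1 -expR0 ler_expR mulr_ge0// ltW.
  apply: le_trans (expR_ge1Dxn j _); last by rewrite mulr_ge0// ltW.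
  by rewrite lerDr.
have dom (s : R) : hpow k s * hpsi s <= K * exponential_pdf d s.
  rewrite /hpow; case: ifPn => s0; last by rewrite mul0r mulr_ge0// exponential_pdf_ge0// ltW.
  rewrite hpsiE// exponential_pdfE//= mulNr.
  rewrite (_ : K * _ = k`!%:R / d ^+ k * (expR c * expR (- (d * s)))); last first.
    by rewrite /K [LHS]mulrA mulfVK ?gt_eqF// -[LHS]mulrA.
  apply: (@le_trans _ _ (s ^+ k * (expR (c - c * s)))).
    by rewrite ler_wpM2l ?exprn_ge0// ler_expR; have := psi_linear s0; rewrite -/c; lra.
  rewrite (_ : c - c * s = (- (d * s)) + (c - d * s)); last by rewrite /d; field.
  by rewrite expRD expRD mulrA ler_wpM2r ?mulr_ge0 ?expR_ge0// pow.
have ig := integrableZl measurableT K (integrable_exponential_pdf d0).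
have mk : measurable_fun setT (fun s : measurableTypeR R => (hpow k s)%:E * (EFin \o hpsi) s)%E.
  by apply: emeasurable_funM; apply/measurable_EFinP; [exact: measurable_hpow|exact: measurable_hpsi].
have : lebesgue_measure.-integrable setT (fun s => (hpow k s)%:E * (EFin \o hpsi) s)%E.
  apply: le_integrable ig => // s _ /=.
  have Ke := mulr_ge0 K0 (exponential_pdf_ge0 (ltW d0) s).
  by rewrite lee_fin (ger0_norm Ke) (ger0_norm (mulr_ge0 (hpow_ge0 _ _) (expR_ge0 _))).
move=> /integrableP[_]; apply: le_lt_trans; rewrite le_eqVlt; apply/orP; left; apply/eqP.
by apply: eq_integral => s _; rewrite gee0_abs// mule_ge0// lee_fin ?hpow_ge0 ?expR_ge0.
Qed.

Lemma momentE r : moment psi r = fine (hmoment r (EFin \o hpsi)).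
Proof.
rewrite /moment /Rintegral hmoment_itv; congr fine; apply: eq_integral => s.
by rewrite inE/= in_itv/= andbT => s0; rewrite hpsiE// EFinM.
Qed.

Lemma moment_gt0 r : 0 < moment psi r.
Proof.
(* [fine] sends infinity to 0, so positivity of the moment relies on its finiteness too. *)
rewrite momentE fine_gt0// hmoment_fin andbT.
(* On [1, 2] the power is at least 1, and [psi] is increasing, so the weight is at least its value
   at 2. *)
apply: (@lt_le_trans _ _ (\int[lebesgue_measure]_(s in `[1%R, 2%R]) (expR (- psi 2))%:E)%E).
  rewrite integral_cst//= lebesgue_measure_itv/= lte_fin ltr1n/= -EFinD -EFinM lte_fin.
  by rewrite mulr_gt0 ?expR_gt0//; lra.
have mk : measurable_fun setT (fun s : measurableTypeR R => (hpow r s)%:E * (EFin \o hpsi) s)%E.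
  by apply: emeasurable_funM; apply/measurable_EFinP; [exact: measurable_hpow|exact: measurable_hpsi].
apply: (@le_trans _ _ (\int[lebesgue_measure]_(s in `[1%R, 2%R])
    ((hpow r s)%:E * (EFin \o hpsi) s))%E).
  apply: ge0_le_integral => //.
  - exact: measurable_funTS.
  - move=> s; rewrite /= in_itv/= => /andP[s1 s2].
    have s0 : 0 <= s by exact: le_trans s1.
    rewrite -EFinM lee_fin /hpow s0 hpsiE// (@le_trans _ _ (expR (- psi s)))//.
      by rewrite ler_expR lerN2 psi_incr// (lt_le_trans _ s1).
    by rewrite ler_peMl ?expR_ge0// exprn_ege1.
apply: ge0_subset_integral => //.
by move=> s _; rewrite mule_ge0// lee_fin ?hpow_ge0 ?expR_ge0.
Qed.

End weight_function.

End halfline.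

(** * Self-adjoint weighted composition operators *)

Section space.
Variables (R : realType) (n : nat) (psi : R -> R).
Hypothesis psi_ge0 : forall y : R, 0 <= y -> 0 <= psi y.
Hypothesis psi_d : hl_derivable psi.
Hypothesis psi_dd : hl_derivable (hl_derive psi).
Hypothesis psi1_gt0 : forall y : R, 0 <= y -> 0 < hl_derive psi y.
Hypothesis psi2_ge0 : forall y : R, 0 <= y -> 0 <= hl_derive (hl_derive psi) y.
Notation T := (measurableTypeR R).
Notation TT := (n.+1.-tuple (T * T)).
Notation lebC := (@lebesgue_Cn R n.+1).
Notation muC := (@mu_Cn R n.+1).
Notation V := 'cV[R[i]]_n.+1.
Notation h := (hpsi psi).
Implicit Types (f U : V -> R[i]) (p z : V).

Let w0 : R := n`!%:R / pi ^+ n.+1.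

Let w0_gt0 : 0 < w0.
Proof. by rewrite divr_gt0// ?ltr0n ?fact_gt0// exprn_gt0// pi_gt0. Qed.

Let mh := measurable_hpsi psi_d.
Let h0 := hpsi_ge0 psi.
Let hfin := hmoment_fin psi_ge0 psi_d psi_dd psi1_gt0 psi2_ge0.

Lemma weight_cvec (t : TT) : weight psi (cvec t) = h (sqnt t).
Proof. by rewrite /weight cnorm2_cvec hpsiE// sqnt_ge0. Qed.

Lemma ge0_integral_mu (F : TT -> \bar R) : measurable_fun setT F ->
  (forall t, 0 <= F t)%E -> (\int[muC]_t F t = w0%:E * \int[lebC]_t F t)%E.
Proof. by move=> mF F0; rewrite ge0_integral_mscale. Qed.

Lemma Rintegral_mu (F : TT -> R) : lebC.-integrable setT (EFin \o F) ->
  \int[muC]_t F t = w0 * \int[lebC]_t F t.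
Proof.
move=> iF; have mF := measurable_int _ iF.
rewrite /Rintegral integralE [in RHS]integralE.
rewrite (ge0_integral_mu (measurable_funepos mF) (funepos_ge0 _)).
rewrite (ge0_integral_mu (measurable_funeneg mF) (funeneg_ge0 _)).
have p1 := integrable_fin_num measurableT (integrable_funepos measurableT iF).
have p2 := integrable_fin_num measurableT (integrable_funeneg measurableT iF).
have H (A B : \bar R) : A \is a fin_num -> B \is a fin_num ->
    fine (w0%:E * A - w0%:E * B)%E = w0 * fine (A - B)%E.
  by case: A B => [a||] [b||]//= _ _; rewrite mulrBr.
exact: H.
Qed.

Lemma cint_mu (F : TT -> R[i]) : cintegrable lebC setT F ->
  cint muC setT F = w0%:C%C * cint lebC setT F.
Proof.
move=> [i1 i2]; apply/eqP; rewrite eq_complex /= !mul0r subr0 addr0.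
by rewrite (Rintegral_mu i1) (Rintegral_mu i2) !eqxx.
Qed.

Let integral_normE f :
  (\int[lebC]_t `|(EFin \o (fun t => nc (f (cvec t)) ^+ 2 * h (sqnt t))%R) t| =
   \int[lebC]_t (nc (f (cvec t)) ^+ 2 * h (sqnt t))%:E)%E.
Proof.
by apply: eq_integral => t _ /=; rewrite ger0_norm// mulr_ge0// sqr_ge0.
Qed.

Lemma in_F_integrable f : in_F psi f ->
  lebC.-integrable setT (EFin \o (fun t => nc (f (cvec t)) ^+ 2 * h (sqnt t))).
Proof.
move=> [hf fi].
have mf : measurable_fun setT (fun t : TT => nc (f (cvec t)) ^+ 2 * h (sqnt t)).
  apply: measurable_funM; last exact: measurableT_comp mh (@measurable_sqnt R n.+1).
  by apply: measurable_funX; apply: cmeasurable_nc => //; exact: cmeasurable_holomorphic.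
apply/integrableP; split; first exact/measurable_EFinP.
move: fi; under eq_integral do rewrite weight_cvec.
rewrite ge0_integral_mu; last 2 first.
- exact/measurable_EFinP.
- by move=> t; rewrite lee_fin mulr_ge0 ?sqr_ge0.
rewrite integral_normE.
set I := integral _ _ _; have : (0 <= I)%E.
  by apply: integral_ge0 => t _; rewrite lee_fin mulr_ge0 ?sqr_ge0.
by case: I => [r||]//= _; rewrite ?ltry// gt0_muley ?lte_fin.
Qed.

Lemma holomorphic_kernel p k : holomorphic (fun z => cdot z p ^+ k).
Proof.
move=> x.
have dp : differentiable (fun z => cdot z p : R[i]^o) x.
  rewrite (_ : (fun z => _) = \sum_(j < n.+1) (fun z => z j 0 *: ((p j 0)^* : R[i]^o))%R).
    by apply: differentiable_sum => j; apply: differentiableZl; exact: differentiable_coord.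
  by apply/funext => z; rewrite fct_sumE.
elim: k => [|k IH].
  by under eq_fun do rewrite expr0; exact: differentiable_cst.
under eq_fun do rewrite exprS.
exact: (@differentiableM _ _ (fun z => cdot z p : R[i]^o) _ _ dp IH).
Qed.

Lemma in_F_kernel p k : in_F psi (fun z => cdot z p ^+ k).
Proof.
split; first exact: holomorphic_kernel.
under eq_integral do rewrite weight_cvec.
have := integrable_kernel_sqr mh h0 hfin p k => /integrableP[mk].
rewrite (integral_normE (fun z => cdot z p ^+ k)) => ik; rewrite ge0_integral_mu//; last first.
  by move=> t; rewrite lee_fin mulr_ge0 ?sqr_ge0.
by rewrite lte_mul_pinfty// lee_fin ltW.
Qed.

(** [w0] times [hconst], the powers of pi cancelling. Its inverse is (k+n)(k+n-1)...(k+1) / (n!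
    c_(k+n)), the coefficient of degree [k] in the reproducing kernel on C^(n+1). *)
Definition kernel_norm k : R := n`!%:R * (k`!%:R / (k + n)`!%:R * moment psi (k + n)).

Lemma kernel_norm_gt0 k : 0 < kernel_norm k.
Proof.
by rewrite !mulr_gt0 ?invr_gt0 ?ltr0n ?fact_gt0 ?(moment_gt0 psi_ge0).
Qed.

(** The integrability is returned along with the value because [cint] can only be conjugated or
    rescaled for an integrable function, as happens when the two arguments are exchanged. *)
Lemma inner_kernelE f p k : in_F psi f ->
  cintegrable lebC setT (fun t =>
     f (cvec t) * ((cdot (cvec t) p ^+ k)^* )%R * (weight psi (cvec t))%:C%C) /\
  inner psi f (fun z => cdot z p ^+ k) =
  (kernel_norm k)%:C%C * fcoef (fun t : R => f (cis t *: p)) k.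
Proof.
move=> Ff; have [hf _] := Ff; have If := in_F_integrable Ff.
have [m1 ig fg] := holomorphic_kernel_dom mh h0 hfin p k hf If.
have i1 := cintegrable_dom measurableT m1 ig (fun t _ => fg t).
under eq_fun do rewrite weight_cvec.
split => //; rewrite -[LHS]/(cint muC setT (fun t => f (cvec t) *
  ((cdot (cvec t) p ^+ k)^* )%R * (weight psi (cvec t))%:C%C)).
under eq_fun do rewrite weight_cvec.
rewrite (cint_mu i1) (holomorphic_reproduction p k mh h0 hfin hf If) mulrA.
congr (_ * _); rewrite -rmorphM; congr (_%:C)%C.
rewrite /hconst /kernel_norm momentE /w0; field.
by rewrite pnatr_eq0 -lt0n fact_gt0 expf_neq0// gt_eqF// pi_gt0.
Qed.

Lemma inner_kernel f p k : in_F psi f -> inner psi f (fun z => cdot z p ^+ k) =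
  (kernel_norm k)%:C%C * fcoef (fun t : R => f (cis t *: p)) k.
Proof. by move=> /inner_kernelE -/(_ p k)[]. Qed.

Lemma fcoef_cst (c : R[i]) : fcoef (fun=> c) 0 = c.
Proof.
transitivity (cmean (fun=> c : R[i])); last exact: cmean_cst.
by apply: eq_cint => t _; rewrite expr0 mulr1.
Qed.


Lemma cintegrable_conj (F : TT -> R[i]) : cintegrable lebC setT F ->
  cintegrable lebC setT (fun t => ((F t)^*)%R).
Proof.
move=> [i1 i2]; split.
  by apply: eq_integrable i1 => // t _ /=; rewrite cRe_conj.
by apply: eq_integrable (integrableN i2) => // t _ /=; rewrite cIm_conj.
Qed.

Lemma conjC_of_real (x : R) : ((x%:C%C : R[i])^* )%R = x%:C%C.
Proof. by rewrite conjE /= oppr0. Qed.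

(** The constant 1 is written as the kernel power with [p = 0] and [k = 0], so that pairing [f] with
    it is a case of reproduction, on a circle reduced to the origin; conjugate symmetry puts it on
    the left. *)
Lemma inner_one f : in_F psi f ->
  inner psi (fun z => cdot z 0 ^+ 0) f = (kernel_norm 0)%:C%C * ((f 0)^* )%R.
Proof.
move=> Ff; have [i1 E] := inner_kernelE 0 0 Ff.
have -> : inner psi (fun z => cdot z 0 ^+ 0) f =
    ((inner psi f (fun z => cdot z 0 ^+ 0))^* )%R.
  rewrite -[RHS]/(((cint muC setT (fun t => f (cvec t) *
    ((cdot (cvec t) 0 ^+ 0)^* )%R * (weight psi (cvec t))%:C%C))^* )%R).
  rewrite (cint_mu i1) rmorphM/= -(cint_conj measurableT i1) conjC_of_real.
  rewrite -(cint_mu (cintegrable_conj i1)).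
  apply: eq_cint => t _; rewrite !rmorphM/= conjCK conjC_of_real.
  by rewrite [in RHS](mulrC (_^*)%R).
rewrite E; under eq_fun do rewrite scaler0.
by rewrite fcoef_cst rmorphM/= conjC_of_real.
Qed.


(** * The symbol of a self-adjoint operator *)

Section self_adjoint.
Variables (U : V -> R[i]) (G : V -> V).
Hypothesis bdd : bounded_operator psi (wcomp U G).
Hypothesis sa : self_adjoint psi (wcomp U G).

Let UE : wcomp U G (fun z => cdot z 0 ^+ 0) = U.
Proof. by apply/funext => z; rewrite /wcomp expr0 mulr1. Qed.

Let U_F : in_F psi U.
Proof. by have [H _ _] := bdd; rewrite -UE; apply: H; exact: in_F_kernel. Qed.

Lemma symbol_fcoef p k :
  (kernel_norm k)%:C%C * fcoef (fun t : R => U (cis t *: p)) k =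
  (kernel_norm 0)%:C%C * ((U 0)^* )%R * cdot p (G 0) ^+ k.
Proof.
have [TF _ _] := bdd.
have Fq := in_F_kernel p k; have F1 := in_F_kernel 0 0.
have := sa F1 Fq; rewrite UE (inner_kernel _ _ U_F) => ->.
rewrite (inner_one (TF _ Fq)) -mulrA; congr (_ * _).
rewrite /wcomp rmorphM rmorphXn/=; congr (_ * _ ^+ _).
rewrite /cdot rmorph_sum/=; apply: eq_bigr => j _.
by rewrite rmorphM/= conjCK mulrC.
Qed.

Lemma symbol_real : ((U 0)^* )%R = U 0.
Proof.
have := symbol_fcoef 0 0; rewrite expr0 mulr1.
under eq_fun do rewrite scaler0.
rewrite fcoef_cst => /mulfI H; symmetry; apply: H.
by rewrite eq_complex /= negb_and gt_eqF// kernel_norm_gt0.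
Qed.

Lemma kernel_norm0 : kernel_norm 0 = moment psi n.
Proof.
by rewrite /kernel_norm add0n fact0 mul1r mulrA divff ?mul1r// pnatr_eq0 -lt0n fact_gt0.
Qed.

Let alpha := (moment psi n)%:C%C * ((U 0)^* )%R.

Let S p N := \sum_(n <= r < N)
  ((r ^_ n)%:R / moment psi r)%:C%C * cdot p (G 0) ^+ (r - n).

(** The Fourier coefficients of U along [2 *: p] are, up to 2^k, terms of the kernel series, and
    Taylor's formula at 1/2 compares U p with their partial sum. The upper index [N.+1 + n]
    corresponds to degrees up to [N]. *)
Lemma symbol_partial_sum p : exists M : R, 0 <= M /\ forall N,
  nc (U p - alpha * (n`!%:R^-1 * S p (N.+1 + n))) <= 2^-1 ^+ N.+1 * M.
Proof.
have [hU _] := U_F.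
(* Slicing along [2 *: p] places [p] at parameter 1/2, strictly inside the unit disc, which gives
   the rate 2^-N. The factors 2^k and (1/2)^k cancel term by term. *)
pose g (w : R[i]) := U (w *: (2 *: p)).
have gd w : exists d, cdiff g w d.
  have [d dP] := holomorphic_slice 0 (2 *: p) hU w; exists d.
  by move: dP; congr (cdiff _ _ _); apply/funext => v; rewrite add0r.
have [M M0 gM] := holomorphic_bounded (\sum_j nc (2 * p j 0)) hU.
have gcis t : nc (g (cis t)) <= M.
  apply: gM => j; rewrite mxE ncM nc_cis mul1r mxE (bigD1 j)//= lerDl.
  by apply: sumr_ge0 => i _; exact: nc_ge0.
have z2 : nc (2^-1 : R[i]) = 2^-1 by rewrite ncV nc_nat.
have z1 : nc (2^-1 : R[i]) < 1 by rewrite z2 invf_lt1// ltr1n.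
exists (2 * ((M + nc (g (2^-1))) / (1 - nc (2^-1 : R[i])))); split.
  by rewrite mulr_ge0 ?divr_ge0 ?subr_ge0 ?addr_ge0 ?nc_ge0// ltW.
move=> N; have := taylor_remainder N gd z1 gcis.
rewrite z2; congr (nc _ <= _).
have -> : g (2^-1) = U p by rewrite /g scalerA mulVf ?scale1r// pnatr_eq0.
congr (_ - _); rewrite /S -[X in \sum_(X <= _ < _) _]add0n big_addn addnK big_mkord !mulr_sumr.
apply: eq_bigr => k _; rewrite addnK.
have k0 : (kernel_norm k)%:C%C != 0 :> R[i].
  by rewrite eq_complex /= negb_and gt_eqF// kernel_norm_gt0.
apply: (mulfI k0); rewrite mulrCA symbol_fcoef kernel_norm0 -/alpha.
have -> : cdot (2 *: p) (G 0) = 2 * cdot p (G 0).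
  by rewrite /cdot mulr_sumr; apply: eq_bigr => j _; rewrite mxE mulrA.
rewrite exprMn (mulrCA _ alpha) [LHS]mulrA [in LHS](mulrCA _ _ (_ ^+ k)).
rewrite /kernel_norm.
have -> : ((k + n) ^_ n)%:R = (k + n)`!%:R / k`!%:R :> R.
  apply: (canRL (mulfK _)); first by rewrite pnatr_eq0 -lt0n fact_gt0.
  by rewrite -natrM -[X in (_ * X`!)%N](addnK n k) ffact_fact// leq_addl.
have -> : n`!%:R^-1 = (n`!%:R^-1 : R)%:C%C :> R[i] by rewrite fmorphV rmorph_nat.
rewrite [RHS]mulrCA; set a : R := _ * (_ * moment _ _).
rewrite (mulrA (_^-1)%:C%C) -rmorphM (mulrA a%:C%C) -rmorphM.
rewrite (_ : a * _ = 1).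
  have p2 : 2 ^+ k != 0 :> R[i] by rewrite expf_neq0// pnatr_eq0.
  by rewrite mul1r exprVn; move: (2 ^+ k) p2 => b b0; field.
have f0 m : m`!%:R != 0 :> R by rewrite pnatr_eq0 -lt0n fact_gt0.
have m0 : moment psi (k + n) != 0 by rewrite gt_eqF// (moment_gt0 psi_ge0).
rewrite /a; move: (n`!%:R) (k`!%:R) ((k + n)`!%:R) (f0 n) (f0 k) (f0 (k + n)%N).
move: (moment _ _) m0 => a0 a00 a1 a2 a3 a10 a20 a30.
by field; rewrite a00 a10 a20 a30.
Qed.

(** For nonzero [alpha] the convergence of the kernel series at this point is obtained from U
    itself, dividing the estimate by [alpha]. For [alpha = 0] the estimate alone gives U p = 0, and
    the value of the [lim] in [kernel_series] does not matter. *)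
Lemma symbol_rkernel p : U p = alpha * rkernel psi (G 0) p.
Proof.
have [M [M0 HM]] := symbol_partial_sum p.
have small (K e : R) : 0 < e -> \forall N \near \oo, 2^-1 ^+ N.+1 * K < e.
  have h1 : `|2^-1 : R| < 1 by rewrite ger0_norm ?invr_ge0// invf_lt1 ?ltr1n.
  move=> e0; have /cvgrPdist_lt/(_ _ e0) := cvg_geometric (2^-1 * K) h1.
  apply: filterS => N /=.
  by rewrite sub0r normrN mulrAC -exprS => /(le_lt_trans (ler_norm _)).
have [a0|a0] := eqVneq alpha 0.
  rewrite a0 mul0r; apply/eqP; rewrite -nc_eq0 -normr_le0 (ger0_norm (nc_ge0 _)).
  apply/ler_addgt0Pl => e e0; rewrite addr0.
  have [N _ /(_ N (leqnn N)) NM] := small M e e0.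
  apply: le_trans (ltW NM); have := HM N.
  by rewrite a0 mul0r subr0.
rewrite /rkernel /kernel_series /=.
suff cv : (fun N => S p N : R[i]^o) @ \oo --> (U p / alpha * n`!%:R : R[i]^o).
  rewrite (cvg_lim _ cv)//.
  have : n`!%:R != 0 :> R[i] by rewrite pnatr_eq0 -lt0n fact_gt0.
  by move: (n`!%:R) => b b0; field; rewrite a0 b0.
(* The shift by [n.+1] turns index [N] into the partial sum of degrees up to [N], the one that was
   estimated. *)
rewrite -(cvg_shiftn n.+1) /=.
apply/cvgrPdist_lt => e e0.
have [eR Re0] : e = (Re e)%:C%C /\ 0 < Re e.
  by move: e0; rewrite ltcE/=; case: (e) => a b /= /andP[/eqP ->].
pose c : R[i] := n`!%:R / alpha.
apply: filterS (small (nc c * M) _ Re0) => N NM.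
rewrite eR nc_normr ltcR addnS -addSn.
have -> : U p / alpha * n`!%:R - S p (N.+1 + n) =
    c * (U p - alpha * (n`!%:R^-1 * S p (N.+1 + n))).
  have : n`!%:R != 0 :> R[i] by rewrite pnatr_eq0 -lt0n fact_gt0.
  by rewrite /c; move: (n`!%:R) => b b0; field; rewrite a0 b0.
rewrite ncM; apply: le_lt_trans NM; by rewrite [leRHS]mulrCA ler_wpM2l ?nc_ge0.
Qed.

End self_adjoint.

End space.

Theorem theorem2p5 (R : realType) (n : nat) (psi : R -> R) (l : R)
  (C : 'M[R[i]]_n) (D : 'cV[R[i]]_n) (U : 'cV[R[i]]_n -> R[i])
  (n_ge1 : (1 <= n)%N)
  (psi_ge0 : forall y : R, 0 <= y -> 0 <= psi y)
  (psi_C3 : hl_C3 psi)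
  (psi1_gt0 : forall y : R, 0 <= y -> 0 < hl_derive psi y)
  (psi2_ge0 : forall y : R, 0 <= y -> 0 <= hl_derive (hl_derive psi) y)
  (psi3_ge0 : forall y : R, 0 <= y -> 0 <= hl_derive (hl_derive (hl_derive psi)) y)
  (l_lt : l < 2^-1)
  (phi_growth : let phi := fun y => y * hl_derive psi y in
    hl_derive (hl_derive phi) =O_ (pinfty_filter R)
      (fun y => y `^ (- 2^-1) * hl_derive phi y `^ (1 + l)))
  (psi_growth : (1 < n)%N ->
    hl_derive (hl_derive psi) =O_ (pinfty_filter R)
      (fun y => y `^ (- 2^-1) * hl_derive psi y `^ (1 + l)))
  (C_unit : C \in unitmx) (C_le1 : opnorm C <= 1) (D_neq0 : D != 0)
  (U_hol : holomorphic U)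
  (bdd : bounded_operator psi (wcomp U (affine C D)))
  (sa : self_adjoint psi (wcomp U (affine C D))) :
  let alpha := (moment psi n.-1)%:C%C * (U 0)^* in
  let case_i := U 0 = 0 /\
    (forall z, U z = 0) /\
    (forall f, in_F psi f -> forall z, wcomp U (affine C D) f z = 0) in
  let case_ii := U 0 <> 0 /\
    (ctranspose C = C ->
       kernel_series n psi (cdot (invmx (ctranspose C) *m D) D) =
       kernel_series n psi (cdot (invmx C *m D) D)) in
  alpha \is Num.real /\
  (forall z, U z = alpha * rkernel psi (affine C D 0) z) /\
  (case_i \/ case_ii) /\ ~ (case_i /\ case_ii).
Proof.
case: n => // n in C D U n_ge1 psi_growth C_unit C_le1 D_neq0 U_hol bdd sa *.
have [psi_d psi_dd _ _] := psi_C3.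
move=> alpha case_i case_ii.
have UE z : U z = alpha * rkernel psi (affine C D 0) z.
  exact: (symbol_rkernel psi_ge0 psi_d psi_dd psi1_gt0 psi2_ge0 bdd sa).
split.
  rewrite /alpha (symbol_real psi_ge0 psi_d psi_dd psi1_gt0 psi2_ge0 bdd sa).
  rewrite CrealE rmorphM/= conjC_of_real.
  by rewrite (symbol_real psi_ge0 psi_d psi_dd psi1_gt0 psi2_ge0 bdd sa).
split; first exact: UE.
split; last by case=> -[U0 _] [U0' _]; exact: U0'.
(* When [U 0] is nonzero, substituting C^* = C makes the two series of (ii) the same expression.
   When it is zero, so is [alpha], and U vanishes by the kernel formula. *)
have [U0|U0] := eqVneq (U 0) 0; last by right; split => [|->//]; exact/eqP.
have Uz z : U z = 0 by rewrite UE /alpha U0 rmorph0 mulr0 mul0r.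
by left; split => //; split => // f _ z; rewrite /wcomp Uz mul0r.
Qed.
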